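(* Let $c>0$, $T>0$, $r>1/2$ and $0<\gamma\le 1$. Assume that the exact solution $u$ of $$\partial_t u=i\langle\partial_x^2\rangle_c u-\frac{i}{4}\langle\partial_x^2\rangle_c^{-1}\left[2c(u+\overline{u})+\partial_{x}^2(u+\overline{u})^2\right]$$ with periodic boundary conditions on $\Omega=(-\pi,\pi)$ satisfies $u(t)\in H^{1+r+2\gamma}$ for $0\le t\le T$, with $\|u\|_{L^\infty(0,T;H^{1+r+2\gamma})}<\infty$. Let $u^0=u(0)$ and $u^{n+1}=\Psi^\tau(u^n)$ for $n\ge0$, where $\Psi^\tau$ is the second-order exponential-type integrator defined in the context. Then there exists a constant $\tau_0>0$ such that for all step sizes $0<\tau\le\tau_0$ and all $n\ge 0$ with $t_n=n\tau\le T$, $$\|u(t_n)-u^n\|_r\le C\tau^{1+\gamma},$$ where $C$ depends on $T$, $c$, $r$ and $\|u\|_{L^\infty(0,T;H^{1+r+2\gamma})}$.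
   Context: All functions are $2\pi$-periodic in $x$, $\Omega=(-\pi,\pi)$, with Fourier coefficients $\widehat f_k=\frac1{2\pi}\int_\Omega f(x)e^{-ikx}dx$. For $m\in\mathbb R$, $\|f\|_m^2=\sum_{k\in\mathbb Z}(1+k^2)^m|\widehat f_k|^2$, and $H^m$ is the space of periodic functions (distributions if $m<0$) with finite $\|\cdot\|_m$; $\|\cdot\|=\|\cdot\|_0$; $(f,g)=\frac1{2\pi}\int_\Omega f\overline g\,dx$. Operators act as Fourier multipliers: $\partial_x^2$ by $-k^2$; $\langle\partial_x^2\rangle_c=\sqrt{\partial_x^4-\partial_x^2+c}$ by $\sqrt{k^4+k^2+c}$; $A=\partial_x^2+\langle\partial_x^2\rangle_c$; $e^{is\partial_x^2}$ by $e^{-isk^2}$; $\partial_x^{-2}$ by $-1/k^2$ for $k\ne0$ and by $0$ for $k=0$. Let $\psi_1(z)=\int_0^1e^{zs}ds$, $\psi_2(z)=\int_0^1se^{zs}ds$ for $z\in\mathbb{C}$; $\psi_j(2i\tau\partial_x^2)$ acts by $\psi_j(-2i\tau k^2)$. A solution of the equation on $[0,T]$ is understood in the sense of Duhamel's formula: $u(t)=e^{it\langle\partial_x^2\rangle_c}u(0)-\frac i4\int_0^te^{i(t-s)\langle\partial_x^2\rangle_c}\langle\partial_x^2\rangle_c^{-1}\left[2c(u+\overline u)+\partial_x^2(u+\overline u)^2\right](s)\,ds$. The second-order integrator is $$\Psi^\tau(f)=e^{i\tau\langle\partial_x^2\rangle_c}f+\mathcal L(f)+\frac{\partial_x^2}{4}\langle\partial_x^2\rangle_c^{-1}e^{i\tau\langle\partial_x^2\rangle_c}\Big(-i\big[I_1^\tau(f)+\overline{I_1^\tau(f)}+2I_2^\tau(f)+I_3^\tau(f)-\tau\overline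 f^2\big]-A\big[J_1^\tau(f,f)+2J_2^\tau(f,f)+J_3^\tau(f,f)\big]$$ $$\qquad+2\big[J_1^\tau(f,\mathcal P(f))+J_2^\tau(\mathcal P(f),f)\big]-2\big[J_3^\tau(f,\mathcal P(f))+J_2^\tau(f,\mathcal P(f))\big]\Big),$$ where $$\mathcal P(f)=Af-\frac14\langle\partial_x^2\rangle_c^{-1}\left[2c(f+\overline f)+\partial_x^2(f+\overline f)^2\right],$$ $$\mathcal L(f)=-\frac{ic\tau}{2}\langle\partial_x^2\rangle_c^{-1}e^{i\tau\langle\partial_x^2\rangle_c}\Big[f-\frac{i\tau}{2}(Af-\mathcal P(f))+\psi_1(2i\tau\partial_x^2)\overline f-i\tau\psi_2(2i\tau\partial_x^2)\big(A\overline f+\overline{\mathcal P(f)}\big)\Big],$$ $$I_1^\tau(f)=\int_0^\tau e^{is\partial_x^2}(e^{-is\partial_x^2}f)^2ds,\quad I_2^\tau(f)=\int_0^\tau e^{is\partial_x^2}|e^{-is\partial_x^2}f|^2ds,\quad I_3^\tau(f)=\tau\psi_1(2i\tau\partial_x^2)(\overline f)^2,$$ $$J_1^\tau(f,g)=\int_0^\tau se^{is\partial_x^2}(e^{-is\partial_x^2}f)(e^{-is\partial_x^2}g)ds,\quad J_2^\tau(f,g)=\int_0^\tau se^{is\partial_x^2}(e^{-is\partial_x^2}f)(e^{is\partial_x^2}\overline g)ds,$$ $$J_3^\tau(f,g)=-\frac{i\tau}2e^{2i\tau\partial_x^2}\partial_x^{-2}(\overline{fg})+\frac{i\tau}2\psi_1(2i\tau\partial_x^2)\partial_x^{-2}(\overline{fg})+\frac{\tau^2}2(\overline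 f,g).$$ In each integral $e^{is\partial_x^2}$ on the far left acts on the whole product following it. *)

(* Defs.v *)
From mathcomp Require Import all_boot all_order all_algebra.
From mathcomp Require Import all_classical all_reals all_analysis.
From mathcomp Require Import ess_sup_inf complex.
Import Order.TTheory GRing.Theory Num.Theory.
Import numFieldNormedType.Exports.

Set Implicit Arguments.
Unset Strict Implicit.
Unset Printing Implicit Defensive.

Local Open Scope classical_set_scope.
Local Open Scope complex_scope.
Local Open Scope ring_scope.

Section PeriodicFunctions.
Context {R : realType}.
Local Notation C := R[i].
Local Notation I := (0 +i* 1 : C).
Local Notation mu := (@lebesgue_measure R).
Implicit Types (f g : R -> C) (m s tau c : R) (k : int).

Definition cexp (z : C) : C :=
  (expR (complex.Re z))%:C *
  (cos (complex.Im z) +i* sin (complex.Im z)).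

Definition cintegral (D : set R) (f : R -> C) : C :=
  (\int[mu]_(x in D) complex.Re (f x)) +i*
  (\int[mu]_(x in D) complex.Im (f x)).

Definition Omega : set R := `]- pi, pi[.

Definition fourier_coef f k : C :=
  ((2 * pi)^-1)%:C *
  cintegral Omega (fun x => f x * cexp (- (I * (k%:~R * x)%:C))).

Definition inner f g : C :=
  ((2 * pi)^-1)%:C * cintegral Omega (fun x => f x * (g x)^*).

Definition sobolev_norm m f : \bar R :=
  sqrte (\esum_(k in [set: int])
    ((1 + (k%:~R : R) ^+ 2) `^ m * Normc.normc (fourier_coef f k) ^+ 2)%:E).

(* For m >= 0 only: elements of H^m are then integrable functions, determined
   up to a null set by their Fourier coefficients. *)
Definition in_sobolev m f : Prop :=
  [/\ forall x, f (x + 2 * pi) = f x,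
      mu.-integrable Omega (fun x => (complex.Re (f x))%:E),
      mu.-integrable Omega (fun x => (complex.Im (f x))%:E) &
      (sobolev_norm m f < +oo)%E].

(* The norm being nonnegative, extending it by 0 outside ]0, T[ does not change
   the essential supremum. *)
Definition sobolev_Linfty_norm (T : R) m (u : R -> R -> C) : \bar R :=
  ess_sup mu ((fun t => sobolev_norm m (u t)) \_ `]0, T[).

(* H^m is separable, so that strong measurability of t |-> u t amounts to
   the measurability of all the coordinates (Pettis). *)
Definition in_sobolev_Linfty (T : R) m (u : R -> R -> C) : Prop :=
  (forall k,
     measurable_fun (`[0, T] : set R)
       (fun t => complex.Re (fourier_coef (u t) k)) /\
     measurable_fun (`[0, T] : set R)
       (fun t => complex.Im (fourier_coef (u t) k))) /\
  (sobolev_Linfty_norm T m u < +oo)%E.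

(* Sum over all k in Z, as the limit of the sums over -N <= k <= N. *)
Definition bilateral_sum (a : int -> C) : C :=
  let S N := \sum_(j < N.*2.+1) a (j%:Z - N%:Z) in
  lim ((fun N => complex.Re (S N)) @ \oo) +i*
  lim ((fun N => complex.Im (S N)) @ \oo).

Definition fourier_mult (p : int -> C) f : R -> C :=
  fun x => bilateral_sum
    (fun k => p k * fourier_coef f k * cexp (I * (k%:~R * x)%:C)).

(* Compositions of multipliers are formed on symbols, since intermediate results
   such as \partial_x^2 (f + \bar f)^2 need not be functions. *)

Definition dx2 k : C := - (k%:~R ^+ 2).

Definition dx2_inv k : C := if k == 0 then 0 else - (k%:~R ^+ 2)^-1.

Definition bracket c k : C :=
  (Num.sqrt ((k%:~R : R) ^+ 4 + k%:~R ^+ 2 + c))%:C.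

Definition opA c k : C := dx2 k + bracket c k.

Definition exp_dx2 s k : C := cexp (I * s%:C * dx2 k).

Definition exp_bracket c s k : C := cexp (I * s%:C * bracket c k).

Definition psi1 (z : C) : C := cintegral `[0, 1] (fun s => cexp (z * s%:C)).

Definition psi2 (z : C) : C :=
  cintegral `[0, 1] (fun s => s%:C * cexp (z * s%:C)).

Definition psi1_dx2 tau k : C := psi1 (2 * I * tau%:C * dx2 k).

Definition psi2_dx2 tau k : C := psi2 (2 * I * tau%:C * dx2 k).

Definition conjf f : R -> C := fun x => (f x)^*.

(* <\partial_x^2>_c^{-1} [2 c (f + \bar f) + \partial_x^2 (f + \bar f)^2] *)
Definition nonlin c f : R -> C := fun x =>
  fourier_mult (fun k => (bracket c k)^-1 * (2 * c%:C))
    (fun y => f y + conjf f y) x +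
  fourier_mult (fun k => (bracket c k)^-1 * dx2 k)
    (fun y => (f y + conjf f y) ^+ 2) x.

(* Function-valued time integrals are taken pointwise in x, here and in I1, I2,
   J1, J2: for arguments in H^m, m > 1/2, the integrands are absolutely
   convergent Fourier series, so that point evaluation commutes with the
   Bochner integral.  Elements of H^m are only determined a.e., hence the
   equality a.e. in x at every t. *)
Definition duhamel_solution c (T : R) (u : R -> R -> C) : Prop :=
  forall t, 0 <= t <= T ->
  {ae mu, forall x,
    u t x = fourier_mult (exp_bracket c t) (u 0) x -
      I / 4 * cintegral `[0, t]
        (fun s => fourier_mult (exp_bracket c (t - s)) (nonlin c (u s)) x)}.

Definition opP c f : R -> C := fun x =>
  fourier_mult (opA c) f x - 4^-1 * nonlin c f x.

Definition opL c tau f : R -> C := fun x =>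
  - (I * c%:C * tau%:C / 2) *
  fourier_mult (fun k => (bracket c k)^-1 * exp_bracket c tau k)
    (fun y =>
      f y
      - I * tau%:C / 2 * (fourier_mult (opA c) f y - opP c f y)
      + fourier_mult (psi1_dx2 tau) (conjf f) y
      - I * tau%:C * fourier_mult (psi2_dx2 tau)
          (fun z => fourier_mult (opA c) (conjf f) z + conjf (opP c f) z) y) x.

Definition I1 tau f : R -> C := fun x =>
  cintegral `[0, tau] (fun s =>
    fourier_mult (exp_dx2 s)
      (fun y => fourier_mult (exp_dx2 (- s)) f y ^+ 2) x).

Definition I2 tau f : R -> C := fun x =>
  cintegral `[0, tau] (fun s =>
    fourier_mult (exp_dx2 s)
      (fun y => `| fourier_mult (exp_dx2 (- s)) f y | ^+ 2) x).

Definition I3 tau f : R -> C := fun x =>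
  tau%:C * fourier_mult (psi1_dx2 tau) (fun y => conjf f y ^+ 2) x.

Definition J1 tau f g : R -> C := fun x =>
  cintegral `[0, tau] (fun s =>
    s%:C * fourier_mult (exp_dx2 s)
      (fun y => fourier_mult (exp_dx2 (- s)) f y *
                fourier_mult (exp_dx2 (- s)) g y) x).

Definition J2 tau f g : R -> C := fun x =>
  cintegral `[0, tau] (fun s =>
    s%:C * fourier_mult (exp_dx2 s)
      (fun y => fourier_mult (exp_dx2 (- s)) f y *
                fourier_mult (exp_dx2 s) (conjf g) y) x).

Definition J3 tau f g : R -> C := fun x =>
  - (I * tau%:C / 2) *
    fourier_mult (fun k => exp_dx2 (2 * tau) k * dx2_inv k)
      (fun y => (f y * g y)^*) x
  + I * tau%:C / 2 *
    fourier_mult (fun k => psi1_dx2 tau k * dx2_inv k)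
      (fun y => (f y * g y)^*) x
  + tau%:C ^+ 2 / 2 * inner (conjf f) g.

Definition integrator c tau f : R -> C := fun x =>
  let Pf := opP c f in
  fourier_mult (exp_bracket c tau) f x + opL c tau f x +
  fourier_mult (fun k => dx2 k / 4 * (bracket c k)^-1 * exp_bracket c tau k)
    (fun y =>
      - I * (I1 tau f y + (I1 tau f y)^* + 2 * I2 tau f y + I3 tau f y
             - tau%:C * conjf f y ^+ 2)
      - fourier_mult (opA c)
          (fun z => J1 tau f f z + 2 * J2 tau f f z + J3 tau f f z) y
      + 2 * (J1 tau f Pf y + J2 tau Pf f y)
      - 2 * (J3 tau f Pf y + J2 tau f Pf y)) x.

End PeriodicFunctions.

(* Main.v *)
Require Import Defs.
From mathcomp Require Import all_boot all_order all_algebra.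
From mathcomp Require Import all_classical all_reals all_analysis.
From mathcomp Require Import measurable_realfun ess_sup_inf complex.
From mathcomp Require Import ring lra.
From mathcomp Require Import zify.
Import Order.TTheory GRing.Theory Num.Theory.
Import numFieldNormedType.Exports.
Import Normc.

Set Implicit Arguments.
Unset Strict Implicit.
Unset Printing Implicit Defensive.

Local Open Scope classical_set_scope.
Local Open Scope complex_scope.
Local Open Scope ring_scope.

Local Notation Re := complex.Re.
Local Notation Im := complex.Im.

(** The proof is carried out on Fourier coefficients.  For r > 1/2 the sequences
    with finite norm of H^r are summable and form an algebra under convolution,
    with a constant that is uniform for r in an interval of length 2
    ([sob_le_conv]); and an integrable function is determined by its coefficients
    ([fourier_uniqueness]).  Hence each function occurring in the integrator is
    the sum of its Fourier series, and products turn into convolutions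
    ([fourier_rep], [repM]).  With B the symbol of the bracket, the flow and the
    integrator both become
      exp(itB) (a - i/4 times the integral over [0, t] of B^-1 (2c X - k^2 Y) ds)
    and differ in X and Y only ([duhamel_flow], [scheme], [rep_scheme]): for the
    flow v, X = exp(-isB) h and Y = exp(-isB) (h * h) with h = v + conj v.

    Local error.  The symbol A = B - k^2 is bounded, so that exp(isB) is
    exp(isk^2) times a factor that can be expanded in s without any loss of
    derivatives.  A phase of size t (1 + k^2) differs from 1 by t^gamma at the
    price of 2 gamma derivatives ([phase_bound]).  Together this gives
      v(s) = exp(isk^2) (f + is P(f)) + O(t^(1 + gamma)) in H^r
    ([flow_first_order]).  Inserting it in X and Y and expanding exp(-isA) as
    well ([sob_filon], [sob_square_expansion]) yields exactly the X of the
    integrator ([Q1_filon]).  Its Y differs from the expansion in the products of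
    two conjugates, where the integrator changes the phase in order to integrate
    in closed form; the difference is governed by sums with the factor
    exp(2isj(k - j)) - 1 ([Q2_filon]).  One power of s is obtained there from one
    derivative on each factor, and a further t^gamma from 2 gamma derivatives:
    this is where 1 + r + 2 gamma derivatives are needed ([sob_Delta],
    [sob_Q2_filon]).  The error of one step is therefore O(t^(2 + gamma))
    ([local_error]).

    Stability.  All terms are compositions of bounded multipliers and
    convolutions, so that one step is Lipschitz with constant 1 + Lt on balls of
    H^r ([scheme_stable]).  The discrete Gronwall argument closes because the
    error stays below 1, whence the iterates stay in the ball of radius one more
    than the bound of the solution ([global_error]).  That bound, given at almost
    all times, holds at all times since each coefficient is continuous in time
    ([sol_ball]). *)

(** * Complex modulus and imaginary exponentials *)

Section ComplexModulus.
Context {R : realType}.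
Local Notation C := R[i].
Implicit Types (z w : C) (x y t : R).

Lemma normc_sqr z : normc z ^+ 2 = Re z ^+ 2 + Im z ^+ 2.
Proof. by case: z => a b; rewrite /= sqr_sqrtr // addr_ge0 // sqr_ge0. Qed.

Lemma normc_ge0 z : 0 <= normc z.
Proof. by case: z => a b; exact: sqrtr_ge0. Qed.

Lemma normc_le_sqr z K : 0 <= K -> (normc z <= K) = (normc z ^+ 2 <= K ^+ 2).
Proof. by move=> K0; rewrite ler_sqr // nnegrE normc_ge0. Qed.

Lemma Re_le_normc z : `|Re z| <= normc z.
Proof.
by rewrite -ler_sqr ?nnegrE ?normr_ge0 ?normc_ge0 // real_normK ?num_real //
  normc_sqr lerDl sqr_ge0.
Qed.

Lemma Im_le_normc z : `|Im z| <= normc z.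
Proof.
by rewrite -ler_sqr ?nnegrE ?normr_ge0 ?normc_ge0 // real_normK ?num_real //
  normc_sqr lerDr sqr_ge0.
Qed.

Lemma normc_le_ReIm z : normc z <= `|Re z| + `|Im z|.
Proof.
rewrite normc_le_sqr ?addr_ge0 // normc_sqr sqrrD !real_normK ?num_real //.
by rewrite addrAC lerDl mulrn_wge0 // mulr_ge0.
Qed.

Lemma normc_conj z : normc z^* = normc z.
Proof. by case: z => a b; rewrite /= sqrrN. Qed.

Lemma normc_real x : normc x%:C = `|x|.
Proof. by rewrite /= expr0n addr0 sqrtr_sqr. Qed.

Lemma normc_I : normc (0 +i* 1 : C) = 1.
Proof. by rewrite /= expr0n add0r expr1n sqrtr1. Qed.

Lemma normcB z w : normc (z - w) <= normc z + normc w.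
Proof. by rewrite (le_trans (le_normcD _ _)) // normcN. Qed.

Lemma normc_sum (I : Type) (s : seq I) (F : I -> C) :
  normc (\sum_(i <- s) F i) <= \sum_(i <- s) normc (F i).
Proof.
elim: s => [|i s IH]; first by rewrite !big_nil normc0.
by rewrite !big_cons (le_trans (le_normcD _ _)) // lerD2l.
Qed.

Lemma normc_nat n : normc (n%:R : C) = n%:R.
Proof. by rewrite -(rmorph_nat (real_complex R)) normc_real normr_nat. Qed.

Lemma Re_D z w : Re (z + w) = Re z + Re w. Proof. by case: z; case: w. Qed.
Lemma Im_D z w : Im (z + w) = Im z + Im w. Proof. by case: z; case: w. Qed.
Lemma Re_M z w : Re (z * w) = Re z * Re w - Im z * Im w.
Proof. by case: z => a b; case: w. Qed.
Lemma Im_M z w : Im (z * w) = Re z * Im w + Im z * Re w.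
Proof. by case: z => a b; case: w. Qed.
Lemma Re_N z : Re (- z) = - Re z. Proof. by case: z. Qed.
Lemma Im_N z : Im (- z) = - Im z. Proof. by case: z. Qed.
Lemma Re_conjc z : Re z^* = Re z. Proof. by case: z. Qed.
Lemma Im_conjc z : Im z^* = - Im z. Proof. by case: z. Qed.
Lemma Re_sum (I : Type) (s : seq I) (F : I -> C) :
  Re (\sum_(i <- s) F i) = \sum_(i <- s) Re (F i).
Proof.
by elim: s => [|i s IH]; rewrite ?big_nil // !big_cons Re_D IH.
Qed.
Lemma Im_sum (I : Type) (s : seq I) (F : I -> C) :
  Im (\sum_(i <- s) F i) = \sum_(i <- s) Im (F i).
Proof.
by elim: s => [|i s IH]; rewrite ?big_nil // !big_cons Im_D IH.
Qed.
Lemma ReImP z w : Re z = Re w -> Im z = Im w -> z = w.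
Proof. by case: z => a b; case: w => a' b' /= -> ->. Qed.

Definition expi t : C := cos t +i* sin t.

Lemma cexp_expi t : cexp (Complex 0 1 * t%:C) = expi t.
Proof.
have -> : Complex 0 1 * t%:C = Complex 0 t.
  by apply: ReImP; rewrite /=; ring.
by rewrite /cexp /= expR0 mul1r.
Qed.

Lemma expi0 : expi 0 = 1. Proof. by rewrite /expi cos0 sin0. Qed.
Lemma expiD s t : expi (s + t) = expi s * expi t.
Proof.
by apply: ReImP; rewrite ?Re_M ?Im_M /= ?cosD ?sinD // addrC.
Qed.
Lemma expi_conj t : (expi t)^* = expi (- t).
Proof. by rewrite /expi /= cosN sinN. Qed.
Lemma normc_expi t : normc (expi t) = 1.
Proof. by rewrite /= cos2Dsin2 sqrtr1. Qed.
Lemma expiN t : expi t * expi (- t) = 1.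
Proof. by rewrite -expiD subrr expi0. Qed.

Lemma sin_abs_le t : `|sin t| <= `|t|.
Proof.
wlog t0 : t / 0 <= t => [H|].
  by have [/H//|/ltW] := leP 0 t; rewrite -oppr_ge0 => /H; rewrite sinN !normrN.
have [x _] := @MVT_segment R (@sin R) (@cos R) 0 t t0
  (fun x _ => is_derive_sin x) (continuous_subspaceT (@continuous_sin R)).
rewrite sin0 !subr0 => ->; rewrite normrM ler_piMl //.
by rewrite ler_norml cos_geN1 cos_le1.
Qed.

Lemma one_sub_cos t : 1 - cos t <= t ^+ 2 / 2.
Proof.
have -> : cos t = 1 - 2 * sin (t / 2) ^+ 2.
  have {1}-> : t = t / 2 + t / 2 by field.
  have := cos2Dsin2 (t / 2); rewrite cosD => H; lra.
have : sin (t / 2) ^+ 2 <= (t / 2) ^+ 2.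
  by rewrite -[leLHS]real_normK ?num_real // -[leRHS]real_normK ?num_real //
    ler_sqr ?nnegrE // sin_abs_le.
nra.
Qed.

Lemma expi_sub1_sqr t : normc (expi t - 1) ^+ 2 = 2 * (1 - cos t).
Proof.
rewrite normc_sqr Re_D Im_D /=.
have := cos2Dsin2 t; set a := cos t; set b := sin t => H.
by rewrite oppr0 addr0 sqrrD sqrrN; lra.
Qed.

Lemma expi_sub1_le t : normc (expi t - 1) <= `|t|.
Proof.
rewrite normc_le_sqr // expi_sub1_sqr real_normK ?num_real //.
by have := one_sub_cos t; lra.
Qed.

Lemma expi_sub1_le2 t : normc (expi t - 1) <= 2.
Proof.
by rewrite (le_trans (normcB _ _)) // normc_expi normc1 -natr1.
Qed.

(** The imaginary part is an increment of sin x - x, whose derivative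
    cos x - 1 is itself at most |x| in modulus. *)
Lemma expi_sub1_taylor t :
  normc (expi t - 1 - Complex 0 1 * t%:C) <= 2 * t ^+ 2.
Proof.
rewrite (le_trans (normc_le_ReIm _)) //.
have -> : Re (expi t - 1 - Complex 0 1 * t%:C) = cos t - 1.
  by rewrite /= !mulr0 !mul0r subrr oppr0 addr0.
have -> : Im (expi t - 1 - Complex 0 1 * t%:C) = sin t - t.
  by rewrite /= mulr0 mul1r add0r oppr0 addr0.
have h1 : `|cos t - 1| <= t ^+ 2 / 2.
  by rewrite ler0_norm ?subr_le0 ?cos_le1 // opprB one_sub_cos.
suff h2 : `|sin t - t| <= t ^+ 2 by have := sqr_ge0 t; lra.
rewrite {h1}; wlog t0 : t / 0 <= t => [H|].
  have [/H//|/ltW] := leP 0 t; rewrite -oppr_ge0 => /H.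
  by rewrite sinN sqrrN -opprD normrN.
have [x xin] := @MVT_segment R (fun x => sin x - x) (fun x => cos x - 1) 0 t t0
  (fun x _ => is_deriveB _ _) (continuous_subspaceT
     (fun x => cvgB (@continuous_sin R x) (@cvg_id _ _))).
rewrite sin0 !subr0 => ->; rewrite normrM expr2 (ger0_norm t0) ler_wpM2r //.
move: xin; rewrite in_itv /= => /andP[x0 xt].
apply: (@le_trans _ _ x) => //; rewrite -[leRHS]ger0_norm //.
apply: le_trans (expi_sub1_le x).
have -> : cos x - 1 = Re (expi x - 1) by [].
exact: Re_le_normc.
Qed.

(** Interpolation between the bounds |t| and 2: it is how a fractional power of
    the step size is traded for a fractional number of derivatives. *)
Lemma expi_sub1_powR t g : 0 < g -> g <= 1 ->
  normc (expi t - 1) <= 2 * `|t| `^ g.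
Proof.
move=> g0 g1; have [t1|/ltW t1] := leP `|t| 1.
  have [->|tn0] := eqVneq t 0.
    by rewrite expi0 subrr normc0 mulr_ge0 // powR_ge0.
  apply: le_trans (expi_sub1_le _) _.
  have h : `|t| <= `|t| `^ g.
    by apply: ger1_powR => //; rewrite normr_gt0 tn0.
  by have := powR_ge0 `|t| g; lra.
apply: le_trans (expi_sub1_le2 _) _; rewrite ler_pMr //.
by rewrite -(powRr0 `|t|) ler_powR // ltW.
Qed.

End ComplexModulus.

(** * Sums over the integers *)

Section Sums.
Context {R : realType}.
Implicit Types (f : int -> R) (s : seq int) (K : R).

Lemma sum_pos_subset f s (t : seq int) : (forall k, 0 <= f k) ->
  uniq s -> uniq t -> {subset s <= t} ->
  \sum_(k <- s) f k <= \sum_(k <- t) f k.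
Proof.
move=> f0 us ut st.
rewrite (perm_big ([seq k <- t | k \in s])) /=; last first.
  apply: uniq_perm => //; first exact: filter_uniq.
  move=> k; rewrite mem_filter; case: (boolP (k \in s)) => //= ks.
  by rewrite st.
by rewrite big_filter [leRHS](bigID [in s]) /= lerDl sumr_ge0.
Qed.

(** The indices of a symmetric partial sum, as a duplicate-free list: this
    makes [bilateral_sum] comparable with sums over arbitrary finite sets. *)
Definition window (N : nat) : seq int :=
  [seq (j%:Z - N%:Z)%R | j <- iota 0 N.*2.+1].

Lemma window_uniq N : uniq (window N).
Proof.
rewrite map_inj_uniq ?iota_uniq // => i j /eqP.
by rewrite (inj_eq (addIr _)) => /eqP[].
Qed.

Lemma mem_window N k : (k \in window N) = (`|k| <= N%:Z).
Proof.
apply/mapP/idP => [[j]|].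
  rewrite mem_iota /= add0n => jN ->.
  rewrite ler_norml; apply/andP; split; lia.
rewrite ler_norml => /andP[h1 h2].
exists (absz (k + N%:Z)); first by rewrite mem_iota /=; lia.
lia.
Qed.

Lemma sum_window_le f K : (forall k, 0 <= f k) ->
  (forall N, \sum_(k <- window N) f k <= K) ->
  forall s, uniq s -> \sum_(k <- s) f k <= K.
Proof.
move=> f0 fK s us; pose N := (\max_(k <- s) absz k)%N.
apply: le_trans (fK N); apply: sum_pos_subset => //; first exact: window_uniq.
move=> k ks; rewrite mem_window -abszE lez_nat.
by rewrite /N (big_rem k) //= leq_maxl.
Qed.

Lemma windowS (V : zmodType) (F : int -> V) N :
  \sum_(k <- window N.+1) F k =
  \sum_(k <- window N) F k + (F N.+1%:Z + F (- N.+1%:Z)).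
Proof.
rewrite (perm_big [:: N.+1%:Z, - N.+1%:Z & window N]) /=; last first.
  apply: uniq_perm; first exact: window_uniq.
    by rewrite 2!cons_uniq window_uniq andbT in_cons !mem_window; lia.
  have H (k : int) : (`|k| <= N.+1%:Z) =
      [|| k == N.+1%:Z, k == - N.+1%:Z | `|k| <= N%:Z] by lia.
  by move=> k; rewrite mem_window 2!in_cons mem_window H.
by rewrite !big_cons addrA addrC.
Qed.

Lemma window0 (V : zmodType) (F : int -> V) : \sum_(k <- window 0) F k = F 0.
Proof. by rewrite /window /= big_seq1 subrr. Qed.

(** Grouping the terms of indices n and -n turns the symmetric partial sums
    into those of an ordinary absolutely convergent series. *)
Lemma window_cvg f K : (forall s, uniq s -> \sum_(k <- s) `|f k| <= K) ->
  cvgn (fun N => \sum_(k <- window N) f k).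
Proof.
move=> fK.
pose y n := if n is m.+1 then f m.+1%:Z + f (- m.+1%:Z) else f 0.
have E (g : int -> R) (z := fun n => if n is m.+1 then g m.+1%:Z + g (- m.+1%:Z) else g 0) N :
    series z N.+1 = \sum_(k <- window N) g k.
  elim: N => [|N IH].
    by rewrite window0 /series /= big_nat1.
  by rewrite windowS -IH /series /= big_nat_recr.
have -> : (fun N => \sum_(k <- window N) f k) = [sequence series y n.+1]_n.
  by apply/funext => N; rewrite /= E.
have cy : cvgn (series y).
  apply: normed_cvg; apply: nondecreasing_is_cvgn.
    by move=> n m nm; apply: (@nondecreasing_series _ (fun i => `|y i|) xpredT 0) => // i _ _.
  exists K => _ [n _ <-].
  pose g k : R := `|f k|.
  apply: (@le_trans _ _ (series (fun n => if n is m.+1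
      then g m.+1%:Z + g (- m.+1%:Z) else g 0) n.+1)).
    rewrite /series /= big_nat_recr //= -[leLHS]addr0 lerD //; last first.
      by case: n => [|n]; rewrite ?addr_ge0 /g ?normr_ge0.
    by apply: ler_sum_nat => -[|m] //= _; exact: ler_normD.
  by rewrite E /g fK // window_uniq.
apply/cvg_ex; exists (limn (series y)).
by rewrite (cvg_shiftS (series y)).
Qed.

End Sums.

Section BilateralSum.
Context {R : realType}.
Local Notation C := R[i].
Implicit Types (a b : int -> C) (s : seq int) (K : R) (z : C).

(** Summability through a bound on the finite sums: only the bound enters the
    estimates, and no infinite sum has to be formed. *)
Definition l1_le a K := forall s, uniq s -> \sum_(k <- s) normc (a k) <= K.

Definition has_bsum a z :=
  (fun N => Re (\sum_(k <- window N) a k)) @ \oo --> Re z /\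
  (fun N => Im (\sum_(k <- window N) a k)) @ \oo --> Im z.

Lemma sum_window a N :
  \sum_(j < N.*2.+1) a (j%:Z - N%:Z) = \sum_(k <- window N) a k.
Proof. by rewrite /window big_map -[X in iota _ X]subn0 -/(index_iota _ _) big_mkord. Qed.

Lemma has_bsum_eq a z : has_bsum a z -> bilateral_sum a = z.
Proof.
move=> [hr hi]; rewrite /bilateral_sum.
under eq_fun do rewrite sum_window.
under [X in _ +i* lim (X @ _)]eq_fun do rewrite sum_window.
by rewrite (cvg_lim _ hr) // (cvg_lim _ hi) //; case: z {hr hi}.
Qed.

Lemma l1_le_bsum a K : l1_le a K -> has_bsum a (bilateral_sum a).
Proof.
move=> aK.
have cR : cvgn (fun N => \sum_(k <- window N) Re (a k)).
  apply: (@window_cvg _ _ K) => s us; apply: le_trans (aK s us).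
  by apply: ler_sum => k _; exact: Re_le_normc.
have cI : cvgn (fun N => \sum_(k <- window N) Im (a k)).
  apply: (@window_cvg _ _ K) => s us; apply: le_trans (aK s us).
  by apply: ler_sum => k _; exact: Im_le_normc.
suff h : has_bsum a (Complex (limn (fun N => \sum_(k <- window N) Re (a k)))
    (limn (fun N => \sum_(k <- window N) Im (a k)))).
  by rewrite (has_bsum_eq h).
split=> /=.
- by under eq_fun do rewrite Re_sum.
- by under eq_fun do rewrite Im_sum.
Qed.

Lemma has_bsumD a b z w : has_bsum a z -> has_bsum b w ->
  has_bsum (fun k => a k + b k) (z + w).
Proof.
move=> [ar ai] [br bi]; split.
- rewrite Re_D; under eq_fun do rewrite big_split Re_D; exact: cvgD.
- rewrite Im_D; under eq_fun do rewrite big_split Im_D; exact: cvgD.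
Qed.

Lemma has_bsumZ a z w : has_bsum a z -> has_bsum (fun k => w * a k) (w * z).
Proof.
move=> [ar ai]; split.
- rewrite Re_M; under eq_fun do rewrite -mulr_sumr Re_M.
  by apply: cvgB; apply: cvgM => //; exact: cvg_cst.
- rewrite Im_M; under eq_fun do rewrite -mulr_sumr Im_M.
  by apply: cvgD; apply: cvgM => //; exact: cvg_cst.
Qed.

Lemma has_bsum_conj a z : has_bsum a z -> has_bsum (fun k => (a k)^*) z^*.
Proof.
move=> [ar ai]; split.
- rewrite Re_conjc; under eq_fun do rewrite -rmorph_sum Re_conjc; exact: ar.
- rewrite Im_conjc; under eq_fun do rewrite -rmorph_sum Im_conjc; exact: cvgN.
Qed.

Lemma perm_window_opp N : perm_eq (map -%R (window N)) (window N).
Proof.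
apply: uniq_perm; rewrite ?(map_inj_uniq oppr_inj) ?window_uniq //.
move=> k; rewrite mem_window; apply/mapP/idP => [[j]|kN].
  by rewrite mem_window => jN ->; rewrite normrN.
by exists (- k); rewrite ?opprK // mem_window normrN.
Qed.

Lemma has_bsum_opp a z : has_bsum a z -> has_bsum (fun k => a (- k)) z.
Proof.
have E N : \sum_(k <- window N) a (- k) = \sum_(k <- window N) a k.
  by rewrite -[RHS](perm_big _ (perm_window_opp N)) [RHS]big_map.
by move=> [ar ai]; split; under eq_fun do rewrite E.
Qed.

Lemma has_bsum_le a z K : has_bsum a z ->
  (forall N, normc (\sum_(k <- window N) a k) <= K) -> normc z <= K.
Proof.
move=> [ar ai] aK.
have K0 : 0 <= K by apply: le_trans (aK 0%N); exact: normc_ge0.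
rewrite normc_le_sqr // normc_sqr.
have c : (fun N => Re (\sum_(k <- window N) a k) ^+ 2 +
    Im (\sum_(k <- window N) a k) ^+ 2) @ \oo --> Re z ^+ 2 + Im z ^+ 2.
  by apply: cvgD; rewrite ?expr2; under eq_fun do rewrite expr2; exact: cvgM.
rewrite -(cvg_lim _ c) //; apply: limr_le; first by apply/cvg_ex; eexists; exact: c.
by apply: nearW => N; rewrite -normc_sqr -normc_le_sqr.
Qed.

Lemma l1_le_normc a K : l1_le a K -> normc (bilateral_sum a) <= K.
Proof.
move=> aK; apply: (has_bsum_le (l1_le_bsum aK)) => N.
by apply: le_trans (normc_sum _ _) _; apply: aK; exact: window_uniq.
Qed.

Lemma l1_le_dom a b K : l1_le b K -> (forall k, normc (a k) <= normc (b k)) ->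
  l1_le a K.
Proof.
by move=> bK ab s us; apply: le_trans (bK s us); exact: ler_sum.
Qed.

Lemma l1_leD a b Ka Kb : l1_le a Ka -> l1_le b Kb ->
  l1_le (fun k => a k + b k) (Ka + Kb).
Proof.
move=> ha hb s us; apply: le_trans (lerD (ha s us) (hb s us)).
by rewrite -big_split; apply: ler_sum => k _; exact: le_normcD.
Qed.

Lemma l1_leZ a K z : l1_le a K -> l1_le (fun k => z * a k) (normc z * K).
Proof.
move=> ha s us; under eq_bigr do rewrite normcM.
by rewrite -mulr_sumr ler_wpM2l ?normc_ge0 // ha.
Qed.

Lemma bilateral_sumD a b Ka Kb : l1_le a Ka -> l1_le b Kb ->
  bilateral_sum (fun k => a k + b k) = bilateral_sum a + bilateral_sum b.
Proof.
by move=> ha hb; apply/has_bsum_eq/has_bsumD; apply: l1_le_bsum; eassumption.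
Qed.

Lemma bilateral_sumZ a z K : l1_le a K ->
  bilateral_sum (fun k => z * a k) = z * bilateral_sum a.
Proof.
by move=> ha; apply/has_bsum_eq/has_bsumZ; apply: l1_le_bsum; eassumption.
Qed.

Lemma bilateral_sum_conj a K : l1_le a K ->
  bilateral_sum (fun k => (a k)^*) = (bilateral_sum a)^*.
Proof.
by move=> ha; apply/has_bsum_eq/has_bsum_conj; apply: l1_le_bsum; eassumption.
Qed.

Lemma bilateral_sum_opp a K : l1_le a K ->
  bilateral_sum (fun k => a (- k)) = bilateral_sum a.
Proof.
by move=> ha; apply/has_bsum_eq/has_bsum_opp; apply: l1_le_bsum; eassumption.
Qed.

End BilateralSum.

(** * The weights 1 + k^2 *)

Section Weights.
Context {R : realType}.
Implicit Types (r : R) (k j : int) (s t : seq int).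

Definition weight r k : R := (1 + k%:~R ^+ 2) `^ r.

Lemma weight_base k : 1 <= 1 + (k%:~R : R) ^+ 2.
Proof. by rewrite lerDl sqr_ge0. Qed.

Lemma weight_gt0 r k : 0 < weight r k.
Proof. by apply: powR_gt0; apply: lt_le_trans (weight_base k). Qed.

Lemma weight_ge0 r k : 0 <= weight r k.
Proof. exact/ltW/weight_gt0. Qed.

Lemma weight_le r r' k : r <= r' -> weight r k <= weight r' k.
Proof. by move=> rr'; apply: ler_powR => //; exact: weight_base. Qed.

Lemma weight0 k : weight 0 k = 1.
Proof. exact: powRr0. Qed.

Lemma weight_ge1 r k : 0 <= r -> 1 <= weight r k.
Proof. by move=> r0; rewrite -(weight0 k) weight_le. Qed.

Lemma weightD r r' k : weight (r + r') k = weight r k * weight r' k.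
Proof.
rewrite /weight powRD //; apply/implyP => _.
by rewrite gt_eqF // (lt_le_trans _ (weight_base k)).
Qed.

Lemma weightN r k : weight r (- k) = weight r k.
Proof. by rewrite /weight rmorphN sqrrN. Qed.

(** The larger of |j| and |k - j| is at least |k| / 2. *)
Lemma weight_split r k j : 0 <= r ->
  weight r k <= 4 `^ r * (weight r j + weight r (k - j)).
Proof.
move=> r0; set u := weight r j; set v := weight r (k - j).
have h (y : R) : 0 <= y -> 1 + k%:~R ^+ 2 <= 4 * y ->
    weight r k <= 4 `^ r * y `^ r.
  move=> y0 le; rewrite -powRM // /weight ge0_ler_powR ?nnegrE ?mulr_ge0 //.
  by rewrite addr_ge0 ?sqr_ge0.
have b2 := weight_base j; have b3 := weight_base (k - j).
have u0 : 0 <= u := weight_ge0 _ _; have v0 : 0 <= v := weight_ge0 _ _.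
have f0 : (0 : R) <= 4 `^ r := powR_ge0 _ _.
have E : (k%:~R : R) = j%:~R + (k - j)%:~R by rewrite -rmorphD subrKC.
have [le|/ltW le] := leP (1 + (j%:~R : R) ^+ 2) (1 + (k - j)%:~R ^+ 2).
  apply: (@le_trans _ _ (4 `^ r * v)); last by rewrite ler_wpM2l // lerDr.
  apply: h => //; first lra.
  by rewrite E; move: le b2 b3; set a := j%:~R; set b := (k - j)%:~R; nra.
apply: (@le_trans _ _ (4 `^ r * u)); last by rewrite ler_wpM2l // lerDl.
apply: h => //; first lra.
by rewrite E; move: le b2 b3; set a := j%:~R; set b := (k - j)%:~R; nra.
Qed.

(** The mean value inequality for x^-q, by which the sums of n^-(1 + q)
    telescope. *)
Lemma inv_powR_telescope (q : R) (n : nat) : 0 < q ->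
  q * n.+2%:R `^ (- (1 + q)) <= n.+1%:R `^ (- q) - n.+2%:R `^ (- q).
Proof.
move=> q0; set x : R := n.+2%:R; have x0 : 0 < x by rewrite ltr0n.
have y0 : 0 < n.+1%:R :> R by rewrite ltr0n.
have yE : n.+1%:R = x * (1 - x^-1).
  by rewrite mulrBr mulr1 divff ?gt_eqF // /x -(natr1 n.+1) addrK.
have z0 : 0 < 1 - x^-1 by rewrite -(pmulr_rgt0 _ x0) -yE.
rewrite yE powRM ?(ltW x0) ?(ltW z0) // -{2}[x `^ (- q)]mulr1 -mulrBr.
have -> : x `^ (- (1 + q)) = x `^ (- q) * x^-1.
  rewrite opprD addrC powRD ?powR_inv1 ?(ltW x0) //.
  by apply/implyP => _; rewrite gt_eqF.
rewrite mulrCA ler_wpM2l ?powR_ge0 //.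
rewrite lerBrDr /powR gt_eqF //.
apply: (@le_trans _ _ (expR (q * x^-1))); first by rewrite addrC expR_ge1Dx.
rewrite ler_expR mulNr -mulrN ler_pM2l // lerNr.
have := @le_ln1Dx R (- x^-1); apply.
by rewrite ltrNl opprK; move: z0; rewrite subr_gt0.
Qed.

(** In the sum of (1 + k^2)^-r the terms k = 0, 1, -1 contribute at most 3, and
    the others at most twice the integral of x^(-2r) over [1, +oo[. *)
Definition zeta_bound r : R := 3 + 2 / (2 * r - 1).

Lemma inv_weight_sum_window r N : 1 / 2 < r ->
  \sum_(k <- window N) (weight r k)^-1 <= zeta_bound r.
Proof.
move=> r2; have q0 : 0 < 2 * r - 1 by lra.
set q := 2 * r - 1 in q0 *.
have w_le (n : nat) : (weight r n.+1%:Z)^-1 <= n.+1%:R `^ (- (1 + q)).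
  rewrite powRN lef_pV2 ?posrE ?powR_gt0 ?weight_gt0 ?ltr0n //.
  have -> : 1 + q = 2 * r by rewrite /q; lra.
  rewrite powRrM powR_mulrn ?ler0n // ge0_ler_powR ?nnegrE ?sqr_ge0 //; first lra.
  by rewrite lerDr.
suff H n : \sum_(k <- window n.+1) (weight r k)^-1 <=
    3 + 2 / q - 2 / q * n.+1%:R `^ (- q).
  case: N => [|n].
    rewrite window0 /weight expr0n addr0 powR1 invr1 /zeta_bound -/q.
    by have h : 0 <= 2 / q; [rewrite divr_ge0 // ltW|lra].
  apply: le_trans (H n) _; rewrite /zeta_bound -/q gerBl.
  by rewrite mulr_ge0 ?powR_ge0 // divr_ge0 // ltW.
elim: n => [|n IH].
  rewrite windowS window0 weightN powR1 mulr1 addrK.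
  have := w_le 0%N; rewrite powR1 => h.
  by rewrite [weight r 0]/weight expr0n addr0 powR1 invr1; lra.
rewrite windowS weightN.
have h1 := w_le n.+1; have h2 := @inv_powR_telescope q n q0.
have h3 : n.+2%:R `^ (- (1 + q)) <=
   (n.+1%:R `^ (- q) - n.+2%:R `^ (- q)) / q :> R.
  by rewrite ler_pdivlMr // mulrC.
move: h1 h3 IH; set A := _^-1; set B := _ `^ (- (1 + q)) => h1 h3 IH.
have -> : 2 / q * n.+2%:R `^ (- q) = 2 / q * n.+1%:R `^ (- q)
   - 2 * ((n.+1%:R `^ (- q) - n.+2%:R `^ (- q)) / q) by field; rewrite gt_eqF.
lra.
Qed.

(** The bound for r serves for all larger exponents; it makes the constants of
    the convolution estimates uniform in gamma. *)
Lemma inv_weight_sum r r' s : 1 / 2 < r -> r <= r' -> uniq s ->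
  \sum_(k <- s) (weight r' k)^-1 <= zeta_bound r.
Proof.
move=> r2 rr' us; apply: (@le_trans _ _ (\sum_(k <- s) (weight r k)^-1)).
  apply: ler_sum => k _.
  by rewrite lef_pV2 ?posrE ?weight_gt0 // weight_le.
apply: sum_window_le us => [k|N]; first by rewrite invr_ge0 weight_ge0.
exact: inv_weight_sum_window.
Qed.

(** Stated with p^2 <= u v, which spares square roots in the applications. *)
Lemma cauchy_schwarz_sum (I : Type) (s : seq I) (p u v : I -> R) :
  (forall i, 0 <= p i) -> (forall i, 0 <= u i) -> (forall i, 0 <= v i) ->
  (forall i, p i ^+ 2 <= u i * v i) ->
  (\sum_(i <- s) p i) ^+ 2 <= (\sum_(i <- s) u i) * (\sum_(i <- s) v i).
Proof.
move=> p0 u0 v0 H.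
elim: s => [|i s]; first by rewrite !big_nil expr0n mul0r.
rewrite !big_cons; set P := \sum_(_ <- _) _; set U := \sum_(_ <- _) _.
set V := \sum_(_ <- _) _ => IH.
have P0 : 0 <= P by apply: sumr_ge0.
have U0 : 0 <= U by apply: sumr_ge0.
have V0 : 0 <= V by apply: sumr_ge0.
have Hi := H i; have pi0 := p0 i; have ui0 := u0 i; have vi0 := v0 i.
move: (p i) (u i) (v i) Hi pi0 ui0 vi0 => x a b Hi x0 a0 b0.
have h : 2 * (x * P) <= a * V + U * b.
  rewrite -ler_sqr ?nnegrE ?addr_ge0 ?mulr_ge0 //.
  have h1 : (x * P) ^+ 2 <= (a * b) * (U * V).
    by rewrite exprMn ler_pM // sqr_ge0.
  have h2 := sqr_ge0 (a * V - U * b).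
  by nra.
nra.
Qed.

End Weights.

(** * Sobolev spaces of sequences and convolution *)

Section SobolevSequences.
Context {R : realType}.
Local Notation C := R[i].
Implicit Types (a b : int -> C) (s : seq int) (K r P d : R) (z : C).

Lemma le_of_eq (x y : R) : x = y -> x <= y. Proof. by move=> ->. Qed.

(** The norm in H^r of the function with coefficients a is at most K.  Bounding
    the finite sums avoids extended real numbers and questions of convergence. *)
Definition sob_le r a K :=
  0 <= K /\ forall s, uniq s ->
    \sum_(k <- s) weight r k * normc (a k) ^+ 2 <= K ^+ 2.

Lemma sob_le_ge0 r a K : sob_le r a K -> 0 <= K. Proof. by case. Qed.

(** Since the weight is (1 + k^2)^r, a multiplier of size (1 + k^2)^d costs 2d
    derivatives. *)
Lemma sob_le_gain r d a b K P : 0 <= P ->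
  (forall k, normc (b k) <= P * weight d k * normc (a k)) ->
  sob_le (r + 2 * d) a K -> sob_le r b (P * K).
Proof.
move=> P0 ab [K0 aK]; split; first exact: mulr_ge0.
move=> s us; rewrite exprMn.
apply: le_trans (ler_wpM2l (sqr_ge0 P) (aK s us)).
rewrite mulr_sumr; apply: ler_sum => k _.
have -> : 2 * d = d + d by rewrite mulrDl mul1r.
have -> : P ^+ 2 * (weight (r + (d + d)) k * normc (a k) ^+ 2) =
  weight r k * (P * weight d k * normc (a k)) ^+ 2 by rewrite 2!weightD; ring.
rewrite ler_wpM2l ?weight_ge0 //.
by rewrite ler_sqr ?nnegrE ?mulr_ge0 ?normc_ge0 ?weight_ge0.
Qed.

Lemma sob_le_dom P r a b K : 0 <= P ->
  (forall k, normc (b k) <= P * normc (a k)) ->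
  sob_le r a K -> sob_le r b (P * K).
Proof.
move=> P0 ab aK; apply: (@sob_le_gain r 0 a b K P P0); last by rewrite mulr0 addr0.
by move=> k; rewrite weight0 mulr1.
Qed.

Lemma sob_le_dom1 r a b K : (forall k, normc (b k) <= normc (a k)) ->
  sob_le r a K -> sob_le r b K.
Proof.
move=> ab aK; rewrite -[K]mul1r; apply: sob_le_dom aK => // k; rewrite mul1r.
exact: ab.
Qed.

Lemma sob_leZ r a K z : sob_le r a K -> sob_le r (fun k => z * a k) (normc z * K).
Proof. by apply: sob_le_dom; rewrite ?normc_ge0 // => k; rewrite normcM. Qed.

Lemma sob_le_weaken r r' a K K' : r' <= r -> K <= K' -> sob_le r a K ->
  sob_le r' a K'.
Proof.
move=> rr KK [K0 aK]; have K'0 : 0 <= K' by exact: le_trans KK.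
split=> // s us; apply: (@le_trans _ _ (K ^+ 2)); last by rewrite ler_sqr.
apply: le_trans (aK s us); apply: ler_sum => k _.
by rewrite ler_wpM2r ?sqr_ge0 // weight_le.
Qed.

Lemma sob_leD r a b Ka Kb : sob_le r a Ka -> sob_le r b Kb ->
  sob_le r (fun k => a k + b k) (Ka + Kb).
Proof.
move=> [Ka0 ha] [Kb0 hb]; split; first exact: addr_ge0.
move=> s us; have {ha}h1 := ha s us; have {hb}h2 := hb s us.
set X := \sum_(_ <- _) _ in h1; set Y := \sum_(_ <- _) _ in h2.
pose Q := \sum_(k <- s) weight r k * (normc (a k) * normc (b k)).
have Q0 : 0 <= Q.
  by apply: sumr_ge0 => k _; rewrite !mulr_ge0 ?normc_ge0 ?weight_ge0.
have hQ : Q ^+ 2 <= X * Y.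
  apply: cauchy_schwarz_sum => k; rewrite ?mulr_ge0 ?sqr_ge0 ?normc_ge0 ?weight_ge0 //.
  by apply: le_of_eq; ring.
have hQ' : Q <= Ka * Kb.
  rewrite -ler_sqr ?nnegrE ?mulr_ge0 //; apply: le_trans hQ _.
  rewrite exprMn ler_pM // ?sumr_ge0 // => k _.
    by rewrite mulr_ge0 ?sqr_ge0 ?weight_ge0.
  by rewrite mulr_ge0 ?sqr_ge0 ?weight_ge0.
apply: (@le_trans _ _ (X + 2 * Q + Y)); last by nra.
rewrite /X /Q /Y mulr_sumr -!big_split /=; apply: ler_sum => k _.
apply: (@le_trans _ _ (weight r k * (normc (a k) + normc (b k)) ^+ 2)).
  rewrite ler_wpM2l ?weight_ge0 // ler_sqr ?nnegrE ?addr_ge0 ?normc_ge0 //.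
  exact: le_normcD.
by apply: le_of_eq; ring.
Qed.

Lemma sob_leN r a K : sob_le r a K -> sob_le r (fun k => - a k) K.
Proof. by apply: sob_le_dom1 => k; rewrite normcN. Qed.

Lemma sob_leB r a b Ka Kb : sob_le r a Ka -> sob_le r b Kb ->
  sob_le r (fun k => a k - b k) (Ka + Kb).
Proof. by move=> ha hb; apply: sob_leD => //; exact: sob_leN. Qed.

Lemma sob_le0 r : sob_le r (fun=> 0) 0.
Proof.
split=> // s _; rewrite big1 ?expr0n // => k _.
by rewrite normc0 expr0n mulr0.
Qed.

Definition crefl a k : C := (a (- k))^*.

Lemma sob_le_crefl r a K : sob_le r a K -> sob_le r (crefl a) K.
Proof.
move=> [K0 aK]; split=> // s us.
have -> : \sum_(k <- s) weight r k * normc (crefl a k) ^+ 2 =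
   \sum_(k <- map -%R s) weight r k * normc (a k) ^+ 2.
  by rewrite big_map; apply: eq_bigr => k _; rewrite /crefl normc_conj weightN.
by apply: aK; rewrite map_inj_uniq //; exact: oppr_inj.
Qed.

Lemma sob_le_pt r a K k : 0 <= r -> sob_le r a K -> normc (a k) <= K.
Proof.
move=> r0 [K0 /(_ [:: k] isT)]; rewrite big_seq1 => h.
rewrite normc_le_sqr //; apply: le_trans h.
by rewrite ler_peMl ?sqr_ge0 // weight_ge1.
Qed.

Lemma zeta_bound_ge1 r : 1 / 2 < r -> 1 <= zeta_bound r.
Proof.
move=> r2; rewrite /zeta_bound.
have : 0 <= 2 / (2 * r - 1) by rewrite divr_ge0 //; lra.
lra.
Qed.

(** Cauchy-Schwarz against the summable sequence (1 + k^2)^-r. *)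
Lemma sob_le_l1 r a K : 1 / 2 < r -> sob_le r a K -> l1_le a (zeta_bound r * K).
Proof.
move=> r2 [K0 aK] s us; have Z1 := zeta_bound_ge1 r2.
have Z0 : 0 <= zeta_bound r by lra.
rewrite -ler_sqr ?nnegrE ?mulr_ge0 ?sumr_ge0 //; last by move=> *; exact: normc_ge0.
apply: (@le_trans _ _ (zeta_bound r * K ^+ 2)); last first.
  rewrite exprMn ler_wpM2r ?sqr_ge0 //; nra.
apply: (@le_trans _ _ ((\sum_(k <- s) (weight r k)^-1) *
   (\sum_(k <- s) weight r k * normc (a k) ^+ 2))).
  apply: cauchy_schwarz_sum => k.
  - exact: normc_ge0.
  - by rewrite invr_ge0 weight_ge0.
  - by rewrite mulr_ge0 ?weight_ge0 ?sqr_ge0.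
  - by rewrite mulrA mulVf ?mul1r // gt_eqF // weight_gt0.
apply: ler_pM => //; last exact: aK.
- by apply: sumr_ge0 => k _; rewrite invr_ge0 weight_ge0.
- by apply: sumr_ge0 => k _; rewrite mulr_ge0 ?weight_ge0 ?sqr_ge0.
- exact: inv_weight_sum.
Qed.

(** The norm is lower semicontinuous for convergence of each coefficient, as a
    supremum of finite sums. *)
Lemma sob_le_lim r (a_ : nat -> int -> C) a K :
  (forall N, sob_le r (a_ N) K) ->
  (forall k, (fun N => Re (a_ N k)) @ \oo --> Re (a k) /\
             (fun N => Im (a_ N k)) @ \oo --> Im (a k)) ->
  sob_le r a K.
Proof.
move=> aK aC; split; first exact: (sob_le_ge0 (aK 0%N)).
move=> s us.
have c : (fun N => \sum_(k <- s) weight r k * normc (a_ N k) ^+ 2) @ \oo -->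
    \sum_(k <- s) weight r k * normc (a k) ^+ 2.
  elim: s {us} => [|k s IH].
    by rewrite big_nil; under eq_fun do rewrite big_nil; exact: cvg_cst.
  rewrite big_cons; under eq_fun do rewrite big_cons.
  apply: cvgD => //; apply: cvgM; first exact: cvg_cst.
  have [cr ci] := aC k.
  rewrite normc_sqr; under eq_fun do rewrite normc_sqr.
  by apply: cvgD; rewrite ?expr2; under eq_fun do rewrite expr2; exact: cvgM.
rewrite -(cvg_lim _ c) //; apply: limr_le; first by apply/cvg_ex; eexists; exact: c.
by apply: nearW => N; exact: (aK N).2.
Qed.

Definition conv_const r : R := 2 * 4 `^ (r + 2) * zeta_bound r.

Lemma conv_const_ge1 r : 1 / 2 < r -> 1 <= conv_const r.
Proof.
move=> r2; have Z1 := zeta_bound_ge1 r2.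
have : 1 <= 4 `^ (r + 2) :> R.
  apply: (@le_trans _ _ (4 `^ 0)); first by rewrite powRr0.
  by rewrite ler_powR; lra.
rewrite /conv_const; nra.
Qed.

Lemma l1_le_mul r a b Ka Kb (c : int -> C) k : 0 <= r ->
  sob_le r a Ka -> sob_le r b Kb ->
  (forall j, normc (c j) <= normc (a j) * normc (b (k - j))) ->
  l1_le c (Ka * Kb).
Proof.
move=> r0 ha hb cab s us.
have Ka0 := sob_le_ge0 ha; have Kb0 := sob_le_ge0 hb.
have hsq (e : int -> C) K s' : sob_le r e K -> uniq s' ->
    \sum_(j <- s') normc (e j) ^+ 2 <= K ^+ 2.
  move=> [_ he] us'; apply: le_trans (he s' us'); apply: ler_sum => j _.
  by rewrite ler_peMl ?sqr_ge0 // weight_ge1.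
rewrite -ler_sqr ?nnegrE ?mulr_ge0 ?sumr_ge0 //; last by move=> *; exact: normc_ge0.
apply: (@le_trans _ _ ((\sum_(j <- s) normc (a j) ^+ 2) *
   (\sum_(j <- s) normc (b (k - j)) ^+ 2))).
  apply: cauchy_schwarz_sum => j; rewrite ?sqr_ge0 //; first exact: normc_ge0.
  by rewrite -exprMn ler_sqr ?nnegrE ?mulr_ge0 ?normc_ge0.
rewrite exprMn; apply: ler_pM.
- by apply: sumr_ge0 => *; exact: sqr_ge0.
- by apply: sumr_ge0 => *; exact: sqr_ge0.
- exact: hsq.
have -> : \sum_(j <- s) normc (b (k - j)) ^+ 2 =
  \sum_(j <- [seq k - j | j <- s]) normc (b j) ^+ 2 by rewrite big_map.
apply: hsq => //; rewrite map_inj_uniq // => x y /eqP.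
by rewrite (inj_eq (addrI _)) (inj_eq oppr_inj) => /eqP.
Qed.

(** H^r is an algebra for r > 1/2.  By Cauchy-Schwarz, with w the weight, the
    square of the sum over j is at most the sum of 1 / (w_j w_{k-j}) times that of
    w_j |a_j|^2 w_{k-j} |b_{k-j}|^2; by [weight_split], w_k times the first factor
    is at most 4^r times the sum of 1 / w_j + 1 / w_{k-j}.

    Only the moduli of the terms enter, which leaves room for oscillating factors
    depending on both k and j.  The constant is uniform for r in [r0, r0 + 2]. *)
Lemma sob_le_conv r0 r a b Ka Kb (c : int -> int -> C) : 1 / 2 < r0 ->
  r0 <= r -> r <= r0 + 2 -> sob_le r a Ka -> sob_le r b Kb ->
  (forall k j, normc (c k j) <= normc (a j) * normc (b (k - j))) ->
  sob_le r (fun k => bilateral_sum (c k)) (conv_const r0 * (Ka * Kb)).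
Proof.
move=> r2 r0r rr0 ha hb cab; have rp : 0 <= r by lra.
have Ka0 := sob_le_ge0 ha; have Kb0 := sob_le_ge0 hb.
have Z1 := zeta_bound_ge1 r2; have C1 := conv_const_ge1 r2.
(* It suffices to bound the symmetric partial sums in j. *)
apply: (@sob_le_lim r (fun N k => \sum_(j <- window N) c k j)); last first.
  by move=> k; exact: (l1_le_bsum (l1_le_mul rp ha hb (cab k))).
move=> N; split; first by rewrite !mulr_ge0 //; lra.
move=> s us; move: (window N) (window_uniq N) => t ut.
pose v k j := weight r j * normc (a j) ^+ 2 *
  (weight r (k - j) * normc (b (k - j)) ^+ 2).
have v0 k j : 0 <= v k j by rewrite !mulr_ge0 ?weight_ge0 ?sqr_ge0 ?normc_ge0.
have step k : weight r k * normc (\sum_(j <- t) c k j) ^+ 2 <=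
    conv_const r0 * \sum_(j <- t) v k j.
  have h1 : normc (\sum_(j <- t) c k j) ^+ 2 <=
      (\sum_(j <- t) (weight r j * weight r (k - j))^-1) * (\sum_(j <- t) v k j).
    apply: (@le_trans _ _ ((\sum_(j <- t) normc (a j) * normc (b (k - j))) ^+ 2)).
      rewrite ler_sqr ?nnegrE ?normc_ge0 ?sumr_ge0 //; last first.
        by move=> j _; rewrite mulr_ge0 ?normc_ge0.
      by apply: le_trans (normc_sum _ _) _; exact: ler_sum.
    apply: cauchy_schwarz_sum => j //.
    - by rewrite mulr_ge0 ?normc_ge0.
    - by rewrite invr_ge0 mulr_ge0 ?weight_ge0.
    have := weight_gt0 r j; have := weight_gt0 r (k - j); rewrite /v.
    set x := weight r j; set y := weight r _ => y0 x0.
    by apply: le_of_eq; field; rewrite !gt_eqF.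
  apply: le_trans (ler_wpM2l (weight_ge0 _ _) h1) _.
  rewrite mulrA ler_wpM2r ?sumr_ge0 // mulr_sumr.
  apply: (@le_trans _ _ (\sum_(j <- t) 4 `^ (r0 + 2) *
      ((weight r (k - j))^-1 + (weight r j)^-1))).
    apply: ler_sum => j _; apply: (@le_trans _ _ (4 `^ r * (weight r j +
       weight r (k - j)) * (weight r j * weight r (k - j))^-1)).
      by rewrite ler_wpM2r ?weight_split // invr_ge0 mulr_ge0 ?weight_ge0.
    have := weight_gt0 r j; have := weight_gt0 r (k - j).
    set x := weight r j; set y := weight r _ => y0 x0.
    have -> : 4 `^ r * (x + y) / (x * y) = 4 `^ r * (y^-1 + x^-1).
      by field; rewrite !gt_eqF.
    rewrite ler_wpM2r //.
      by rewrite addr_ge0 ?invr_ge0 ?(ltW x0) ?(ltW y0).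
    by rewrite ler_powR; lra.
  rewrite -mulr_sumr big_split /= /conv_const.
  have -> : 2 * 4 `^ (r0 + 2) * zeta_bound r0 =
     4 `^ (r0 + 2) * (zeta_bound r0 + zeta_bound r0) by ring.
  rewrite ler_wpM2l ?powR_ge0 // lerD //; last exact: inv_weight_sum.
  have -> : \sum_(j <- t) (weight r (k - j))^-1 =
    \sum_(j <- [seq k - j | j <- t]) (weight r j)^-1 by rewrite big_map.
  apply: inv_weight_sum => //; rewrite map_inj_uniq // => x y /eqP.
  by rewrite (inj_eq (addrI _)) (inj_eq oppr_inj) => /eqP.
apply: (@le_trans _ _ (\sum_(k <- s) conv_const r0 * \sum_(j <- t) v k j)).
  by apply: ler_sum => k _; exact: step.
rewrite -mulr_sumr exprMn; apply: (@le_trans _ _ (conv_const r0 * (Ka * Kb) ^+ 2)).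
  rewrite ler_wpM2l //; first lra.
  rewrite exchange_big /= exprMn.
  apply: (@le_trans _ _ (\sum_(j <- t) weight r j * normc (a j) ^+ 2 * Kb ^+ 2)).
    apply: ler_sum => j _; rewrite -mulr_sumr ler_wpM2l //.
      by rewrite mulr_ge0 ?weight_ge0 ?sqr_ge0.
    have -> : \sum_(k <- s) weight r (k - j) * normc (b (k - j)) ^+ 2 =
      \sum_(k <- [seq k - j | k <- s]) weight r k * normc (b k) ^+ 2 by rewrite big_map.
    apply: hb.2; rewrite map_inj_uniq // => x y /eqP.
    by rewrite (inj_eq (addIr _)) => /eqP.
  by rewrite -mulr_suml ler_wpM2r ?sqr_ge0 //; exact: ha.2.
by rewrite ler_wpM2r ?sqr_ge0 //; nra.
Qed.

Definition conv a b k : C := bilateral_sum (fun j => a j * b (k - j)).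

Lemma sob_conv r0 r a b Ka Kb : 1 / 2 < r0 -> r0 <= r -> r <= r0 + 2 ->
  sob_le r a Ka -> sob_le r b Kb ->
  sob_le r (conv a b) (conv_const r0 * (Ka * Kb)).
Proof.
by move=> h1 h2 h3 ha hb; apply: (sob_le_conv h1 h2 h3 ha hb) => k j; rewrite normcM.
Qed.

End SobolevSequences.

(** * Integrals of complex-valued functions *)

Section ComplexIntegral.
Context {R : realType}.
Local Notation C := R[i].
Local Notation mu := (@lebesgue_measure R).
Implicit Types (f g : R -> C) (D : set R) (K t : R) (z : C).

Definition cmeas D f :=
  measurable_fun D (fun x => Re (f x)) /\ measurable_fun D (fun x => Im (f x)).

Definition cintegrable D f :=
  mu.-integrable D (fun x => (Re (f x))%:E) /\
  mu.-integrable D (fun x => (Im (f x))%:E).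

Lemma cintegrable_meas D f : cintegrable D f -> cmeas D f.
Proof.
by move=> [hr hi]; split; apply/measurable_EFinP;
  [exact: (measurable_int mu hr)|exact: (measurable_int mu hi)].
Qed.

Lemma cmeas_eq D f g : (forall x, D x -> f x = g x) -> cmeas D f -> cmeas D g.
Proof.
move=> fg [hr hi]; split; [apply: eq_measurable_fun hr|apply: eq_measurable_fun hi];
  by move=> x /set_mem Dx; rewrite fg.
Qed.

Lemma cmeas_cst D z : cmeas D (fun=> z).
Proof. by split; exact: measurable_cst. Qed.

Lemma cmeas_real D (f : R -> R) : measurable_fun D f -> cmeas D (fun x => (f x)%:C).
Proof. by move=> mf; split => //; exact: measurable_cst. Qed.

Lemma cmeasD D f g : cmeas D f -> cmeas D g -> cmeas D (fun x => f x + g x).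
Proof.
move=> [fr fi] [gr gi]; split.
- by under eq_fun do rewrite Re_D; exact: measurable_funD.
- by under eq_fun do rewrite Im_D; exact: measurable_funD.
Qed.

Lemma cmeasM D f g : cmeas D f -> cmeas D g -> cmeas D (fun x => f x * g x).
Proof.
move=> [fr fi] [gr gi]; split.
- by under eq_fun do rewrite Re_M; apply: measurable_funB; exact: measurable_funM.
- by under eq_fun do rewrite Im_M; apply: measurable_funD; exact: measurable_funM.
Qed.

Lemma cmeasZ D f z : cmeas D f -> cmeas D (fun x => z * f x).
Proof. by move=> mf; apply: cmeasM => //; exact: cmeas_cst. Qed.

Lemma cmeasN D f : cmeas D f -> cmeas D (fun x => - f x).
Proof.
move=> mf; apply: (@cmeas_eq _ (fun x => (-1) * f x)); last exact: cmeasZ.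
by move=> x _; rewrite mulN1r.
Qed.

Lemma cmeasB D f g : cmeas D f -> cmeas D g -> cmeas D (fun x => f x - g x).
Proof. by move=> mf mg; apply: cmeasD => //; exact: cmeasN. Qed.

Lemma cmeas_conj D f : cmeas D f -> cmeas D (fun x => (f x)^*).
Proof.
move=> [fr fi]; split.
- by under eq_fun do rewrite Re_conjc.
- by under eq_fun do rewrite Im_conjc; exact: measurable_funN.
Qed.

Lemma cmeas_sum D (I : Type) (s : seq I) (F : I -> R -> C) :
  (forall i, cmeas D (F i)) -> cmeas D (fun x => \sum_(i <- s) F i x).
Proof.
move=> mF; elim: s => [|i s IH].
  by under eq_fun do rewrite big_nil; exact: cmeas_cst.
by under eq_fun do rewrite big_cons; exact: cmeasD.
Qed.

Lemma cmeas_expi D (w : R) : cmeas D (fun x => expi (w * x)).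
Proof.
have m : measurable_fun setT (fun x : R => w * x).
  by apply: measurable_funM => //; exact: measurable_cst.
split; apply: measurable_funTS.
- apply: (measurableT_comp _ m); apply: continuous_measurable_fun.
  exact: continuous_cos.
- apply: (measurableT_comp _ m); apply: continuous_measurable_fun.
  exact: continuous_sin.
Qed.

Lemma cmeas_normc D f : cmeas D f -> measurable_fun D (fun x => normc (f x)).
Proof.
move=> [fr fi]; have -> : (fun x => normc (f x)) =
    (fun x => Num.sqrt (Re (f x) ^+ 2 + Im (f x) ^+ 2)).
  by apply/funext => x; case: (f x).
apply: (@measurableT_comp _ _ _ _ _ _ (@Num.sqrt R)).
  by apply: continuous_measurable_fun; exact: sqrt_continuous.
by apply: measurable_funD; apply: measurable_funX.
Qed.

Lemma cmeas_sub D D' f : measurable D' -> D `<=` D' -> cmeas D' f -> cmeas D f.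
Proof.
by move=> mD' DD' [fr fi]; split; apply: measurable_funS DD' _.
Qed.

Lemma cmeas_bilateral D (F : int -> R -> C) :
  (forall k, cmeas D (F k)) ->
  (forall x, D x -> exists K, l1_le (fun k => F k x) K) ->
  cmeas D (fun x => bilateral_sum (fun k => F k x)).
Proof.
move=> mF lF; split.
- apply: (measurable_fun_cvg (h := fun N x => Re (\sum_(k <- window N) F k x))).
    by move=> N; exact: (cmeas_sum _ _).1.
  by move=> x /lF[K /l1_le_bsum[]].
- apply: (measurable_fun_cvg (h := fun N x => Im (\sum_(k <- window N) F k x))).
    by move=> N; exact: (cmeas_sum _ _).2.
  by move=> x /lF[K /l1_le_bsum[]].
Qed.

Definition ebounded D f K := {ae mu, forall x, D x -> normc (f x) <= K}.

Lemma ebounded_pt D f K : (forall x, D x -> normc (f x) <= K) -> ebounded D f K.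
Proof. by move=> h; apply: aeW. Qed.

Lemma integrable_ebounded D (h : R -> R) K : measurable D -> (mu D < +oo)%E ->
  measurable_fun D h -> {ae mu, forall x, D x -> `|h x| <= K} ->
  mu.-integrable D (fun x => (h x)%:E).
Proof.
move=> mD Doo mh hK; apply/integrableP; split; first exact/measurable_EFinP.
apply: (@le_lt_trans _ _ (\int[mu]_(x in D) (`|K|%:E))%E); last first.
  by rewrite integral_cst // lte_mul_pinfty.
apply: ae_ge0_le_integral => //.
- by apply: measurableT_comp => //; exact/measurable_EFinP.
- move: hK; apply: filterS; first exact: (ae_filter_ringOfSetsType mu).
  by move=> x hx Dx; rewrite lee_fin (le_trans (hx Dx)) // ler_norm.
Qed.

Lemma cintegrable_ebounded D f K : measurable D -> (mu D < +oo)%E ->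
  cmeas D f -> ebounded D f K -> cintegrable D f.
Proof.
move=> mD Doo [mr mi] bf; have key h := @integrable_ebounded D h K mD Doo.
split; apply: key => //; move: bf; apply: filterS; try exact: (ae_filter_ringOfSetsType mu).
- by move=> x hx Dx; apply: le_trans (hx Dx); exact: Re_le_normc.
- by move=> x hx Dx; apply: le_trans (hx Dx); exact: Im_le_normc.
Qed.

Lemma cintegrableD D f g : measurable D -> cintegrable D f -> cintegrable D g ->
  cintegrable D (fun x => f x + g x).
Proof.
move=> mD [fr fi] [gr gi]; split.
- by under eq_fun do rewrite Re_D EFinD; exact: integrableD.
- by under eq_fun do rewrite Im_D EFinD; exact: integrableD.
Qed.

Lemma cintegrableZ D f z : measurable D -> cintegrable D f ->
  cintegrable D (fun x => z * f x).
Proof.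
move=> mD [fr fi].
have hZ h w : mu.-integrable D (fun x => (h x)%:E) ->
    mu.-integrable D (fun x => (w * h x)%:E).
  by move=> ih; under eq_fun do rewrite EFinM; exact: integrableZl.
split.
- by under eq_fun do rewrite Re_M EFinB; apply: integrableB => //; exact: hZ.
- by under eq_fun do rewrite Im_M EFinD; apply: integrableD => //; exact: hZ.
Qed.

Lemma cintegral_eq D f g : (forall x, D x -> f x = g x) ->
  cintegral D f = cintegral D g.
Proof.
by move=> fg; rewrite /cintegral; congr (_ +i* _); apply: eq_Rintegral => x /set_mem Dx;
  rewrite fg.
Qed.

Lemma cintegral_ae_eq D f g : measurable D -> cmeas D f -> cmeas D g ->
  {ae mu, forall x, D x -> f x = g x} -> cintegral D f = cintegral D g.
Proof.
move=> mD [fr fi] [gr gi] fg; rewrite /cintegral /Rintegral; congr (fine _ +i* fine _).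
- apply: ae_eq_integral => //; try exact/measurable_EFinP.
  move: fg; apply: filterS; first exact: (ae_filter_ringOfSetsType mu).
  by move=> x h Dx; rewrite h.
- apply: ae_eq_integral => //; try exact/measurable_EFinP.
  move: fg; apply: filterS; first exact: (ae_filter_ringOfSetsType mu).
  by move=> x h Dx; rewrite h.
Qed.

Lemma cintegralD D f g : measurable D -> cintegrable D f -> cintegrable D g ->
  cintegral D (fun x => f x + g x) = cintegral D f + cintegral D g.
Proof.
move=> mD [fr fi] [gr gi]; apply: ReImP => /=.
- by under eq_Rintegral do rewrite Re_D; exact: RintegralD.
- by under eq_Rintegral do rewrite Im_D; exact: RintegralD.
Qed.

Lemma cintegralZ D f z : measurable D -> cintegrable D f ->
  cintegral D (fun x => z * f x) = z * cintegral D f.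
Proof.
move=> mD [fr fi].
have hZ' h w : mu.-integrable D (fun x => (h x)%:E) ->
    mu.-integrable D (fun x => (w * h x)%:E).
  by move=> ih; under eq_fun do rewrite EFinM; exact: integrableZl.
apply: ReImP; rewrite ?Re_M ?Im_M /=.
- under eq_Rintegral do rewrite Re_M.
  by rewrite RintegralB ?RintegralZl //; exact: hZ'.
- under eq_Rintegral do rewrite Im_M.
  by rewrite RintegralD ?RintegralZl //; exact: hZ'.
Qed.

Lemma cintegralN D f : measurable D -> cintegrable D f ->
  cintegral D (fun x => - f x) = - cintegral D f.
Proof.
move=> mD cf; rewrite -mulN1r -cintegralZ //; apply: cintegral_eq => x _.
by rewrite mulN1r.
Qed.

Lemma cintegrableN D f : measurable D -> cintegrable D f ->
  cintegrable D (fun x => - f x).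
Proof.
move=> mD cf; have := cintegrableZ (-1) mD cf.
by under eq_fun do rewrite mulN1r.
Qed.

Lemma cintegrableB D f g : measurable D -> cintegrable D f -> cintegrable D g ->
  cintegrable D (fun x => f x - g x).
Proof. by move=> mD cf cg; apply: cintegrableD => //; exact: cintegrableN. Qed.

Lemma cintegralB D f g : measurable D -> cintegrable D f -> cintegrable D g ->
  cintegral D (fun x => f x - g x) = cintegral D f - cintegral D g.
Proof.
move=> mD cf cg; rewrite cintegralD ?cintegralN //; exact: cintegrableN.
Qed.

Lemma cintegrable0 D : measurable D -> cintegrable D (fun=> 0).
Proof. by move=> mD; split; exact: integrable0. Qed.

Lemma cintegral0 D : cintegral D (fun=> 0) = 0.
Proof. by apply: ReImP; rewrite /= /Rintegral integral0. Qed.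

Lemma cintegrable_sum D (I : Type) (s : seq I) (F : I -> R -> C) : measurable D ->
  (forall i, cintegrable D (F i)) -> cintegrable D (fun x => \sum_(i <- s) F i x).
Proof.
move=> mD cF; elim: s => [|i s IH].
  by under eq_fun do rewrite big_nil; exact: cintegrable0.
by under eq_fun do rewrite big_cons; exact: cintegrableD.
Qed.

Lemma cintegral_sum D (I : Type) (s : seq I) (F : I -> R -> C) : measurable D ->
  (forall i, cintegrable D (F i)) ->
  cintegral D (fun x => \sum_(i <- s) F i x) = \sum_(i <- s) cintegral D (F i).
Proof.
move=> mD cF; elim: s => [|i s IH].
  by rewrite big_nil; under eq_fun do rewrite big_nil; exact: cintegral0.
rewrite big_cons -IH; under eq_fun do rewrite big_cons.
by rewrite cintegralD //; exact: cintegrable_sum.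
Qed.

Lemma cintegral_conj D f : measurable D -> cintegrable D f ->
  cintegral D (fun x => (f x)^*) = (cintegral D f)^*.
Proof.
move=> mD [fr fi]; apply: ReImP; rewrite ?Re_conjc ?Im_conjc /=.
- by apply: eq_Rintegral => x _; rewrite Re_conjc.
- rewrite -mulN1r -RintegralZl //; apply: eq_Rintegral => x _.
  by rewrite Im_conjc mulN1r.
Qed.

(** The modulus of the integral z is the integral of the real part of
    conj(z) f / |z|.  Truncating that function at the bound turns the inequality
    almost everywhere into a pointwise one without changing the integral. *)
Lemma cintegral_le D f K : measurable D -> (mu D < +oo)%E -> cmeas D f ->
  0 <= K -> ebounded D f K -> normc (cintegral D f) <= K * fine (mu D).
Proof.
move=> mD Doo mf K0 bf.
have cf := cintegrable_ebounded mD Doo mf bf.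
set z := cintegral D f.
have [->|z0] := eqVneq z 0; first by rewrite normc0 mulr_ge0 // fine_ge0.
have nz : 0 < normc z.
  by rewrite lt_neqAle normc_ge0 andbT eq_sym; apply: contra_neq z0 => /eq0_normc.
have E : normc z ^+ 2 = Re (cintegral D (fun x => z^* * f x)).
  rewrite cintegralZ // -/z normc_sqr Re_M Re_conjc Im_conjc; ring.
suff : normc z ^+ 2 <= normc z * (K * fine (mu D)) by rewrite expr2 ler_pM2l.
have czf := cintegrableZ z^* mD cf.
rewrite E /= mulrA -Rintegral_cst //.
have ic : mu.-integrable D (fun=> (normc z * K)%:E).
  by apply: (@integrable_ebounded _ _ `|normc z * K|) => //; apply: aeW.
pose h x := Re (z^* * f x); pose c := normc z * K.
have mh : measurable_fun D h by exact: (cintegrable_meas czf).1.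
have mh' : measurable_fun D (fun x => Num.min (h x) c).
  by apply: measurable_minr => //; exact: measurable_cst.
have hh' : {ae mu, forall x, D x -> (h x)%:E = (Num.min (h x) c)%:E}.
  move: bf; apply: filterS; first exact: (ae_filter_ringOfSetsType mu).
  move=> x bx Dx; congr EFin; apply/esym/min_idPl.
  apply: le_trans (ler_norm _) _; apply: le_trans (Re_le_normc _) _.
  by rewrite normcM normc_conj ler_wpM2l ?normc_ge0 ?bx.
rewrite -/c -/h (_ : Rintegral _ _ _ = \int[mu]_(x in D) Num.min (h x) c); last first.
  by congr fine; apply: ae_eq_integral => //; exact/measurable_EFinP.
apply: le_Rintegral => //.
- apply/integrableP; split; first exact/measurable_EFinP.
  rewrite (_ : integral _ _ _ = \int[mu]_(x in D) `|(h x)%:E|)%E; last first.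
    apply: ae_eq_integral => //; try (by apply: measurableT_comp => //; exact/measurable_EFinP).
    move: hh'; apply: filterS; first exact: (ae_filter_ringOfSetsType mu).
    by move=> x e Dx; rewrite e.
  by have /integrableP[] := czf.1.
- by move=> x _; rewrite ge_min lexx orbT.
Qed.

(** Dominated convergence applied to the symmetric partial sums, which K
    bounds almost everywhere. *)
Lemma cintegral_bilateral D (F : int -> R -> C) K : measurable D -> (mu D < +oo)%E ->
  (forall k, cmeas D (F k)) ->
  (forall x, D x -> exists K', l1_le (fun k => F k x) K') ->
  {ae mu, forall x, D x -> l1_le (fun k => F k x) K} ->
  has_bsum (fun k => cintegral D (F k))
           (cintegral D (fun x => bilateral_sum (fun k => F k x))).
Proof.
move=> mD Doo mF lF aF.
have mB := cmeas_bilateral mF lF.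
have cF k : cintegrable D (F k).
  apply: (@cintegrable_ebounded _ _ K) => //; move: aF; apply: filterS.
    exact: (ae_filter_ringOfSetsType mu).
  by move=> x h Dx; have := h Dx [:: k] isT; rewrite big_seq1.
have iK : mu.-integrable D (fun=> K%:E).
  by apply: (@integrable_ebounded _ _ `|K|) => //; apply: aeW.
have key (p : C -> R) (pD : forall N x, p (\sum_(k <- window N) F k x) =
     \sum_(k <- window N) p (F k x)) (pn : forall z, `|p z| <= normc z)
    (mp : forall f, cmeas D f -> measurable_fun D (fun x => p (f x)))
    (pl : forall x, D x -> (fun N => p (\sum_(k <- window N) F k x)) @ \oo -->
       p (bilateral_sum (fun k => F k x))) :
    (fun N => \int[mu]_(x in D) p (\sum_(k <- window N) F k x)) @ \oo -->
    \int[mu]_(x in D) p (bilateral_sum (fun k => F k x)).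
  have [] := @dominated_convergence _ _ R mu D mD
    (fun N x => (p (\sum_(k <- window N) F k x))%:E)
    (fun x => (p (bilateral_sum (fun k => F k x)))%:E) (fun=> K%:E).
  - by move=> N; apply/measurable_EFinP; apply: mp; exact: cmeas_sum.
  - by apply/measurable_EFinP; exact: mp.
  - by apply: aeW => x /pl h; apply: cvg_EFin => //; exact: nearW.
  - exact: iK.
  - move: aF; apply: filterS; first exact: (ae_filter_ringOfSetsType mu).
    move=> x h N Dx; rewrite lee_fin; apply: le_trans (pn _) _.
    by apply: le_trans (normc_sum _ _) _; apply: h => //; exact: window_uniq.
  move=> iB _ h; have fB := integrable_fin_num _ iB.
  rewrite -(fineK (fB mD)) in h.
  exact: fine_cvg h.
have E N : \sum_(k <- window N) cintegral D (F k) =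
    cintegral D (fun x => \sum_(k <- window N) F k x) by rewrite cintegral_sum.
split.
- under eq_fun do rewrite E; apply: (key (@complex.Re R)) => //.
  + by move=> N x; rewrite Re_sum.
  + exact: Re_le_normc.
  + by move=> f [].
  + by move=> x /lF[K' /l1_le_bsum[]].
- under eq_fun do rewrite E; apply: (key (@complex.Im R)) => //.
  + by move=> N x; rewrite Im_sum.
  + exact: Im_le_normc.
  + by move=> f [].
  + by move=> x /lF[K' /l1_le_bsum[]].
Qed.

(** Cauchy-Schwarz against 1: the integral of (h - c)^2 is nonnegative for
    every c, in particular for the mean value of h. *)
Lemma sqr_Rintegral_le D (h : R -> R) K : measurable D -> (mu D < +oo)%E ->
  measurable_fun D h -> (forall x, D x -> `|h x| <= K) ->
  (\int[mu]_(x in D) h x) ^+ 2 <= fine (mu D) * \int[mu]_(x in D) (h x ^+ 2).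
Proof.
move=> mD Doo mh hK.
have ih : mu.-integrable D (fun x => (h x)%:E).
  by apply: (@integrable_ebounded _ _ K) => //; apply: aeW.
have ih2 : mu.-integrable D (fun x => (h x ^+ 2)%:E).
  apply: (@integrable_ebounded _ _ (K ^+ 2)) => //; first exact: measurable_funX.
  apply: aeW => x Dx; rewrite normrX ler_sqr ?nnegrE ?hK //.
  by apply: le_trans (hK x Dx).
have ic (c : R) : mu.-integrable D (fun=> c%:E).
  by apply: (@integrable_ebounded _ _ `|c|) => //; apply: aeW.
set m := fine (mu D); set I := Rintegral _ _ _; set J := Rintegral _ _ _.
have m0 : 0 <= m by rewrite fine_ge0.
have H (c : R) : 2 * c * I <= J + c ^+ 2 * m.
  have -> : J + c ^+ 2 * m = \int[mu]_(x in D) (h x ^+ 2 + c ^+ 2).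
    by rewrite RintegralD ?Rintegral_cst //; exact: ic.
  have -> : 2 * c * I = \int[mu]_(x in D) (2 * c * h x) by rewrite RintegralZl.
  apply: le_Rintegral => //.
  - by rewrite /comp; under eq_fun do rewrite EFinM; exact: integrableZl.
  - by rewrite /comp; under eq_fun do rewrite EFinD; apply: integrableD => //; exact: ic.
  - by move=> x _; have := sqr_ge0 (h x - c); lra.
have [m0'|mn0] := eqVneq m 0.
  have J0 : 0 <= J by apply: Rintegral_ge0 => x _; exact: sqr_ge0.
  rewrite m0' mul0r; have [->|In0] := eqVneq I 0; first by rewrite expr0n.
  (* A nonzero I would violate H for large c. *)
  by have := H ((J + 1) / I); rewrite m0' mulr0 addr0 -mulrA divfK //; lra.
have mp : 0 < m by rewrite lt_neqAle eq_sym mn0.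
have := H (I / m); rewrite -(ler_pM2l mp).
have -> : m * (2 * (I / m) * I) = 2 * I ^+ 2 by field.
have -> : m * (J + (I / m) ^+ 2 * m) = m * J + I ^+ 2 by field.
lra.
Qed.

(** Minkowski inequality for the integral of a bounded curve in H^r, from
    Cauchy-Schwarz in each coefficient. *)
Lemma sob_le_cintegral D r (F : int -> R -> C) K : measurable D -> (mu D < +oo)%E ->
  0 <= r -> 0 <= K ->
  (forall k, cmeas D (F k)) -> (forall x, D x -> sob_le r (fun k => F k x) K) ->
  sob_le r (fun k => cintegral D (F k)) (fine (mu D) * K).
Proof.
move=> mD Doo r0 K0 mF hF.
have m0 : 0 <= fine (mu D) by rewrite fine_ge0.
split=> [|s us]; first by rewrite mulr_ge0.
have bF k x : D x -> normc (F k x) <= K.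
  by move=> Dx; apply: (@sob_le_pt _ r (F^~ x) K k r0); exact: hF.
have mN k : measurable_fun D (fun x => normc (F k x) ^+ 2).
  by apply: measurable_funX; exact: cmeas_normc.
have iN k : mu.-integrable D (fun x => (normc (F k x) ^+ 2)%:E).
  apply: (@integrable_ebounded _ _ (K ^+ 2)) => //.
  apply: aeW => x Dx; rewrite normrX ler_sqr ?nnegrE ?normr_ge0 //.
  by rewrite ger0_norm ?normc_ge0 // bF.
have iR k : mu.-integrable D (fun x => (Re (F k x) ^+ 2)%:E).
  apply: (@integrable_ebounded _ _ (K ^+ 2)) => //.
    by apply: measurable_funX; exact: (mF k).1.
  apply: aeW => x Dx; rewrite normrX ler_sqr ?nnegrE ?normr_ge0 //.
  by apply: le_trans (Re_le_normc _) _; exact: bF.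
have iI k : mu.-integrable D (fun x => (Im (F k x) ^+ 2)%:E).
  apply: (@integrable_ebounded _ _ (K ^+ 2)) => //.
    by apply: measurable_funX; exact: (mF k).2.
  apply: aeW => x Dx; rewrite normrX ler_sqr ?nnegrE ?normr_ge0 //.
  by apply: le_trans (Im_le_normc _) _; exact: bF.
have ic (c : R) : mu.-integrable D (fun=> c%:E).
  by apply: (@integrable_ebounded _ _ `|c|) => //; apply: aeW.
have h1 k : normc (cintegral D (F k)) ^+ 2 <=
    fine (mu D) * \int[mu]_(x in D) (normc (F k x) ^+ 2).
  rewrite normc_sqr.
  have -> : \int[mu]_(x in D) (normc (F k x) ^+ 2) =
     \int[mu]_(x in D) (Re (F k x) ^+ 2 + Im (F k x) ^+ 2).
    by apply: eq_Rintegral => x _; rewrite normc_sqr.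
  rewrite RintegralD //; [|exact: iR|exact: iI].
  rewrite mulrDr lerD //.
  - apply: (@sqr_Rintegral_le _ _ K) => //; first exact: (mF k).1.
    by move=> x Dx; apply: le_trans (Re_le_normc _) _; exact: bF.
  - apply: (@sqr_Rintegral_le _ _ K) => //; first exact: (mF k).2.
    by move=> x Dx; apply: le_trans (Im_le_normc _) _; exact: bF.
have iW k : mu.-integrable D (fun x => (weight r k * normc (F k x) ^+ 2)%:E).
  by under eq_fun do rewrite EFinM; exact: integrableZl.
have iS s' : mu.-integrable D
    (fun x => (\sum_(k <- s') weight r k * normc (F k x) ^+ 2)%:E).
  elim: s' => [|k s' IH]; first by under eq_fun do rewrite big_nil; exact: integrable0.
  by under eq_fun do rewrite big_cons EFinD; apply: integrableD.
apply: (@le_trans _ _ (fine (mu D) *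
    \int[mu]_(x in D) (\sum_(k <- s) weight r k * normc (F k x) ^+ 2))).
  have -> : \int[mu]_(x in D) (\sum_(k <- s) weight r k * normc (F k x) ^+ 2) =
      \sum_(k <- s) weight r k * \int[mu]_(x in D) (normc (F k x) ^+ 2).
    elim: s {us} => [|k s IH].
      rewrite big_nil; under eq_Rintegral do rewrite big_nil.
      by rewrite /Rintegral integral0.
    rewrite big_cons -IH; under eq_Rintegral do rewrite big_cons.
    rewrite RintegralD //; [|exact: iW|exact: iS].
    by congr (_ + _); rewrite RintegralZl //; exact: iN.
  rewrite mulr_sumr; apply: ler_sum => k _.
  by rewrite [leRHS]mulrCA ler_wpM2l ?weight_ge0.
rewrite exprMn expr2 -mulrA ler_wpM2l // mulrC -Rintegral_cst //.
apply: le_Rintegral => //; [exact: iS|exact: ic|].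
by move=> x /hF[_]; exact.
Qed.

End ComplexIntegral.

(** * Explicit integrals of exponentials *)

Section ExplicitIntegrals.
Context {R : realType}.
Local Notation C := R[i].
Local Notation mu := (@lebesgue_measure R).
Implicit Types (a b w t : R).

Lemma Rintegral_FTC2 (f F : R -> R) a b : a <= b ->
  (forall x : R, is_derive x 1 F (f x)) -> continuous f ->
  \int[mu]_(x in `[a, b]) f x = F b - F a.
Proof.
rewrite le_eqVlt => /predU1P[->|ab] dF cf.
  by rewrite set_itv1 Rintegral_set1 subrr.
have cF : continuous F.
  move=> x; apply: differentiable_continuous; apply/derivable1_diffP.
  by case: (dF x).
rewrite /Rintegral (@continuous_FTC2 R f F a b ab) //.
- exact: continuous_subspaceT.
- split.
  + by move=> x _; case: (dF x).
  + exact/cvg_at_right_filter/cF.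
  + exact/cvg_at_left_filter/cF.
- by move=> x _; rewrite derive1E; case: (dF x).
Qed.

Lemma is_derive_mul w t : is_derive t 1 (fun s : R => w * s) w.
Proof.
have := @is_deriveZ R R R id w t 1 1 (@is_derive_id _ _ _ _).
by rewrite /GRing.scale /= mulr1.
Qed.

Lemma is_derive_sin_mul w t : is_derive t 1 (fun s => sin (w * s)) (w * cos (w * t)).
Proof.
rewrite mulrC.
exact: (@is_derive1_comp R (@sin R) (fun s => w * s) t _ _
   (is_derive_sin _) (is_derive_mul w t)).
Qed.

Lemma is_derive_cos_mul w t :
  is_derive t 1 (fun s => cos (w * s)) (- (w * sin (w * t))).
Proof.
rewrite mulrC -mulNr.
exact: (@is_derive1_comp R (@cos R) (fun s => w * s) t _ _
   (is_derive_cos _) (is_derive_mul w t)).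
Qed.

Lemma continuous_mulw w : continuous (fun s : R => w * s).
Proof. by move=> x; apply: cvgM; [exact: cvg_cst|exact: cvg_id]. Qed.

Lemma continuous_sin_mul w : continuous (fun s : R => sin (w * s)).
Proof. by move=> x; apply: continuous_comp; [exact: continuous_mulw|exact: continuous_sin]. Qed.

Lemma continuous_cos_mul w : continuous (fun s : R => cos (w * s)).
Proof. by move=> x; apply: continuous_comp; [exact: continuous_mulw|exact: continuous_cos]. Qed.

Lemma Rintegral_cos w a b : a <= b -> w != 0 ->
  \int[mu]_(s in `[a, b]) cos (w * s) = (sin (w * b) - sin (w * a)) / w.
Proof.
move=> ab w0.
have H (x : R) : is_derive x 1 (fun s => w^-1 * sin (w * s)) (cos (w * x)).
  have := @is_deriveZ R R R (fun s => sin (w * s)) w^-1 x 1 _ (is_derive_sin_mul w x).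
  by rewrite /GRing.scale /= mulKf.
by rewrite (Rintegral_FTC2 ab H (@continuous_cos_mul w)); field.
Qed.

Lemma Rintegral_sin w a b : a <= b -> w != 0 ->
  \int[mu]_(s in `[a, b]) sin (w * s) = (cos (w * a) - cos (w * b)) / w.
Proof.
move=> ab w0.
have H (x : R) : is_derive x 1 (fun s => - w^-1 * cos (w * s)) (sin (w * x)).
  have := @is_deriveZ R R R (fun s => cos (w * s)) (- w^-1) x 1 _ (is_derive_cos_mul w x).
  by rewrite /GRing.scale /= mulrNN mulKf.
by rewrite (Rintegral_FTC2 ab H (@continuous_sin_mul w)); field.
Qed.

Lemma cintegral_expi w a b : a <= b -> w != 0 ->
  cintegral `[a, b] (fun s => expi (w * s)) =
  (expi (w * b) - expi (w * a)) / (Complex 0 1 * w%:C).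
Proof.
move=> ab w0; apply: (@mulIf _ (Complex 0 1 * w%:C)).
  by rewrite mulf_neq0 // eq_complex /= ?oner_eq0 ?andbF // negb_and w0.
rewrite mulfVK; last first.
  by rewrite mulf_neq0 // eq_complex /= ?oner_eq0 ?andbF // negb_and w0.
apply: ReImP; rewrite /cintegral /= Rintegral_cos // Rintegral_sin //; field => //.
Qed.

(** The value given by integration by parts; the real and imaginary parts are
    computed from explicit primitives. *)
Lemma cintegral_s_expi w t : 0 <= t -> w != 0 ->
  cintegral `[0, t] (fun s => s%:C * expi (w * s)) =
  (t%:C * expi (w * t) - cintegral `[0, t] (fun s => expi (w * s))) /
  (Complex 0 1 * w%:C).
Proof.
move=> t0 w0.
have n0 : (Complex 0 1 * w%:C : C) != 0.
  by rewrite mulf_neq0 // eq_complex /= ?oner_eq0 ?andbF // negb_and w0.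
apply: (@mulIf _ (Complex 0 1 * w%:C)) => //; rewrite mulfVK //.
have Ec : \int[mu]_(s in `[0, t]) (s * cos (w * s)) =
    t * sin (w * t) / w + (cos (w * t) - 1) / w ^+ 2.
  have H (x : R) : is_derive x 1 (fun s => w^-1 * (s * sin (w * s)) +
     w^-1 ^+ 2 * cos (w * s)) (x * cos (w * x)).
    have h1 := @is_deriveM R R id (fun s => sin (w * s)) x 1 _ _
      (@is_derive_id _ _ _ _) (is_derive_sin_mul w x).
    have h2 := @is_deriveZ R R R _ (w^-1) x 1 _ h1.
    have h3 := @is_deriveZ R R R _ (w^-1 ^+ 2) x 1 _ (is_derive_cos_mul w x).
    by apply: (is_derive_eq (is_deriveD h2 h3)); rewrite /GRing.scale /=; field.
  have cH : continuous (fun s : R => s * cos (w * s)).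
    by move=> x; apply: cvgM; [exact: cvg_id|exact: continuous_cos_mul].
  by rewrite (Rintegral_FTC2 t0 H cH) mulr0 cos0; field.
have Es : \int[mu]_(s in `[0, t]) (s * sin (w * s)) =
    - (t * cos (w * t)) / w + sin (w * t) / w ^+ 2.
  have H (x : R) : is_derive x 1 (fun s => (- w^-1) * (s * cos (w * s)) +
     w^-1 ^+ 2 * sin (w * s)) (x * sin (w * x)).
    have h1 := @is_deriveM R R id (fun s => cos (w * s)) x 1 _ _
      (@is_derive_id _ _ _ _) (is_derive_cos_mul w x).
    have h2 := @is_deriveZ R R R _ (- w^-1) x 1 _ h1.
    have h3 := @is_deriveZ R R R _ (w^-1 ^+ 2) x 1 _ (is_derive_sin_mul w x).
    by apply: (is_derive_eq (is_deriveD h2 h3)); rewrite /GRing.scale /=; field.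
  have cH : continuous (fun s : R => s * sin (w * s)).
    by move=> x; apply: cvgM; [exact: cvg_id|exact: continuous_sin_mul].
  by rewrite (Rintegral_FTC2 t0 H cH) mulr0 sin0; field.
have ERe : \int[mu]_(s in `[0, t]) Re (s%:C * expi (w * s)) =
    \int[mu]_(s in `[0, t]) (s * cos (w * s)).
  by apply: eq_Rintegral => s _; rewrite /= mul0r subr0.
have EIm : \int[mu]_(s in `[0, t]) Im (s%:C * expi (w * s)) =
    \int[mu]_(s in `[0, t]) (s * sin (w * s)).
  by apply: eq_Rintegral => s _; rewrite /= mul0r addr0.
have Vc := Rintegral_cos t0 w0; have Vs := Rintegral_sin t0 w0.
by apply: ReImP; rewrite /cintegral ERe EIm /= Ec Es ?Vc ?Vs ?(mulr0 w) ?cos0 ?sin0; field.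
Qed.

End ExplicitIntegrals.

(** * Absolutely convergent Fourier series *)

Section FourierSeries.
Context {R : realType}.
Local Notation C := R[i].
Local Notation mu := (@lebesgue_measure R).
Local Notation Omega := (@Omega R).
Implicit Types (f g : R -> C) (a b : int -> C) (x : R) (k j n : int) (K : R).

Lemma expi_2pi k : expi (k%:~R * (2 * pi)) = 1 :> C.
Proof.
have h2 : expi (2 * pi) = 1 :> C.
  by rewrite /expi mulr_natl cos2pi sin2pi.
have hn (n : nat) : expi (n%:R * (2 * pi)) = 1 :> C.
  elim: n => [|n IH]; first by rewrite mul0r expi0.
  by rewrite -natr1 mulrDl expiD IH !mul1r h2.
case: k => n; first exact: hn.
have := @expiN R (n.+1%:R * (2 * pi)); rewrite hn mul1r => <-.
by rewrite NegzE rmorphN /= mulNr.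
Qed.

Lemma OmegaE : Omega = `]- pi, pi[%classic. Proof. by []. Qed.

Lemma measurable_Omega : measurable Omega.
Proof. exact: measurable_itv. Qed.

Lemma mu_Omega : mu Omega = (2 * pi)%:E.
Proof.
rewrite OmegaE lebesgue_measure_itv /= lte_fin ifT.
  by rewrite -EFinB opprK mulr_natl mulr2n.
by have := pi_gt0 R; lra.
Qed.

Lemma mu_Omega_fin : (mu Omega < +oo)%E.
Proof. by rewrite mu_Omega ltry. Qed.

Lemma cintegral_cst (D : set R) (z : C) : measurable D ->
  cintegral D (fun=> z) = z * (fine (mu D))%:C.
Proof.
move=> mD; apply: ReImP; rewrite ?Re_M ?Im_M /cintegral /=.
- by rewrite Rintegral_cst // mulr0 subr0.
- by rewrite Rintegral_cst // mulr0 add0r.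
Qed.

(** The fundamental theorem of calculus needs the closed interval. *)
Lemma Omega_cc f K : cmeas setT f -> (forall x, normc (f x) <= K) ->
  cintegral Omega f = cintegral `[- pi, pi] f.
Proof.
move=> mf fK.
have h (i : interval R) (D := [set` i]) : (mu D < +oo)%E -> cintegrable D f.
  move=> Doo; apply: (@cintegrable_ebounded _ D f K) => //.
  - exact: measurable_itv.
  - exact: (cmeas_sub measurableT _ mf).
  - by apply: ebounded_pt => x _.
have fo : (mu [set` `]- (pi : R), (pi : R)]%R] < +oo)%E.
  by rewrite lebesgue_measure_itv /=; case: ifP => _; rewrite ltry.
rewrite /cintegral OmegaE; congr (_ +i* _).
- rewrite Rintegral_itv_bndo_bndc ?Rintegral_itv_obnd_cbnd //.
    exact: (h _ fo).1.
  exact: (h _ mu_Omega_fin).1.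
- rewrite Rintegral_itv_bndo_bndc ?Rintegral_itv_obnd_cbnd //.
    exact: (h _ fo).2.
  exact: (h _ mu_Omega_fin).2.
Qed.

Lemma cintegral_Omega_expi n :
  cintegral Omega (fun x => expi (n%:~R * x)) = if n == 0 then (2 * pi)%:C else 0.
Proof.
have pp := pi_gt0 R; case: eqP => [->|/eqP n0].
  have -> : (fun x => expi ((0%:~R : R) * x)) = fun=> 1 :> C.
    by apply/funext => x; rewrite mul0r expi0.
  by rewrite (cintegral_cst _ measurable_Omega) mu_Omega mul1r.
rewrite (@Omega_cc _ 1); [|exact: cmeas_expi|by move=> x; rewrite normc_expi].
rewrite cintegral_expi ?intr_eq0 //; last lra.
have {1}-> : n%:~R * pi = n%:~R * - pi + n%:~R * (2 * pi) :> R by ring.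
by rewrite expiD expi_2pi mulr1 subrr mul0r.
Qed.

Lemma has_bsum_delta n (z : C) : has_bsum (fun k => if k == n then z else 0) z.
Proof.
have E N : (absz n <= N)%N ->
    \sum_(k <- window N) (if k == n then z else 0) = z.
  move=> nN; rewrite (bigD1_seq n) ?window_uniq //=.
    by rewrite eqxx big1 ?addr0 // => k /negbTE ->.
  by rewrite mem_window; lia.
split; apply: cvg_near_cst; exists (absz n) => // N /= /E ->; by [].
Qed.

Lemma bilateral_sum_delta n (z : C) :
  bilateral_sum (fun k => if k == n then z else 0) = z.
Proof. exact/has_bsum_eq/has_bsum_delta. Qed.

Definition fser a x : C := bilateral_sum (fun k => a k * expi (k%:~R * x)).

Lemma fourier_multE p f x :
  fourier_mult p f x = fser (fun k => p k * fourier_coef f k) x.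
Proof.
by rewrite /fourier_mult /fser; under eq_fun do rewrite cexp_expi.
Qed.

Lemma fourier_coefE f k : fourier_coef f k =
  ((2 * pi)^-1)%:C * cintegral Omega (fun x => f x * expi (- (k%:~R * x))).
Proof.
rewrite /fourier_coef; congr (_ * _); apply: cintegral_eq => x _.
by rewrite -cexp_expi rmorphN mulrN.
Qed.

Lemma cmeas_expiN k D : cmeas D (fun x => expi (- (k%:~R * x)) : C).
Proof.
by have := @cmeas_expi R D (- k%:~R); under eq_fun do rewrite mulNr.
Qed.

Lemma l1_le_expi a K x : l1_le a K -> l1_le (fun k => a k * expi (k%:~R * x)) K.
Proof. by move=> h; apply: l1_le_dom h _ => k; rewrite normcM normc_expi mulr1. Qed.

Lemma cmeas_fser a K D : l1_le a K -> cmeas D (fser a).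
Proof.
move=> aK; apply: cmeas_bilateral => [k|x _]; last by exists K; exact: l1_le_expi.
by apply: cmeasZ; exact: cmeas_expi.
Qed.

Lemma fser_bound a K x : l1_le a K -> normc (fser a x) <= K.
Proof. by move=> aK; apply: l1_le_normc; exact: l1_le_expi. Qed.

Lemma cintegrable_Omega f K : cmeas Omega f -> ebounded Omega f K ->
  cintegrable Omega f.
Proof.
by apply: cintegrable_ebounded; [exact: measurable_Omega|exact: mu_Omega_fin].
Qed.

Lemma pi2_inv : ((2 * pi : R)^-1)%:C * (2 * pi)%:C = 1 :> C.
Proof.
rewrite -rmorphM mulVf ?rmorph1 //; apply/negP => /eqP h.
by have := pi_gt0 R; lra.
Qed.

(** Term by term integration is allowed because the terms are dominated by
    |a_j| |g|. *)
Lemma fourier_coef_fserM a K g Kg k : l1_le a K -> cmeas Omega g ->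
  0 <= Kg -> ebounded Omega g Kg ->
  fourier_coef (fun x => fser a x * g x) k =
  bilateral_sum (fun j => a j * fourier_coef g (k - j)).
Proof.
move=> aK mg Kg0 bg.
pose F j x := a j * (g x * expi (- ((k - j)%:~R * x))).
have FE j x : F j x = a j * expi (j%:~R * x) * (g x * expi (- (k%:~R * x))).
  rewrite /F rmorphB /= mulrBl opprB addrC expiD; ring.
have nF j x : normc (F j x) = normc (a j) * normc (g x).
  by rewrite !normcM normc_expi mulr1.
have mG j : cmeas Omega (fun x => g x * expi (- ((k - j)%:~R * x))).
  by apply: cmeasM => //; exact: cmeas_expiN.
have iG j : cintegrable Omega (fun x => g x * expi (- ((k - j)%:~R * x))).
  apply: (@cintegrable_Omega _ Kg) => //.
  move: bg; apply: filterS; first exact: (ae_filter_ringOfSetsType mu).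
  by move=> x h Ox; rewrite normcM normc_expi mulr1 h.
have lF x : l1_le (fun j => F j x) (normc (g x) * K).
  move=> s us; under eq_bigr do rewrite nF mulrC.
  by rewrite -mulr_sumr ler_wpM2l ?normc_ge0 ?aK.
have lK : l1_le (fun j => F j 0) (normc (g 0) * K) by exact: lF.
have K0 : 0 <= K by have := aK [::] isT; rewrite big_nil.
have := @cintegral_bilateral R Omega F (Kg * K) measurable_Omega mu_Omega_fin.
case.
- by move=> j; exact: cmeasZ.
- by move=> x _; exists (normc (g x) * K).
- move: bg; apply: filterS; first exact: (ae_filter_ringOfSetsType mu).
  by move=> x h Ox s us; apply: le_trans (lF x s us) _; rewrite ler_wpM2r ?h.
move=> h1 h2; have {h1 h2}h := conj h1 h2.
have {}h := has_bsumZ ((2 * pi)^-1)%:C h.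
rewrite fourier_coefE; apply/esym.
have -> : cintegral Omega (fun x => fser a x * g x * expi (- (k%:~R * x))) =
    cintegral Omega (fun x => bilateral_sum (fun j => F j x)).
  apply: cintegral_eq => x _; rewrite /fser -mulrA mulrC.
  rewrite -(bilateral_sumZ _ (l1_le_expi x aK)); congr bilateral_sum.
  by apply/funext => j; rewrite FE mulrC.
rewrite -(has_bsum_eq h); congr bilateral_sum; apply/funext => j.
rewrite fourier_coefE cintegralZ //; [ring|exact: measurable_Omega].
Qed.

Lemma fourier_coef_fser a K k : l1_le a K -> fourier_coef (fser a) k = a k.
Proof.
move=> aK.
have -> : fser a = (fun x => fser a x * 1) by apply/funext => x; rewrite mulr1.
rewrite (@fourier_coef_fserM a K (fun=> 1) 1) //; last first.
  by apply: ebounded_pt => x _; rewrite normc1.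
rewrite -[RHS](bilateral_sum_delta k); congr bilateral_sum; apply/funext => j.
rewrite fourier_coefE.
have -> : cintegral Omega (fun x => 1 * expi (- ((k - j)%:~R * x))) =
   if j == k then (2 * pi)%:C else 0.
  rewrite -subr_eq0 -cintegral_Omega_expi; apply: cintegral_eq => x _.
  by rewrite mul1r -mulNr -rmorphN opprB.
by case: eqP => [->|_]; rewrite ?pi2_inv ?mulr1 ?mulr0.
Qed.

Lemma fourier_coef_ae f g k : cmeas Omega f -> cmeas Omega g ->
  {ae mu, forall x, Omega x -> f x = g x} -> fourier_coef f k = fourier_coef g k.
Proof.
move=> mf mg fg; rewrite !fourier_coefE; congr (_ * _).
apply: cintegral_ae_eq; first exact: measurable_Omega.
- by apply: cmeasM => //; exact: cmeas_expiN.
- by apply: cmeasM => //; exact: cmeas_expiN.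
move: fg; apply: filterS; first exact: (ae_filter_ringOfSetsType mu).
by move=> x h Ox; rewrite h.
Qed.

End FourierSeries.

(** * Uniqueness of Fourier coefficients *)

Section Uniqueness.
Context {R : realType}.
Local Notation C := R[i].
Local Notation mu := (@lebesgue_measure R).
Local Notation Omega := (@Omega R).
Implicit Types (f g : R -> C) (x : R) (k j : int) (K : R).

Lemma cintegrableM (D : set R) f g K : measurable D -> cintegrable D f ->
  cmeas D g -> (forall x, D x -> normc (g x) <= K) ->
  cintegrable D (fun x => f x * g x).
Proof.
move=> mD cf mg gK; have [mr mi] := cmeasM (cintegrable_meas cf) mg.
pose G x : \bar R := (`|K| * (`|Re (f x)| + `|Im (f x)|))%:E.
have iG : mu.-integrable D G.
  rewrite /G; under eq_fun do rewrite EFinM EFinD.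
  apply: integrableZl => //; apply: integrableD => //.
  - by under eq_fun do rewrite -abse_EFin; exact: (integrable_abse cf.1).
  - by under eq_fun do rewrite -abse_EFin; exact: (integrable_abse cf.2).
have nG x : D x -> normc (f x * g x) <= `|K| * (`|Re (f x)| + `|Im (f x)|).
  move=> Dx; rewrite normcM mulrC ler_pM ?normc_ge0 //.
  - by apply: le_trans (gK x Dx) _; exact: ler_norm.
  - exact: normc_le_ReIm.
have G0 x : `|G x|%E = G x.
  by rewrite /G abse_EFin ger0_norm // mulr_ge0 // addr_ge0.
split; apply: le_integrable iG => //; try exact/measurable_EFinP.
- move=> x Dx; rewrite G0 abse_EFin lee_fin.
  by apply: le_trans (nG x Dx); exact: Re_le_normc.
- move=> x Dx; rewrite G0 abse_EFin lee_fin.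
  by apply: le_trans (nG x Dx); exact: Im_le_normc.
Qed.

(** By Lebesgue differentiation an integrable function is almost everywhere
    the derivative of its primitive. *)
Lemma ae_eq0_of_primitive (h : R -> R) :
  mu.-integrable Omega (fun x => (h x)%:E) ->
  (forall b, - pi < b < pi -> \int[mu]_(x in Omega) (h x * (x <= b)%R%:R) = 0) ->
  {ae mu, forall x, Omega x -> h x = 0}.
Proof.
move=> ih h0; have mO := @measurable_Omega R.
have lH := integrable_locally_restrict mO ih.
have iH : mu.-integrable setT (fun x => ((h \_ Omega) x)%:E).
  have : mu.-integrable setT ((fun x => (h x)%:E) \_ Omega).
    by apply/(integrable_mkcond _ _).1.
  by apply: eq_integrable => // x _; rewrite /patch; case: ifP.
have := @FTC1Ny R (h \_ Omega); case => //.
- by move=> y; apply: (integrableS measurableT) => //.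
move=> M [mM M0 sM]; exists M; split => //.
apply: subset_trans sM => x /= nh; apply: contra_not nh => -[_ dF] Ox.
have {dF} : (h \_ Omega) x = 0.
  rewrite -dF derive1E.
  rewrite (@near_eq_derive R R R _ (fun=> 0) x 1); first by rewrite derive_cst.
  have : nbhs x `]- pi, pi[%classic.
    by apply: open_nbhs_nbhs; split; [exact: itv_open|].
  apply: filterS => b /=; rewrite in_itv /= => bO.
  rewrite -[RHS](h0 b bO) [LHS]Rintegral_mkcond [RHS]Rintegral_mkcond.
  apply: eq_Rintegral => y _; rewrite /patch /=.
  have -> : (y \in `]-oo, b]%classic) = (y <= b).
    by apply/idP/idP; rewrite inE /= in_itv.
  by case: ifP; case: ifP; rewrite ?mulr1 ?mulr0.
by rewrite /patch mem_set.
Qed.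

Lemma bernoulli_ineq (y : R) (n : nat) : -1 <= y -> 1 + n%:R * y <= (1 + y) ^+ n.
Proof.
move=> y1; elim: n => [|n IH]; first by rewrite mul0r addr0 expr0.
rewrite exprS -natr1; have : 0 <= n%:R :> R by [].
move: IH; set c : R := n%:R; set X := _ ^+ n => IH c0.
have : (1 + y) * (1 + c * y) <= (1 + y) * X by rewrite ler_wpM2l //; lra.
have := sqr_ge0 y; nra.
Qed.

(** On [0, 1] the polynomials (1 - v^n)^(2^n) converge to the indicator function
    of [0, 1/2[ away from 1/2, by the Bernoulli inequality on both sides. *)
Definition step_poly (n : nat) : {poly C} := (1 - 'X^n) ^+ (2 ^ n).
Definition stepv (n : nat) (v : R) : R := (1 - v ^+ n) ^+ (2 ^ n).

Lemma horner_step (n : nat) (v : R) : (step_poly n).[v%:C] = (stepv n v)%:C.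
Proof. by rewrite /step_poly /stepv !hornerE /= rmorphXn rmorphB rmorph1 rmorphXn. Qed.

Lemma stepv_01 (n : nat) (v : R) : 0 <= v <= 1 -> 0 <= stepv n v <= 1.
Proof.
move=> /andP[v0 v1]; have h0 : 0 <= v ^+ n by exact: exprn_ge0.
have h1 : v ^+ n <= 1 by exact: exprn_ile1.
by rewrite /stepv exprn_ge0 ?exprn_ile1 //; lra.
Qed.

Lemma stepv_cvg1 (v : R) : 0 <= v -> v < 1 / 2 -> stepv ^~ v @ \oo --> (1 : R).
Proof.
move=> v0 v1.
have g : (fun n => 1 - (2 * v) ^+ n) @ \oo --> (1 : R).
  rewrite -[X in _ --> X]subr0; apply: cvgB; first exact: cvg_cst.
  by apply: cvg_expr; rewrite ger0_norm ?mulr_ge0 //; lra.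
apply: (squeeze_cvgr _ g (cvg_cst _)); apply: nearW => n.
have h0 : 0 <= v ^+ n by exact: exprn_ge0.
have h1 : v ^+ n <= 1 by apply: exprn_ile1 => //; lra.
have /andP[_ ->] : 0 <= stepv n v <= 1 by apply: stepv_01; lra.
rewrite andbT; have := @bernoulli_ineq (- v ^+ n) (2 ^ n).
by rewrite exprMn natrX mulrN; apply; lra.
Qed.

Lemma stepv_cvg0 (v : R) : 1 / 2 < v -> v <= 1 -> stepv ^~ v @ \oo --> (0 : R).
Proof.
move=> v0 v1; have vp : 0 < 2 * v by lra.
have g : (fun n => (2 * v)^-1 ^+ n) @ \oo --> (0 : R).
  apply: cvg_expr; rewrite ger0_norm ?invr_ge0 ?(ltW vp) //.
  by rewrite invf_lt1 //; lra.
apply: (squeeze_cvgr _ (cvg_cst _) g); apply: nearW => n.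
have h0 : 0 <= v ^+ n by apply: exprn_ge0; lra.
have h1 : v ^+ n <= 1 by apply: exprn_ile1 => //; lra.
have /andP[-> _] : 0 <= stepv n v <= 1 by apply: stepv_01; lra.
rewrite /= exprVn -[leRHS]mul1r ler_pdivlMr ?exprn_gt0 //.
have hb := @bernoulli_ineq (v ^+ n) (2 ^ n).
apply: (@le_trans _ _ ((1 - v ^+ n) ^+ (2 ^ n) * (1 + v ^+ n) ^+ (2 ^ n))).
  rewrite ler_wpM2l ?exprn_ge0 ?subr_ge0 //.
  by rewrite exprMn -natrX; have := hb _; lra.
rewrite -exprMn; apply: exprn_ile1; nra.
Qed.

(** Multiplication by the trigonometric polynomial v, of degree one, only
    shifts frequencies by at most one; so if all coefficients of g vanish, those of
    g p(v) vanish too, by induction on p. *)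
Lemma fourier_orthogonal_poly g (al : R) (be be' : C) (v : R -> R) :
  cintegrable Omega g -> (forall k, fourier_coef g k = 0) ->
  (forall x, 0 <= v x <= 1) ->
  (forall x, (v x)%:C = al%:C + be * expi x + be' * expi (- x)) ->
  forall p : {poly C}, forall k,
    cintegral Omega (fun x => g x * p.[(v x)%:C] * expi (k%:~R * x)) = 0.
Proof.
move=> cg g0 v01 vE p; have mO := @measurable_Omega R.
have mv : cmeas Omega (fun x => (v x)%:C).
  under eq_fun do rewrite vE; apply: cmeasD; [apply: cmeasD|].
  - exact: cmeas_cst.
  - by apply: cmeasZ; have := @cmeas_expi R Omega 1; under eq_fun do rewrite mul1r.
  - by apply: cmeasZ; have := @cmeas_expi R Omega (-1); under eq_fun do rewrite mulN1r.
suff [_ _] : [/\ cmeas Omega (fun x => p.[(v x)%:C]),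
   exists K, forall x, normc p.[(v x)%:C] <= K &
   forall k, cintegral Omega (fun x => g x * p.[(v x)%:C] * expi (k%:~R * x)) = 0] by [].
have cz k : cintegral Omega (fun x => g x * expi (k%:~R * x)) = 0.
  have := g0 (- k); rewrite fourier_coefE => /eqP.
  rewrite mulf_eq0 => /orP[/eqP h|/eqP h].
    by move: (@pi2_inv R) (@oner_neq0 C); rewrite h mul0r => ->; rewrite eqxx.
  by rewrite -[RHS]h; apply: cintegral_eq => x _; rewrite rmorphN mulNr opprK.
elim/poly_ind: p => [|p c [mp [K pK] pz]].
  split.
  - by under eq_fun do rewrite horner0; exact: cmeas_cst.
  - by exists 0 => x; rewrite horner0 normc0.
  - move=> k; rewrite -[RHS](cintegral0 Omega); apply: cintegral_eq => x _.
    by rewrite horner0 mulr0 mul0r.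
have K0 : 0 <= K by apply: le_trans (pK 0); exact: normc_ge0.
have cge k : cintegrable Omega (fun x => g x * expi (k%:~R * x)).
  apply: (@cintegrableM _ _ _ 1) => //; first exact: cmeas_expi.
  by move=> x _; rewrite normc_expi.
have cgp k : cintegrable Omega (fun x => g x * p.[(v x)%:C] * expi (k%:~R * x)).
  apply: (@cintegrableM _ _ _ 1) => //; last by move=> x _; rewrite normc_expi.
    by apply: (@cintegrableM _ _ _ K).
  exact: cmeas_expi.
split.
- under eq_fun do rewrite !hornerE; apply: cmeasD; last exact: cmeas_cst.
  exact: cmeasM.
- exists (K + normc c) => x; rewrite !hornerE.
  apply: le_trans (le_normcD _ _) _; rewrite lerD2r normcM normc_real.
  have /andP[h0 h1] := v01 x.
  by rewrite -[leRHS]mulr1 ler_pM ?normc_ge0 // ger0_norm.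
move=> k.
transitivity (cintegral Omega (fun x =>
   al%:C * (g x * p.[(v x)%:C] * expi (k%:~R * x)) +
   be * (g x * p.[(v x)%:C] * expi ((k + 1)%:~R * x)) +
   be' * (g x * p.[(v x)%:C] * expi ((k - 1)%:~R * x)) +
   c * (g x * expi (k%:~R * x)))).
  apply: cintegral_eq => x _; rewrite !hornerE {2}vE !rmorphD rmorphN rmorph1 /=.
  by rewrite !mulrDl mul1r mulN1r !expiD; ring.
pose V f := cintegrable Omega f /\ cintegral Omega f = 0.
have VD f f' : V f -> V f' -> V (fun x => f x + f' x).
  move=> [c1 e1] [c2 e2]; split; first exact: cintegrableD.
  by rewrite cintegralD // e1 e2 addr0.
have VZ z f : V f -> V (fun x => z * f x).
  move=> [c1 e1]; split; first exact: cintegrableZ.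
  by rewrite cintegralZ // e1 mulr0.
have Vp k' : V (fun x => g x * p.[(v x)%:C] * expi (k'%:~R * x)) by [].
by have [] := VD _ _ (VD _ _ (VD _ _ (VZ al%:C _ (Vp k)) (VZ be _ (Vp (k + 1))))
  (VZ be' _ (Vp (k - 1)))) (VZ c _ (conj (cge k) (cz k))).
Qed.

(** Comparing cosines decides whether x lies on the arc of half-length d around
    m; the condition on 2 pi - d prevents x from reaching that arc by going around
    the circle. *)
Lemma cos_compare (m d x : R) : 0 < d -> d < pi -> `|x - m| < 2 * pi - d ->
  (`|x - m| < d -> cos d < cos (x - m)) /\ (d < `|x - m| -> cos (x - m) < cos d).
Proof.
move=> d0 dp xm; have pp := pi_gt0 R; rewrite -(cos_norm (x - m)).
move: (normr_ge0 (x - m)) xm; set y := `|x - m| => y0 yd.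
have din : d \in `[0, pi] by rewrite in_itv /=; lra.
split=> h.
  by rewrite ltr_cos // in_itv /=; lra.
have [yp|py] := leP y pi.
  by rewrite ltr_cos // in_itv /=; lra.
have -> : cos y = cos (2 * pi - y).
  by rewrite -(cosN (2 * pi - y)) opprB -(cosD2pi (y - 2 * pi)) mulr2n; congr cos; ring.
by rewrite ltr_cos ?in_itv /=; lra.
Qed.

(** The trigonometric polynomial v = 1/2 - (cos (x - m) - cos d) / 4 has values
    in [0, 1], and in ]-pi, pi[ it is below 1/2 precisely on the arc ]-pi, b[, of
    midpoint m and half-length d.  The integrals of g times a polynomial in v
    vanish; those of [step_poly] give in the limit that the integral of g over
    ]-pi, b[ vanishes for each b, whence g = 0 almost everywhere. *)
Theorem fourier_uniqueness g : cintegrable Omega g ->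
  (forall k, fourier_coef g k = 0) -> {ae mu, forall x, Omega x -> g x = 0}.
Proof.
move=> cg g0; have mO := @measurable_Omega R; have pp := pi_gt0 R.
have key (p : C -> R) (pM : forall z (t : R), p (z * t%:C) = p z * t)
    (ip : mu.-integrable Omega (fun x => (p (g x))%:E))
    (pI : forall f, cintegral Omega f = 0 -> \int[mu]_(x in Omega) p (f x) = 0) :
    {ae mu, forall x, Omega x -> p (g x) = 0}.
  apply: ae_eq0_of_primitive => // b /andP[b1 b2].
  pose m := (b - pi) / 2; pose d := (b + pi) / 2.
  have d0 : 0 < d by rewrite /d; lra.
  have dp : d < pi by rewrite /d; lra.
  (* -pi and b are the points m - d and m + d. *)
pose v x := 1 / 2 - (cos (x - m) - cos d) / 4.
  have v01 x : 0 <= v x <= 1.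
    rewrite /v; have := cos_geN1 (x - m); have := cos_le1 (x - m).
    by have := cos_geN1 d; have := cos_le1 d; lra.
  have vE x : (v x)%:C = (1 / 2 + cos d / 4)%:C +
      (- (8^-1)%:C * expi (- m)) * expi x + (- (8^-1)%:C * expi m) * expi (- x).
    rewrite -!mulrA -!expiD /v.
    apply: ReImP.
      rewrite /= (_ : - m + x = x - m); last ring.
      by rewrite -(opprB x m) cosN sinN; field.
    rewrite /= (_ : - m + x = x - m); last ring.
    by rewrite -(opprB x m) cosN sinN; field.
  have I0 (n : nat) : \int[mu]_(x in Omega) (p (g x) * stepv n (v x)) = 0.
    have := fourier_orthogonal_poly cg g0 v01 vE (step_poly n) 0.
    have -> : (fun x => g x * (step_poly n).[(v x)%:C] * expi (0%:~R * x)) =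
       (fun x => g x * (stepv n (v x))%:C).
      by apply/funext => x; rewrite mul0r expi0 mulr1 horner_step.
    by move=> /pI; under eq_Rintegral do rewrite pM.
  have mp : measurable_fun Omega (fun x => p (g x)).
    by apply/measurable_EFinP; exact: (measurable_int mu ip).
  have mvx : measurable_fun Omega v.
    apply: measurable_funTS; apply: continuous_measurable_fun => x.
    apply: cvgB; first exact: cvg_cst.
    apply: cvgM; last exact: cvg_cst.
    apply: cvgB; last exact: cvg_cst.
    apply: (@continuous_comp _ _ _ (fun x => x - m) (@cos R)); last exact: continuous_cos.
    by apply: cvgB; [exact: cvg_id|exact: cvg_cst].
  (* The limit is the indicator function of the arc, except at the point b. *)
  have [] := @dominated_convergence _ _ R mu Omega mO
    (fun n x => (p (g x) * stepv n (v x))%:E)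
    (fun x => (p (g x) * (x <= b)%R%:R)%:E) (fun x => `|(p (g x))%:E|%E).
  - move=> n; apply/measurable_EFinP; apply: measurable_funM => //.
    rewrite /stepv; apply: measurable_funX; apply: measurable_funB => //.
    exact: measurable_funX.
  - apply/measurable_EFinP; apply: measurable_funM => //.
    apply: (@measurableT_comp _ _ _ _ _ _ (fun b : bool => b%:R : R)) => //.
    by apply: measurable_fun_ler.
  - exists [set b]; split => //; first exact: lebesgue_measure_set1.
    move=> x /= nx; apply: contrapT => xb; apply: nx => Ox.
    apply: cvg_EFin; first exact: nearW.
    apply: cvgM; first exact: cvg_cst.
    move: Ox; rewrite OmegaE /= in_itv /= => /andP[x1 x2].
    have xm : `|x - m| < 2 * pi - d.
      by rewrite ltr_norml /m /d; apply/andP; split; lra.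
    have [c1 c2] := cos_compare d0 dp xm.
    have /andP[vx0 vx1] := v01 x.
    have [xlb|bx] := ltP x b.
      rewrite ltW //; apply: stepv_cvg1 => //.
      have : cos d < cos (x - m) by apply: c1; rewrite ltr_norml /m /d; apply/andP; split; lra.
      by rewrite /v; lra.
    have {}bx : b < x by rewrite lt_neqAle bx andbT; apply/eqP => bx'; apply: xb.
    rewrite leNgt bx /=; apply: stepv_cvg0 => //.
    have : cos (x - m) < cos d.
      by apply: c2; apply: lt_le_trans (ler_norm _); rewrite /m /d; lra.
    by rewrite /v; lra.
  - exact: integrable_abse.
  - apply: aeW => x n _; rewrite !abse_EFin lee_fin normrM.
    have /andP[s0 s1] := @stepv_01 n _ (v01 x).
    by rewrite ler_piMr // ger0_norm.
  move=> iL _ hl; have fL := integrable_fin_num _ iL.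
  rewrite -(fineK (fL mO)) in hl.
  have := fine_cvg hl; rewrite (_ : fine \o _ = fun=> 0); last first.
    by apply/funext => n; exact: I0.
  move=> /(_ _) c0; rewrite /Rintegral -(cvg_lim _ c0) //; exact: lim_cst.
have hR : {ae mu, forall x, Omega x -> Re (g x) = 0}.
  apply: key => [z t||f /(congr1 (@complex.Re R))//].
    by rewrite Re_M /= mulr0 subr0.
  exact: cg.1.
have hI : {ae mu, forall x, Omega x -> Im (g x) = 0}.
  apply: key => [z t||f /(congr1 (@complex.Im R))//].
    by rewrite Im_M /= mulr0 add0r.
  exact: cg.2.
move: hR hI; apply: filterS2; first exact: (ae_filter_ringOfSetsType mu).
by move=> x h1 h2 Ox; apply: ReImP; rewrite ?h1 ?h2.
Qed.

End Uniqueness.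

(** * Functions represented by their coefficients *)

Section Representation.
Context {R : realType}.
Local Notation C := R[i].
Local Notation mu := (@lebesgue_measure R).
Local Notation Omega := (@Omega R).
Implicit Types (f g : R -> C) (a b p : int -> C) (x s : R) (k j : int) (K P r : R).

(** Up to a null set, f is the sum of the Fourier series with coefficients a, and
    a lies in H^r.  Carrying f and a together lets each operation on functions be
    followed on the coefficients. *)
Definition fourier_rep r f a :=
  [/\ cmeas Omega f, {ae mu, forall x, Omega x -> f x = fser a x} &
      exists K, sob_le r a K].

Lemma fser_meas r a K : 1 / 2 < r -> sob_le r a K -> cmeas Omega (fser a).
Proof. by move=> r2 /(sob_le_l1 r2) h; exact: cmeas_fser h. Qed.

Lemma rep_fser r a K : 1 / 2 < r -> sob_le r a K -> fourier_rep r (fser a) a.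
Proof.
by move=> r2 aK; split; [exact: fser_meas aK|exact: aeW|exists K].
Qed.

Lemma rep_coef r f a : 1 / 2 < r -> fourier_rep r f a -> fourier_coef f = a.
Proof.
move=> r2 [mf fa [K aK]]; apply/funext => k.
rewrite (fourier_coef_ae k mf (fser_meas r2 aK) fa).
exact: fourier_coef_fser (sob_le_l1 r2 aK).
Qed.

Lemma rep_ebounded r f a : 1 / 2 < r -> fourier_rep r f a ->
  exists2 K, 0 <= K & ebounded Omega f K.
Proof.
move=> r2 [mf fa [K aK]]; exists (zeta_bound r * K).
  rewrite mulr_ge0 ?(sob_le_ge0 aK) //; have := zeta_bound_ge1 r2; lra.
move: fa; apply: filterS; first exact: (ae_filter_ringOfSetsType mu).
by move=> x h Ox; rewrite h //; apply: fser_bound; exact: sob_le_l1.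
Qed.

Lemma rep_cintegrable r f a : 1 / 2 < r -> fourier_rep r f a -> cintegrable Omega f.
Proof.
move=> r2 fa; have [K _ bK] := rep_ebounded r2 fa; case: fa => mf _ _.
exact: cintegrable_Omega bK.
Qed.

Lemma fourier_coefB f g k : cintegrable Omega f -> cintegrable Omega g ->
  fourier_coef (fun x => f x - g x) k = fourier_coef f k - fourier_coef g k.
Proof.
move=> cf cg; have mO := @measurable_Omega R; rewrite !fourier_coefE -mulrBr.
have ce h : cintegrable Omega h ->
    cintegrable Omega (fun x => h x * expi (- (k%:~R * x))).
  move=> ch; apply: (@cintegrableM _ _ _ _ 1) => //; first exact: cmeas_expiN.
  by move=> x _; rewrite normc_expi.
rewrite -cintegralB //; [|exact: ce|exact: ce].
by congr (_ * _); apply: cintegral_eq => x _; rewrite mulrBl.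
Qed.

(** The function and the sum of its Fourier series have the same coefficients,
    so that the uniqueness theorem applies to their difference. *)
Lemma rep_of_coef r f K : 1 / 2 < r -> cintegrable Omega f ->
  sob_le r (fourier_coef f) K -> fourier_rep r f (fourier_coef f).
Proof.
move=> r2 cf fK; split; [exact: cintegrable_meas|idtac|by exists K].
have rS := rep_fser r2 fK; have cS := rep_cintegrable r2 rS.
have := @fourier_uniqueness R (fun x => f x - fser (fourier_coef f) x)
  (cintegrableB (@measurable_Omega R) cf cS).
move=> H; have : {ae mu, forall x, Omega x -> f x - fser (fourier_coef f) x = 0}.
  by apply: H => k; rewrite fourier_coefB // (rep_coef r2 rS) subrr.
apply: filterS; first exact: (ae_filter_ringOfSetsType mu).
by move=> x h Ox; apply/eqP; rewrite -subr_eq0 h.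
Qed.

Lemma rep_eq r f g a : (forall x, g x = f x) -> fourier_rep r f a -> fourier_rep r g a.
Proof. by move=> fg; rewrite (_ : g = f) //; exact/funext. Qed.

Lemma rep_eqa r f a b : (forall k, b k = a k) -> fourier_rep r f a -> fourier_rep r f b.
Proof. by move=> fg; rewrite (_ : b = a) //; exact/funext. Qed.

Lemma fserD a b Ka Kb x : l1_le a Ka -> l1_le b Kb ->
  fser (fun k => a k + b k) x = fser a x + fser b x.
Proof.
move=> ha hb; rewrite /fser -(bilateral_sumD (l1_le_expi x ha) (l1_le_expi x hb)).
by congr bilateral_sum; apply/funext => k; rewrite mulrDl.
Qed.

Lemma fserZ z a K x : l1_le a K -> fser (fun k => z * a k) x = z * fser a x.
Proof.
move=> ha; rewrite /fser -(bilateral_sumZ z (l1_le_expi x ha)).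
by congr bilateral_sum; apply/funext => k; rewrite mulrA.
Qed.

Lemma l1_le_crefl a K : l1_le a K -> l1_le (crefl a) K.
Proof.
move=> aK s us; under eq_bigr do rewrite /crefl normc_conj.
have -> : \sum_(k <- s) normc (a (- k)) = \sum_(k <- map -%R s) normc (a k).
  by rewrite big_map.
by apply: aK; rewrite map_inj_uniq //; exact: oppr_inj.
Qed.

Lemma fser_conj a K x : l1_le a K -> (fser a x)^* = fser (crefl a) x.
Proof.
move=> ha; rewrite /fser -(bilateral_sum_conj (l1_le_expi x ha)).
rewrite -(bilateral_sum_opp (l1_le_expi x (l1_le_crefl ha))).
congr bilateral_sum; apply/funext => k.
by rewrite /crefl opprK rmorphM /= expi_conj rmorphN mulNr.
Qed.

Lemma repD r f g a b : 1 / 2 < r -> fourier_rep r f a -> fourier_rep r g b ->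
  fourier_rep r (fun x => f x + g x) (fun k => a k + b k).
Proof.
move=> r2 [mf fa [Ka ha]] [mg gb [Kb hb]]; split.
- exact: cmeasD.
- move: fa gb; apply: filterS2; first exact: (ae_filter_ringOfSetsType mu).
  move=> x h1 h2 Ox; rewrite h1 // h2 //.
  by rewrite (fserD x (sob_le_l1 r2 ha) (sob_le_l1 r2 hb)).
- by exists (Ka + Kb); exact: sob_leD.
Qed.

Lemma repZ r z f a : 1 / 2 < r -> fourier_rep r f a ->
  fourier_rep r (fun x => z * f x) (fun k => z * a k).
Proof.
move=> r2 [mf fa [Ka ha]]; split.
- exact: cmeasZ.
- move: fa; apply: filterS; first exact: (ae_filter_ringOfSetsType mu).
  by move=> x h1 Ox; rewrite h1 // (fserZ z x (sob_le_l1 r2 ha)).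
- by exists (normc z * Ka); exact: sob_leZ.
Qed.

Lemma repN r f a : 1 / 2 < r -> fourier_rep r f a ->
  fourier_rep r (fun x => - f x) (fun k => - a k).
Proof.
move=> r2 fa; apply: (@rep_eq _ (fun x => -1 * f x)); first by move=> x; rewrite mulN1r.
by apply: (@rep_eqa _ _ (fun k => -1 * a k)); [move=> k; rewrite mulN1r|exact: repZ].
Qed.

Lemma repB r f g a b : 1 / 2 < r -> fourier_rep r f a -> fourier_rep r g b ->
  fourier_rep r (fun x => f x - g x) (fun k => a k - b k).
Proof. by move=> r2 fa gb; apply: repD => //; exact: repN. Qed.

Lemma rep_conj r f a : 1 / 2 < r -> fourier_rep r f a ->
  fourier_rep r (fun x => (f x)^*) (crefl a).
Proof.
move=> r2 [mf fa [Ka ha]]; split.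
- exact: cmeas_conj.
- move: fa; apply: filterS; first exact: (ae_filter_ringOfSetsType mu).
  by move=> x h1 Ox; rewrite h1 // (fser_conj x (sob_le_l1 r2 ha)).
- by exists Ka; exact: sob_le_crefl.
Qed.

(** The coefficients of the product are the convolution, which is again in H^r;
    uniqueness then gives back the function. *)
Lemma repM r f g a b : 1 / 2 < r -> fourier_rep r f a -> fourier_rep r g b ->
  fourier_rep r (fun x => f x * g x) (conv a b).
Proof.
move=> r2 ra rb; have [mf fa [Ka ha]] := ra; have [mg gb [Kb hb]] := rb.
have [Kf Kf0 bf] := rep_ebounded r2 ra; have [Kg Kg0 bg] := rep_ebounded r2 rb.
have mfg : cmeas Omega (fun x => f x * g x) by exact: cmeasM.
have cfg : cintegrable Omega (fun x => f x * g x).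
  apply: (@cintegrable_Omega _ _ (Kf * Kg)) => //.
  move: bf bg; apply: filterS2; first exact: (ae_filter_ringOfSetsType mu).
  by move=> x h1 h2 Ox; rewrite normcM ler_pM ?normc_ge0 ?h1 ?h2.
have E : fourier_coef (fun x => f x * g x) = conv a b.
  apply/funext => k; rewrite (@fourier_coef_ae _ _ (fun x => fser a x * g x)) //.
  - rewrite (fourier_coef_fserM k (sob_le_l1 r2 ha) mg Kg0 bg).
    by rewrite /conv (rep_coef r2 rb).
  - by apply: cmeasM => //; exact: fser_meas ha.
  - move: fa; apply: filterS; first exact: (ae_filter_ringOfSetsType mu).
    by move=> x h Ox; rewrite h.
rewrite -E; apply: (@rep_of_coef _ _ (conv_const r * (Ka * Kb))) => //.
by rewrite E; apply: sob_conv => //; lra.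
Qed.

Lemma repX2 r f a : 1 / 2 < r -> fourier_rep r f a ->
  fourier_rep r (fun x => f x ^+ 2) (conv a a).
Proof.
move=> r2 fa; apply: (@rep_eq _ (fun x => f x * f x)); last exact: repM.
by move=> x; rewrite expr2.
Qed.

(** Read off from the commutativity of the product of functions, without
    reindexing sums. *)
Lemma convC r a b Ka Kb : 1 / 2 < r -> sob_le r a Ka -> sob_le r b Kb ->
  conv a b = conv b a.
Proof.
move=> r2 ha hb; have ra := rep_fser r2 ha; have rb := rep_fser r2 hb.
rewrite -(rep_coef r2 (repM r2 ra rb)) -(rep_coef r2 (repM r2 rb ra)).
by congr fourier_coef; apply/funext => x; rewrite mulrC.
Qed.

Lemma conv_crefl r a b Ka Kb : 1 / 2 < r -> sob_le r a Ka -> sob_le r b Kb ->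
  crefl (conv a b) = conv (crefl a) (crefl b).
Proof.
move=> r2 ha hb; have ra := rep_fser r2 ha; have rb := rep_fser r2 hb.
rewrite -(rep_coef r2 (rep_conj r2 (repM r2 ra rb))).
rewrite -(rep_coef r2 (repM r2 (rep_conj r2 ra) (rep_conj r2 rb))).
by congr fourier_coef; apply/funext => x; rewrite rmorphM.
Qed.

Lemma rep_mult r p f a P : 1 / 2 < r -> (forall k, normc (p k) <= P) ->
  fourier_rep r f a -> fourier_rep r (fourier_mult p f) (fun k => p k * a k).
Proof.
move=> r2 pP fa; have P0 : 0 <= P by apply: le_trans (pP 0); exact: normc_ge0.
apply: (@rep_eq _ (fser (fun k => p k * a k))).
  by move=> x; rewrite fourier_multE (rep_coef r2 fa).
case: fa => _ _ [K aK]; apply: (@rep_fser _ _ (P * K)) => //.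
by apply: sob_le_dom aK => // k; rewrite normcM ler_wpM2r ?normc_ge0.
Qed.

Lemma rep_cst r (z : C) : 1 / 2 < r ->
  fourier_rep r (fun=> z) (fun k => if k == 0 then z else 0).
Proof.
move=> r2; apply: (@rep_eq _ (fser (fun k => if k == 0 then z else 0))).
  move=> x; rewrite /fser -[LHS](bilateral_sum_delta 0).
  by congr bilateral_sum; apply/funext => k; case: eqP => [->|_];
    rewrite ?mul0r ?expi0 ?mulr1.
apply: (@rep_fser _ _ (normc z)) => //; split=> [|s us]; first exact: normc_ge0.
have [s0|s0] := boolP (0 \in s).
  rewrite (bigD1_seq 0) //= big1; last first.
    by move=> k /negbTE ->; rewrite normc0 expr0n mulr0.
  by rewrite addr0 /weight expr0n addr0 powR1 mul1r.
rewrite big1_seq ?sqr_ge0 // => k /= ks.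
rewrite ifN ?normc0 ?expr0n ?mulr0 //.
by apply: contraNneq s0 => <-.
Qed.

(** Integrability and value together, so that the integral of a long sum is
    computed in one pass. *)
Definition has_int (D : set R) f (z : C) := cintegrable D f /\ cintegral D f = z.

Lemma has_intD (D : set R) f g z w : measurable D -> has_int D f z -> has_int D g w ->
  has_int D (fun x => f x + g x) (z + w).
Proof.
by move=> mD [cf <-] [cg <-]; split; [exact: cintegrableD|rewrite cintegralD].
Qed.

Lemma has_intZ (D : set R) f z w : measurable D -> has_int D f z ->
  has_int D (fun x => w * f x) (w * z).
Proof.
by move=> mD [cf <-]; split; [exact: cintegrableZ|rewrite cintegralZ].
Qed.

Lemma has_intN (D : set R) f z : measurable D -> has_int D f z ->
  has_int D (fun x => - f x) (- z).
Proof.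
by move=> mD [cf <-]; split; [exact: cintegrableN|rewrite cintegralN].
Qed.

Lemma has_intB (D : set R) f g z w : measurable D -> has_int D f z -> has_int D g w ->
  has_int D (fun x => f x - g x) (z - w).
Proof. by move=> mD hf hg; apply: has_intD => //; exact: has_intN. Qed.

Lemma has_int_eq (D : set R) f g z : has_int D f z -> (forall x, g x = f x) ->
  has_int D g z.
Proof. by move=> hf fg; rewrite (_ : g = f) //; exact/funext. Qed.

Lemma cmeas_conv r (D : set R) (a b : R -> int -> C) k : 1 / 2 < r ->
  (forall j, cmeas D (fun s => a s j)) -> (forall j, cmeas D (fun s => b s j)) ->
  (forall s, D s -> exists K, sob_le r (a s) K) ->
  (forall s, D s -> exists K, sob_le r (b s) K) ->
  cmeas D (fun s => conv (a s) (b s) k).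
Proof.
move=> r2 ma mb ha hb; apply: (@cmeas_bilateral R D (fun j s => a s j * b s (k - j))).
  by move=> j; exact: cmeasM.
move=> s Ds; have [Ka hKa] := ha s Ds; have [Kb hKb] := hb s Ds.
exists (Ka * Kb); apply: (@l1_le_mul _ r (a s) (b s) Ka Kb _ k) => //; first lra.
by move=> j; rewrite normcM.
Qed.

(** The uniform bound is only required at almost all times, which is all that an
    essential bound on the solution provides. *)
Lemma fser_cintegral (D : set R) (a : R -> int -> C) K x : measurable D ->
  (mu D < +oo)%E -> (forall k, cmeas D (fun s => a s k)) ->
  (forall s, D s -> exists K', l1_le (a s) K') ->
  {ae mu, forall s, D s -> l1_le (a s) K} ->
  cintegral D (fun s => fser (a s) x) = fser (fun k => cintegral D (fun s => a s k)) x.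
Proof.
move=> mD Doo ma la aK.
have h := @cintegral_bilateral R D (fun k s => a s k * expi (k%:~R * x)) K mD Doo.
rewrite /fser -(has_bsum_eq (h _ _ _)).
- congr bilateral_sum; apply/funext => k.
  rewrite [RHS]mulrC -cintegralZ //; first by apply: cintegral_eq => s _; rewrite mulrC.
  apply: (@cintegrable_ebounded _ _ _ K) => //.
  move: aK; apply: filterS; first exact: (ae_filter_ringOfSetsType mu).
  by move=> s h1 Ds; have := h1 Ds [:: k] isT; rewrite big_seq1.
- by move=> k; apply: cmeasM => //; exact: cmeas_cst.
- by move=> s /la[K' hK']; exists K'; exact: l1_le_expi.
- move: aK; apply: filterS; first exact: (ae_filter_ringOfSetsType mu).
  by move=> s h1 Ds; exact: l1_le_expi (h1 Ds).
Qed.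

Lemma rep_cintegral r (D : set R) (F : R -> R -> C) (a : R -> int -> C) K :
  1 / 2 < r -> measurable D -> (mu D < +oo)%E -> 0 <= K ->
  (forall k, cmeas D (fun s => a s k)) ->
  (forall s, D s -> sob_le r (a s) K) ->
  (forall s x, D s -> F s x = fser (a s) x) ->
  fourier_rep r (fun x => cintegral D (fun s => F s x))
    (fun k => cintegral D (fun s => a s k)).
Proof.
move=> r2 mD Doo K0 ma aK FE.
apply: (@rep_eq _ (fser (fun k => cintegral D (fun s => a s k)))).
  move=> x; rewrite -(@fser_cintegral _ _ (zeta_bound r * K)) //.
  - by apply: cintegral_eq => s Ds; exact: FE.
  - by move=> s Ds; exists (zeta_bound r * K); exact: sob_le_l1 (aK s Ds).
  - by apply: aeW => s Ds; exact: sob_le_l1 (aK s Ds).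
apply: (@rep_fser _ _ (fine (mu D) * K)) => //.
apply: (@sob_le_cintegral R D r (fun k s => a s k)) => //; lra.
Qed.

End Representation.

(** * Symbols of the operators *)

Section Symbols.
Context {R : realType}.
Local Notation C := R[i].
Local Notation I := (Complex (0 : R) (1 : R)).
Implicit Types (c s t : R) (k : int) (a b : int -> C).

Definition lap k : R := k%:~R ^+ 2.
Definition Bsym c k : R := Num.sqrt ((k%:~R : R) ^+ 4 + k%:~R ^+ 2 + c).
Definition Asym c k : R := Bsym c k - lap k.

Lemma lap_ge0 k : 0 <= lap k. Proof. exact: sqr_ge0. Qed.
Lemma lapN k : lap (- k) = lap k. Proof. by rewrite /lap rmorphN sqrrN. Qed.

Lemma Bsym_sqr c k : 0 < c -> Bsym c k ^+ 2 = lap k ^+ 2 + lap k + c.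
Proof.
move=> c0; rewrite /Bsym sqr_sqrtr; first by rewrite /lap -exprM.
rewrite addr_ge0 ?(ltW c0) // addr_ge0 ?sqr_ge0 //.
by rewrite (_ : 4 = 2 * 2)%N // exprM sqr_ge0.
Qed.

Lemma Bsym_ge_sqrt c k : 0 < c -> Num.sqrt c <= Bsym c k.
Proof.
move=> c0; apply: ler_wsqrtr; rewrite lerDr addr_ge0 ?sqr_ge0 //.
by rewrite (_ : 4 = 2 * 2)%N // exprM sqr_ge0.
Qed.

Lemma Bsym_gt0 c k : 0 < c -> 0 < Bsym c k.
Proof. by move=> c0; apply: lt_le_trans (Bsym_ge_sqrt k c0); rewrite sqrtr_gt0. Qed.

Lemma lap_le_Bsym c k : 0 < c -> lap k <= Bsym c k.
Proof.
move=> c0; have l0 := lap_ge0 k.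
rewrite -ler_sqr ?nnegrE ?(ltW (Bsym_gt0 k c0)) // Bsym_sqr //; lra.
Qed.

Lemma Asym_ge0 c k : 0 < c -> 0 <= Asym c k.
Proof. by move=> c0; rewrite subr_ge0 lap_le_Bsym. Qed.

(** Since B^2 = k^4 + k^2 + c <= (k^2 + 1 + c)^2, the difference A of two symbols
    of order two is bounded. *)
Lemma Asym_le c k : 0 < c -> Asym c k <= 1 + c.
Proof.
move=> c0; have l0 := lap_ge0 k; have b0 := Bsym_gt0 k c0.
rewrite lerBlDr -ler_sqr ?nnegrE ?(ltW b0) //; last lra.
by rewrite Bsym_sqr //; nra.
Qed.

Lemma Bsym_le c k : 0 < c -> Bsym c k <= (1 + c) * (1 + lap k).
Proof.
move=> c0; have := Asym_le k c0; rewrite /Asym lerBlDr => h.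
apply: (le_trans h); have := lap_ge0 k; nra.
Qed.

Lemma bracketE c k : bracket c k = (Bsym c k)%:C. Proof. by []. Qed.

Lemma dx2E k : dx2 k = (- lap k)%:C :> C.
Proof. by rewrite /dx2 /lap rmorphN rmorphXn /= rmorph_int. Qed.

Lemma opAE c k : opA c k = (Asym c k)%:C.
Proof. by rewrite /opA dx2E bracketE -rmorphD addrC. Qed.

Lemma exp_dx2E s k : exp_dx2 s k = expi (- (s * lap k)).
Proof.
by rewrite /exp_dx2 dx2E -mulrA -rmorphM mulrN cexp_expi.
Qed.

Lemma exp_bracketE c s k : exp_bracket c s k = expi (s * Bsym c k).
Proof. by rewrite /exp_bracket bracketE -mulrA -rmorphM cexp_expi. Qed.

Lemma dx2_invE k : dx2_inv k = (- (lap k)^-1)%:C :> C.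
Proof.
rewrite /dx2_inv; case: eqP => [->|_].
  by rewrite /lap expr0n /= invr0 oppr0.
by rewrite rmorphN fmorphV rmorphXn /= rmorph_int.
Qed.

Lemma psi1E t k : psi1_dx2 t k =
  cintegral `[0, 1] (fun s => expi (- (2 * t * lap k) * s)).
Proof.
rewrite /psi1_dx2 /psi1; apply: cintegral_eq => s _.
rewrite -cexp_expi dx2E; congr cexp.
by rewrite !rmorphM /= !rmorphN /= !rmorphM /= rmorph_nat; ring.
Qed.

Lemma psi2E t k : psi2_dx2 t k =
  cintegral `[0, 1] (fun s => s%:C * expi (- (2 * t * lap k) * s)).
Proof.
rewrite /psi2_dx2 /psi2; apply: cintegral_eq => s _; congr (_ * _).
rewrite -cexp_expi dx2E; congr cexp.
by rewrite !rmorphM /= !rmorphN /= !rmorphM /= rmorph_nat; ring.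
Qed.

Lemma cC_neq0 (x : R) : x != 0 -> x%:C != 0 :> C.
Proof. by move=> x0; rewrite eq_complex /= eqxx andbT. Qed.

Lemma I_neq0 : I != 0 :> C.
Proof. by rewrite eq_complex /= oner_eq0 andbF. Qed.

Lemma mu_itv t : 0 <= t -> lebesgue_measure ([set` `[0%R, t]] : set R) = t%:E.
Proof.
move=> t0; rewrite lebesgue_measure_itv /= lte_fin.
have [t1|t1] := ltP 0 t; first by rewrite -EFinB subr0.
by congr EFin; apply/le_anti; rewrite t0 t1.
Qed.

Lemma mu_itv_fin t : 0 <= t -> (lebesgue_measure ([set` `[0%R, t]] : set R) < +oo)%E.
Proof. by move=> t0; rewrite mu_itv // ltry. Qed.

Lemma measurable_0t t : measurable ([set` `[0%R, t]] : set R).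
Proof. exact: measurable_itv. Qed.

Lemma cintegral_id t : 0 <= t ->
  cintegral `[0, t] (fun s => s%:C) = (t ^+ 2 / 2)%:C.
Proof.
move=> t0; apply: ReImP; last by rewrite /cintegral /= /Rintegral integral0.
rewrite /cintegral /=.
have H (x : R) : is_derive x 1 (fun s : R => 2^-1 * (s * s)) x.
  have h1 := @is_deriveM R R id id x 1 _ _ (@is_derive_id _ _ _ _) (@is_derive_id _ _ _ _).
  have h2 := @is_deriveZ R R R _ (2^-1) x 1 _ h1.
  by apply: (is_derive_eq h2); rewrite /GRing.scale /=; field.
have cH : continuous (fun x : R => x) by move=> x; exact: cvg_id.
by rewrite (Rintegral_FTC2 t0 H cH); field.
Qed.

Lemma cintegral_expi_scale t w : 0 < t ->
  cintegral `[0, t] (fun s => expi (w * s)) =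
  t%:C * cintegral `[0, 1] (fun s => expi (w * t * s)).
Proof.
move=> t0; have [->|w0] := eqVneq w 0.
  have -> : (fun s => expi (0 * s)) = fun=> 1 :> C.
    by apply/funext => s; rewrite !mul0r expi0.
  have -> : (fun s => expi (0 * t * s)) = fun=> 1 :> C.
    by apply/funext => s; rewrite !mul0r expi0.
  have m1 := measurable_0t 1; have mt := measurable_0t t.
  by rewrite !cintegral_cst // !mu_itv ?(ltW t0) // !mul1r mulr1.
have tC := cC_neq0 (lt0r_neq0 t0); have wC := cC_neq0 w0; have IC := I_neq0.
rewrite !cintegral_expi ?(ltW t0) ?mulf_neq0 ?(lt0r_neq0 t0) //.
by rewrite !mulr0 mulr1 rmorphM /=; field; rewrite ?tC ?wC ?IC.
Qed.

Lemma cintegral_s_expi_scale t w : 0 < t ->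
  cintegral `[0, t] (fun s => s%:C * expi (w * s)) =
  t%:C ^+ 2 * cintegral `[0, 1] (fun s => s%:C * expi (w * t * s)).
Proof.
move=> t0; have [->|w0] := eqVneq w 0.
  have -> : (fun s => s%:C * expi (0 * s)) = (fun s : R => s%:C).
    by apply/funext => s; rewrite mul0r expi0 mulr1.
  have -> : (fun s => s%:C * expi (0 * t * s)) = (fun s : R => s%:C).
    by apply/funext => s; rewrite !mul0r expi0 mulr1.
  rewrite !cintegral_id ?(ltW t0) // -rmorphXn -rmorphM /=.
  by congr (_%:C); rewrite expr1n; field.
have tC := cC_neq0 (lt0r_neq0 t0); have wC := cC_neq0 w0; have IC := I_neq0.
rewrite !cintegral_s_expi ?(ltW t0) ?mulf_neq0 ?(lt0r_neq0 t0) //.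
rewrite !cintegral_expi ?(ltW t0) ?mulf_neq0 ?(lt0r_neq0 t0) //.
by rewrite !mulr0 !mulr1 rmorphM /=; field; rewrite ?tC ?wC ?IC.
Qed.

End Symbols.

(** * The integrator on coefficients: definitions and bounds *)

Section Scheme.
Context {R : realType}.
Local Notation C := R[i].
Local Notation mu := (@lebesgue_measure R).
Local Notation Omega := (@Omega R).
Local Notation I := (Complex (0 : R) (1 : R)).
Implicit Types (f g : R -> C) (a b : int -> C) (c r s t x K : R) (k : int).

Definition hsum a k := a k + crefl a k.

(** The coefficients of [nonlin] ([rep_nonlin]); [P_seq] gives those of [opP]. *)
Definition nonlin_seq c a k : C := (Bsym c k)^-1%:C *
  ((2 * c)%:C * hsum a k - (lap k)%:C * conv (hsum a) (hsum a) k).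

Definition P_seq c a k : C := (Asym c k)%:C * a k - 4^-1 * nonlin_seq c a k.

(** The coefficients of exp(-is dx^2) f. *)
Definition twist s a k : C := expi (s * lap k) * a k.

(** The products in the integrator.  [form1] and [form2] are the coefficients of
    the integrands of I_1, J_1 and of I_2, J_2, and [form1c] those of the conjugate
    of the first.  In [form3] the two conjugates are multiplied without their
    phases, and the product is given the phase exp(-2isk^2) instead: its integrals
    are then explicit, which gives I_3 and J_3. *)
Definition form1 s a b k : C :=
  expi (- (s * lap k)) * conv (twist s a) (twist s b) k.
Definition form2 s a b k : C :=
  expi (- (s * lap k)) * conv (twist s a) (crefl (twist s b)) k.
Definition form1c s a k : C :=
  expi (s * lap k) * conv (crefl (twist s a)) (crefl (twist s a)) k.
Definition form3 s a b k : C :=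
  expi (- (2 * s * lap k)) * conv (crefl a) (crefl b) k.

(** The integrands in s which make the integrator a Duhamel formula: the
    functions psi_1, psi_2 and J_3 in its definition come from the integrals over
    [0, t] of the terms with the phase exp(-2isk^2). *)
Definition Q1 c s a k : C :=
  a k - I * s%:C * ((Asym c k)%:C * a k - P_seq c a k) +
  expi (- (2 * s * lap k)) * (crefl a k -
     I * s%:C * ((Asym c k)%:C * crefl a k + crefl (P_seq c a) k)).

Definition Q2 c s a k : C :=
  form1 s a a k + form1c s a k + 2 * form2 s a a k + form3 s a a k
  - conv (crefl a) (crefl a) k
  - I * s%:C * (Asym c k)%:C *
      (form1 s a a k + 2 * form2 s a a k + form3 s a a k)
  + 2 * I * s%:C * (form1 s a (P_seq c a) k + form2 s (P_seq c a) a k)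
  - 2 * I * s%:C * (form3 s a (P_seq c a) k + form2 s a (P_seq c a) k).

Definition scheme_rhs c a s k : C :=
  (Bsym c k)^-1%:C * ((2 * c)%:C * Q1 c s a k - (lap k)%:C * Q2 c s a k).

Definition scheme c t a k : C := expi (t * Bsym c k) *
  (a k - I / 4 * cintegral `[0, t] (fun s => scheme_rhs c a s k)).

Lemma sob_hsum r a K : sob_le r a K -> sob_le r (hsum a) (K + K).
Proof. by move=> h; apply: sob_leD => //; exact: sob_le_crefl. Qed.

Lemma normc_twist s a k : normc (twist s a k) = normc (a k).
Proof. by rewrite /twist normcM normc_expi mul1r. Qed.

Lemma sob_twist r s a K : sob_le r a K -> sob_le r (twist s a) K.
Proof. by apply: sob_le_dom1 => k; rewrite normc_twist. Qed.

Lemma sob_expi r a K (w : int -> R) : sob_le r a K ->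
  sob_le r (fun k => expi (w k) * a k) K.
Proof. by apply: sob_le_dom1 => k; rewrite normcM normc_expi mul1r. Qed.

Definition cmul c : R := 2 * c / Num.sqrt c.

Lemma cmul_ge0 c : 0 < c -> 0 <= cmul c.
Proof. by move=> c0; rewrite /cmul !mulr_ge0 ?invr_ge0 ?sqrtr_ge0 // ltW. Qed.

Lemma normc_cmul c k : 0 < c -> normc ((Bsym c k)^-1%:C * (2 * c)%:C) <= cmul c.
Proof.
move=> c0; have c2 : 0 <= 2 * c by lra.
rewrite -rmorphM normc_real ger0_norm; last first.
  by rewrite mulr_ge0 ?invr_ge0 ?(ltW (Bsym_gt0 _ c0)).
rewrite mulrC /cmul ler_wpM2l // lef_pV2 ?Bsym_ge_sqrt // posrE.
  exact: Bsym_gt0.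
by rewrite sqrtr_gt0.
Qed.

Lemma normc_lapB c k : 0 < c -> normc ((Bsym c k)^-1%:C * (lap k)%:C) <= 1.
Proof.
move=> c0; rewrite -rmorphM normc_real ger0_norm; last first.
  by rewrite mulr_ge0 ?lap_ge0 // invr_ge0 (ltW (Bsym_gt0 _ c0)).
by rewrite mulrC ler_pdivrMr ?Bsym_gt0 // mul1r lap_le_Bsym.
Qed.

Lemma sob_cmul c r a K : 0 < c -> sob_le r a K ->
  sob_le r (fun k => (Bsym c k)^-1%:C * ((2 * c)%:C * a k)) (cmul c * K).
Proof.
move=> c0; apply: sob_le_dom; first exact: cmul_ge0.
by move=> k; rewrite mulrA normcM ler_wpM2r ?normc_ge0 // normc_cmul.
Qed.

Lemma sob_lapB c r a K : 0 < c -> sob_le r a K ->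
  sob_le r (fun k => (Bsym c k)^-1%:C * ((lap k)%:C * a k)) K.
Proof.
move=> c0; apply: sob_le_dom1.
by move=> k; rewrite mulrA normcM ler_piMl ?normc_ge0 // normc_lapB.
Qed.

Lemma sob_A c r a K : 0 < c -> sob_le r a K ->
  sob_le r (fun k => (Asym c k)%:C * a k) ((1 + c) * K).
Proof.
move=> c0; apply: sob_le_dom; first lra.
move=> k; rewrite normcM normc_real ler_wpM2r ?normc_ge0 //.
by rewrite ger0_norm ?Asym_ge0 ?Asym_le.
Qed.

Lemma sob_Bcomb c r a b Ka Kb : 0 < c -> sob_le r a Ka -> sob_le r b Kb ->
  sob_le r (fun k => (Bsym c k)^-1%:C * ((2 * c)%:C * a k - (lap k)%:C * b k))
   (cmul c * Ka + Kb).
Proof.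
move=> c0 ha hb.
rewrite (_ : (fun k => _) = (fun k => (Bsym c k)^-1%:C * ((2 * c)%:C * a k) -
   (Bsym c k)^-1%:C * ((lap k)%:C * b k))).
  by apply: sob_leB; [exact: sob_cmul|exact: sob_lapB].
by apply/funext => k; rewrite mulrBr.
Qed.

Lemma sob_nonlin r0 r c a K : 1 / 2 < r0 -> r0 <= r -> r <= r0 + 2 -> 0 < c ->
  sob_le r a K -> sob_le r (nonlin_seq c a)
    (cmul c * (K + K) + conv_const r0 * ((K + K) * (K + K))).
Proof.
move=> h1 h2 h3 c0 ha; have hh := sob_hsum ha.
by apply: sob_Bcomb => //; exact: sob_conv.
Qed.

Definition P_bound r c K : R := (1 + c) * K +
  (cmul c * (K + K) + conv_const r * ((K + K) * (K + K))).

Lemma normc_4V : normc (4^-1 : C) <= 1.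
Proof. by rewrite normcV normc_nat invf_le1 // ler1n. Qed.

(** As in [sob_le_conv], the constant is uniform for r in [r0, r0 + 2]. *)
Lemma sob_P r0 r c a K : 1 / 2 < r0 -> r0 <= r -> r <= r0 + 2 -> 0 < c ->
  sob_le r a K -> sob_le r (P_seq c a) (P_bound r0 c K).
Proof.
move=> h1 h2 h3 c0 ha; apply: sob_leB; first exact: sob_A.
apply: sob_le_dom1 (sob_nonlin h1 h2 h3 c0 ha) => k.
by rewrite normcM ler_piMl ?normc_ge0 ?normc_4V.
Qed.

Lemma rep_nonlin r c f a : 1 / 2 < r -> 0 < c -> fourier_rep r f a ->
  fourier_rep r (nonlin c f) (nonlin_seq c a).
Proof.
move=> r2 c0 fa; have hf := repD r2 fa (rep_conj r2 fa).
apply: (@rep_eqa _ _ _ (fun k => (bracket c k)^-1 * (2 * c%:C) * hsum a k +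
   (bracket c k)^-1 * dx2 k * conv (hsum a) (hsum a) k)).
  move=> k; rewrite /nonlin_seq bracketE dx2E -fmorphV rmorphN !rmorphM /= rmorph_nat.
  by ring.
apply: repD => //.
- apply: (rep_mult r2 (P := cmul c)) hf => k.
  by rewrite bracketE -fmorphV -(rmorph_nat (real_complex R)) -rmorphM normc_cmul.
- apply: (rep_mult r2 (P := 1)); last exact: repX2.
  by move=> k; rewrite bracketE dx2E -fmorphV rmorphN mulrN normcN normc_lapB.
Qed.

Lemma normc_Asym c k : 0 < c -> normc ((Asym c k)%:C : C) <= 1 + c.
Proof. by move=> c0; rewrite normc_real ger0_norm ?Asym_ge0 ?Asym_le. Qed.

Lemma rep_opA r c f a : 1 / 2 < r -> 0 < c -> fourier_rep r f a ->
  fourier_rep r (fourier_mult (opA c) f) (fun k => (Asym c k)%:C * a k).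
Proof.
move=> r2 c0 fa; apply: (@rep_eqa _ _ _ (fun k => opA c k * a k)).
  by move=> k; rewrite opAE.
by apply: (rep_mult r2 (P := 1 + c)) fa => k; rewrite opAE normc_Asym.
Qed.

Lemma rep_opP r c f a : 1 / 2 < r -> 0 < c -> fourier_rep r f a ->
  fourier_rep r (opP c f) (P_seq c a).
Proof.
move=> r2 c0 fa; apply: repB => //; first exact: rep_opA.
by apply: repZ => //; exact: rep_nonlin.
Qed.

Lemma rep_exp r (w : int -> R) p f a : 1 / 2 < r -> (forall k, p k = expi (w k)) ->
  fourier_rep r f a ->
  fourier_rep r (fourier_mult p f) (fun k => expi (w k) * a k).
Proof.
move=> r2 pw fa; apply: (@rep_eqa _ _ _ (fun k => p k * a k)).
  by move=> k; rewrite pw.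
by apply: (rep_mult r2 (P := 1)) fa => k; rewrite pw normc_expi.
Qed.

Lemma rep_twist r s f a : 1 / 2 < r -> fourier_rep r f a ->
  fourier_rep r (fourier_mult (exp_dx2 (- s)) f) (twist s a).
Proof.
by move=> r2; apply: rep_exp => // k; rewrite exp_dx2E mulNr opprK.
Qed.

Lemma crefl_twist s a k : crefl (twist s a) k = expi (- (s * lap k)) * crefl a k.
Proof. by rewrite /crefl /twist rmorphM /= expi_conj lapN. Qed.

Lemma rep_crefl_twist r s f a : 1 / 2 < r -> fourier_rep r f a ->
  fourier_rep r (fourier_mult (exp_dx2 s) (conjf f)) (crefl (twist s a)).
Proof.
move=> r2 fa; apply: (@rep_eqa _ _ _ (fun k => expi (- (s * lap k)) * crefl a k)).
  by move=> k; exact: crefl_twist.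
by apply: rep_exp => //; [move=> k; rewrite exp_dx2E|exact: rep_conj].
Qed.

Lemma fourier_multE_rep r p f a x : 1 / 2 < r -> fourier_rep r f a ->
  fourier_mult p f x = fser (fun k => p k * a k) x.
Proof. by move=> r2 fa; rewrite fourier_multE (rep_coef r2 fa). Qed.

Lemma cmeas_twist (D : set R) a k : cmeas D (fun s => twist s a k).
Proof.
apply: cmeasM; last exact: cmeas_cst.
by under eq_fun do rewrite mulrC; exact: cmeas_expi.
Qed.

Lemma cmeas_ctwist (D : set R) a k : cmeas D (fun s => crefl (twist s a) k).
Proof. by apply: cmeas_conj; exact: cmeas_twist. Qed.

Lemma cmeas_expi_lap (D : set R) (q : R) k : cmeas D (fun s => expi (- (q * s * lap k)) : C).
Proof.
apply: (@cmeas_eq _ _ (fun s => expi (- (q * lap k) * s))); last exact: cmeas_expi.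
by move=> s _; congr expi; ring.
Qed.

Lemma cmeas_id (D : set R) : cmeas D (fun s => s%:C).
Proof. by apply: cmeas_real; exact: measurable_id. Qed.

Lemma cmeas_form1 r (D : set R) a b Ka Kb k : 1 / 2 < r -> sob_le r a Ka ->
  sob_le r b Kb -> cmeas D (fun s => form1 s a b k).
Proof.
move=> r2 ha hb; apply: cmeasM.
  have := @cmeas_expi_lap D 1 k; by under eq_fun do rewrite mul1r.
apply: (cmeas_conv k r2); try by move=> j; exact: cmeas_twist.
- by move=> s _; exists Ka; exact: sob_twist.
- by move=> s _; exists Kb; exact: sob_twist.
Qed.

Lemma cmeas_form2 r (D : set R) a b Ka Kb k : 1 / 2 < r -> sob_le r a Ka ->
  sob_le r b Kb -> cmeas D (fun s => form2 s a b k).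
Proof.
move=> r2 ha hb; apply: cmeasM.
  have := @cmeas_expi_lap D 1 k; by under eq_fun do rewrite mul1r.
apply: (cmeas_conv k r2); [by move=> j; exact: cmeas_twist|
  by move=> j; exact: cmeas_ctwist| |].
- by move=> s _; exists Ka; exact: sob_twist.
- by move=> s _; exists Kb; apply: sob_le_crefl; exact: sob_twist.
Qed.

Lemma sob_form1 r0 r s a b Ka Kb : 1 / 2 < r0 -> r0 <= r -> r <= r0 + 2 ->
  sob_le r a Ka -> sob_le r b Kb ->
  sob_le r (form1 s a b) (conv_const r0 * (Ka * Kb)).
Proof.
move=> h1 h2 h3 ha hb; apply: sob_expi.
by apply: (sob_conv h1 h2 h3); exact: sob_twist.
Qed.

Lemma sob_form2 r0 r s a b Ka Kb : 1 / 2 < r0 -> r0 <= r -> r <= r0 + 2 ->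
  sob_le r a Ka -> sob_le r b Kb ->
  sob_le r (form2 s a b) (conv_const r0 * (Ka * Kb)).
Proof.
move=> h1 h2 h3 ha hb; apply: sob_expi.
by apply: (sob_conv h1 h2 h3); [|apply: sob_le_crefl]; exact: sob_twist.
Qed.

Lemma sob_form1c r0 r s a Ka : 1 / 2 < r0 -> r0 <= r -> r <= r0 + 2 ->
  sob_le r a Ka -> sob_le r (form1c s a) (conv_const r0 * (Ka * Ka)).
Proof.
move=> h1 h2 h3 ha; apply: sob_expi.
by apply: (sob_conv h1 h2 h3); apply: sob_le_crefl; exact: sob_twist.
Qed.

Lemma form1c_crefl r s a K k : 1 / 2 < r -> sob_le r a K ->
  form1c s a k = crefl (form1 s a a) k.
Proof.
move=> r2 ha; have ht := sob_twist s ha.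
rewrite /form1c -(conv_crefl r2 ht ht) /crefl /form1 rmorphM /= expi_conj.
by rewrite opprK lapN.
Qed.

Lemma sob_le_s r (a : int -> C) K s t : 0 <= s <= t -> sob_le r a K ->
  sob_le r (fun k => s%:C * a k) (t * K).
Proof.
move=> /andP[s0 st] ha; apply: sob_le_dom ha; first exact: le_trans st.
by move=> k; rewrite normcM normc_real ger0_norm // ler_wpM2r ?normc_ge0.
Qed.

Lemma has_int_sob r t (a : R -> int -> C) K k : 1 / 2 < r -> 0 <= t ->
  cmeas `[0, t] (fun s => a s k) ->
  (forall s, 0 <= s <= t -> sob_le r (a s) K) ->
  has_int `[0, t] (fun s => a s k) (cintegral `[0, t] (fun s => a s k)).
Proof.
move=> r2 t0 ma ha; split=> //.
apply: (@cintegrable_ebounded _ _ _ K) => //; first exact: mu_itv_fin.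
apply: ebounded_pt => s; rewrite /= in_itv /= => st.
by apply: (@sob_le_pt _ r _ K k) (ha s st); lra.
Qed.

End Scheme.

(** * Coefficients of the integral terms *)

Section SchemeRepresentation.
Context {R : realType}.
Local Notation C := R[i].
Local Notation mu := (@lebesgue_measure R).
Local Notation Omega := (@Omega R).
Local Notation I := (Complex (0 : R) (1 : R)).
Implicit Types (f g : R -> C) (a b : int -> C) (c r s t x K : R) (k : int).

Lemma conv_const_ge0 r : 1 / 2 < r -> 0 <= conv_const r.
Proof. by move=> /conv_const_ge1; lra. Qed.

Lemma in_0t t s : `[0, t]%classic s -> 0 <= s <= t.
Proof. by rewrite /= in_itv. Qed.

Lemma rep_I1 r t f a K : 1 / 2 < r -> 0 <= t -> fourier_rep r f a -> sob_le r a K ->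
  fourier_rep r (I1 t f) (fun k => cintegral `[0, t] (fun s => form1 s a a k)).
Proof.
move=> r2 t0 fa ha; have K0 := sob_le_ge0 ha; have C0 := conv_const_ge0 r2.
apply: (@rep_cintegral _ _ _ _ _ (conv_const r * (K * K))) => //.
- exact: mu_itv_fin.
- by do ?[exact: C0 | apply: mulr_ge0 => //].
- by move=> k; exact: (cmeas_form1 _ k r2 ha ha).
- by move=> s _; apply: sob_form1 => //; lra.
- move=> s x _; rewrite (fourier_multE_rep _ _ r2 (repX2 r2 (rep_twist s r2 fa))).
  by apply: (congr1 (fun e => fser e x)); apply/funext => k; rewrite exp_dx2E.
Qed.

Lemma rep_I2 r t f a K : 1 / 2 < r -> 0 <= t -> fourier_rep r f a -> sob_le r a K ->
  fourier_rep r (I2 t f) (fun k => cintegral `[0, t] (fun s => form2 s a a k)).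
Proof.
move=> r2 t0 fa ha; have K0 := sob_le_ge0 ha; have C0 := conv_const_ge0 r2.
apply: (@rep_cintegral _ _ _ _ _ (conv_const r * (K * K))) => //.
- exact: mu_itv_fin.
- by do ?[exact: C0 | apply: mulr_ge0 => //].
- by move=> k; exact: (cmeas_form2 _ k r2 ha ha).
- by move=> s _; apply: sob_form2 => //; lra.
- move=> s x _; have rt := rep_twist s r2 fa.
  rewrite (_ : (fun y => _) = (fun y => fourier_mult (exp_dx2 (- s)) f y *
     (fourier_mult (exp_dx2 (- s)) f y)^*)); last first.
    by apply/funext => y; rewrite normCK.
  rewrite (fourier_multE_rep _ _ r2 (repM r2 rt (rep_conj r2 rt))).
  by apply: (congr1 (fun e => fser e x)); apply/funext => k; rewrite exp_dx2E.
Qed.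

Lemma rep_J1 r t f g a b Ka Kb : 1 / 2 < r -> 0 <= t ->
  fourier_rep r f a -> sob_le r a Ka -> fourier_rep r g b -> sob_le r b Kb ->
  fourier_rep r (J1 t f g)
    (fun k => cintegral `[0, t] (fun s => s%:C * form1 s a b k)).
Proof.
move=> r2 t0 fa ha gb hb; have C0 := conv_const_ge0 r2.
have Ka0 := sob_le_ge0 ha; have Kb0 := sob_le_ge0 hb.
have hf s : sob_le r (form1 s a b) (conv_const r * (Ka * Kb)).
  by apply: sob_form1 => //; lra.
apply: (@rep_cintegral _ _ _ _ (fun s k => s%:C * form1 s a b k)
  (t * (conv_const r * (Ka * Kb)))) => //.
- exact: mu_itv_fin.
- by do ?[exact: C0 | apply: mulr_ge0 => //].
- by move=> k; apply: cmeasM; [exact: cmeas_id|exact: (cmeas_form1 _ k r2 ha hb)].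
- by move=> s /in_0t st; apply: sob_le_s.
- move=> s x _; rewrite (fserZ _ _ (sob_le_l1 r2 (hf s))); congr (_ * _).
  rewrite (fourier_multE_rep _ _ r2 (repM r2 (rep_twist s r2 fa) (rep_twist s r2 gb))).
  by apply: (congr1 (fun e => fser e x)); apply/funext => k; rewrite exp_dx2E.
Qed.

Lemma rep_J2 r t f g a b Ka Kb : 1 / 2 < r -> 0 <= t ->
  fourier_rep r f a -> sob_le r a Ka -> fourier_rep r g b -> sob_le r b Kb ->
  fourier_rep r (J2 t f g)
    (fun k => cintegral `[0, t] (fun s => s%:C * form2 s a b k)).
Proof.
move=> r2 t0 fa ha gb hb; have C0 := conv_const_ge0 r2.
have Ka0 := sob_le_ge0 ha; have Kb0 := sob_le_ge0 hb.
have hf s : sob_le r (form2 s a b) (conv_const r * (Ka * Kb)).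
  by apply: sob_form2 => //; lra.
apply: (@rep_cintegral _ _ _ _ (fun s k => s%:C * form2 s a b k)
  (t * (conv_const r * (Ka * Kb)))) => //.
- exact: mu_itv_fin.
- by do ?[exact: C0 | apply: mulr_ge0 => //].
- by move=> k; apply: cmeasM; [exact: cmeas_id|exact: (cmeas_form2 _ k r2 ha hb)].
- by move=> s /in_0t st; apply: sob_le_s.
- move=> s x _; rewrite (fserZ _ _ (sob_le_l1 r2 (hf s))); congr (_ * _).
  rewrite (fourier_multE_rep _ _ r2
     (repM r2 (rep_twist s r2 fa) (rep_crefl_twist s r2 gb))).
  by apply: (congr1 (fun e => fser e x)); apply/funext => k; rewrite exp_dx2E.
Qed.

Lemma normc_psi1 t k : normc (psi1_dx2 t k) <= 1 :> R.
Proof.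
rewrite psi1E; have h := @cintegral_le R `[0, 1] (fun s => expi (- (2 * t * lap k) * s)) 1.
apply: le_trans (h _ _ _ _ _) _ => //.
- exact: mu_itv_fin.
- exact: cmeas_expi.
- by apply: ebounded_pt => s _; rewrite normc_expi.
- by rewrite mu_itv // mul1r.
Qed.

Lemma normc_psi2 t k : normc (psi2_dx2 t k) <= 1 :> R.
Proof.
rewrite psi2E.
have h := @cintegral_le R `[0, 1] (fun s => s%:C * expi (- (2 * t * lap k) * s)) 1.
apply: le_trans (h _ _ _ _ _) _ => //.
- exact: mu_itv_fin.
- by apply: cmeasM; [exact: cmeas_id|exact: cmeas_expi].
- apply: ebounded_pt => s /in_0t /andP[s0 s1].
  by rewrite normcM normc_expi mulr1 normc_real ger0_norm.
- by rewrite mu_itv // mul1r.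
Qed.

Lemma normc_dx2_inv k : normc (dx2_inv k : C) <= 1.
Proof.
rewrite dx2_invE normc_real normrN ger0_norm ?invr_ge0 ?lap_ge0 //.
have [->|k0] := eqVneq k 0; first by rewrite /lap expr0n invr0.
rewrite invf_le1.
  rewrite /lap -rmorphXn /= (_ : 1 = 1%:~R) // ler_int.
  by move: k0; case: k => [[|n]|n] // _; rewrite expr2; lia.
by rewrite /lap lt_neqAle sqr_ge0 andbT eq_sym expf_neq0 // intr_eq0.
Qed.

Lemma psi1_int t k : 0 < t ->
  cintegral `[0, t] (fun s => expi (- (2 * s * lap k))) = t%:C * psi1_dx2 t k.
Proof.
move=> t0; rewrite psi1E.
have -> : (fun s => expi (- (2 * s * lap k))) = (fun s => expi (- (2 * lap k) * s)) :> (R -> C).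
  by apply/funext => s; congr expi; ring.
rewrite cintegral_expi_scale //; congr (_ * _); apply: cintegral_eq => s _.
by congr expi; ring.
Qed.

Lemma psi2_int t k : 0 < t ->
  cintegral `[0, t] (fun s => s%:C * expi (- (2 * s * lap k))) = t%:C ^+ 2 * psi2_dx2 t k.
Proof.
move=> t0; rewrite psi2E.
have -> : (fun s => s%:C * expi (- (2 * s * lap k))) =
    (fun s => s%:C * expi (- (2 * lap k) * s)) :> (R -> C).
  by apply/funext => s; congr (_ * expi _); ring.
rewrite cintegral_s_expi_scale //; congr (_ * _); apply: cintegral_eq => s _.
by congr (_ * expi _); ring.
Qed.

Lemma has_int_bounded t (h : R -> C) K : 0 <= t -> cmeas `[0, t] h ->
  (forall s, 0 <= s <= t -> normc (h s) <= K) ->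
  has_int `[0, t] h (cintegral `[0, t] h).
Proof.
move=> t0 mh hK; split=> //; apply: (@cintegrable_ebounded _ _ _ K) => //.
  exact: mu_itv_fin.
by apply: ebounded_pt => s /in_0t; exact: hK.
Qed.

Lemma has_int_psi1 t k (z : C) : 0 < t ->
  has_int `[0, t] (fun s => expi (- (2 * s * lap k)) * z) (t%:C * psi1_dx2 t k * z).
Proof.
move=> t0; rewrite -psi1_int // mulrC.
apply: (@has_int_eq _ _ (fun s => z * expi (- (2 * s * lap k)))).
  apply: has_intZ; first exact: measurable_0t.
  apply: (@has_int_bounded _ _ 1); first exact: ltW.
    exact: cmeas_expi_lap.
  by move=> s _; rewrite normc_expi.
by move=> s; rewrite mulrC.
Qed.

Lemma has_int_psi2 t k (z : C) : 0 < t ->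
  has_int `[0, t] (fun s => s%:C * expi (- (2 * s * lap k)) * z)
    (t%:C ^+ 2 * psi2_dx2 t k * z).
Proof.
move=> t0; rewrite -psi2_int // mulrC.
apply: (@has_int_eq _ _ (fun s => z * (s%:C * expi (- (2 * s * lap k))))).
  apply: has_intZ; first exact: measurable_0t.
  apply: (@has_int_bounded _ _ t); first exact: ltW.
    by apply: cmeasM; [exact: cmeas_id|exact: cmeas_expi_lap].
  by move=> s /andP[s0 st]; rewrite normcM normc_expi mulr1 normc_real ger0_norm.
by move=> s; rewrite mulrC.
Qed.

Lemma has_int_cst t (z : C) : 0 <= t -> has_int `[0, t] (fun=> z) (t%:C * z).
Proof.
move=> t0; have -> : t%:C * z = cintegral `[0, t] (fun=> z).
  by rewrite (cintegral_cst z (measurable_0t t)) mu_itv //= mulrC.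
apply: (@has_int_bounded _ _ (normc z)) => //; exact: cmeas_cst.
Qed.

Lemma has_int_s t (z : C) : 0 <= t ->
  has_int `[0, t] (fun s => s%:C * z) ((t ^+ 2 / 2)%:C * z).
Proof.
move=> t0; rewrite -cintegral_id // mulrC.
apply: (@has_int_eq _ _ (fun s => z * s%:C)); last by move=> s; rewrite mulrC.
apply: has_intZ; first exact: measurable_0t.
apply: (@has_int_bounded _ _ t) => //; first exact: cmeas_id.
by move=> s /andP[s0 st]; rewrite normc_real ger0_norm.
Qed.

(** The inverse Laplacian annihilates the mode zero, which the last term
    restores. *)
Definition J3_seq t a b k : C :=
  - (I * t%:C / 2) * (exp_dx2 (2 * t) k * dx2_inv k * crefl (conv a b) k)
  + I * t%:C / 2 * (psi1_dx2 t k * dx2_inv k * crefl (conv a b) k)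
  + (if k == 0 then t%:C ^+ 2 / 2 * crefl (conv a b) 0 else 0).

Lemma rep_J3 r t f g a b : 1 / 2 < r -> fourier_rep r f a -> fourier_rep r g b ->
  fourier_rep r (J3 t f g) (J3_seq t a b).
Proof.
move=> r2 fa gb; have h := rep_conj r2 (repM r2 fa gb).
apply: repD => //.
  apply: repD => //; apply: repZ => //.
  - apply: (rep_mult r2 (P := 1)) h => k.
    by rewrite exp_dx2E normcM normc_expi mul1r normc_dx2_inv.
  - apply: (rep_mult r2 (P := 1)) h => k.
    by rewrite normcM mulr_ile1 ?normc_ge0 ?normc_psi1 ?normc_dx2_inv.
have -> : inner (conjf f) g = crefl (conv a b) 0.
  rewrite -(rep_coef r2 h) fourier_coefE /inner; congr (_ * _).
  apply: cintegral_eq => x _.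
  by rewrite mul0r oppr0 expi0 mulr1 rmorphM.
exact: rep_cst.
Qed.

(** At the mode zero there is no oscillation and the integral of s is t^2 / 2;
    elsewhere the integral of s exp(-2isk^2) is given by [cintegral_s_expi]. *)
Lemma has_int_form3 r t a b Ka Kb k : 1 / 2 < r -> 0 < t ->
  sob_le r a Ka -> sob_le r b Kb ->
  has_int `[0, t] (fun s => s%:C * form3 s a b k) (J3_seq t a b k).
Proof.
move=> r2 t0 ha hb; rewrite /J3_seq (conv_crefl r2 ha hb).
set w := conv (crefl a) (crefl b).
apply: (@has_int_eq _ _ (fun s => s%:C * expi (- (2 * s * lap k)) * w k)); last first.
  by move=> s; rewrite /form3 mulrA.
have [->|k0] := eqVneq k 0.
  have E : dx2_inv 0 = 0 :> C by rewrite /dx2_inv eqxx.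
  rewrite E !mulr0 !mul0r !mulr0 !add0r.
  apply: (@has_int_eq _ _ (fun s => s%:C * w 0)); last first.
    by move=> s; rewrite /lap expr0n mulr0 oppr0 expi0 mulr1.
  have -> : t%:C ^+ 2 / 2 = (t ^+ 2 / 2)%:C :> C.
    by rewrite rmorphM /= rmorphXn fmorphV rmorph_nat.
  exact/has_int_s/ltW.
have l0 : lap k != 0 :> R by rewrite /lap expf_neq0 // intr_eq0.
have [cI _] := has_int_psi2 k (w k) t0; split=> //.
transitivity (w k * cintegral `[0, t] (fun s => s%:C * expi (- (2 * lap k) * s))).
  rewrite -cintegralZ; [|exact: measurable_0t|].
    by apply: cintegral_eq => s _; rewrite mulrC; congr (_ * (_ * expi _)); ring.
  have [h _] := has_int_psi2 k 1 t0.
  have -> : (fun s => s%:C * expi (- (2 * lap k) * s)) =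
     (fun s => s%:C * expi (- (2 * s * lap k)) * 1) :> (R -> C).
    by apply/funext => s; rewrite mulr1; congr (_ * expi _); ring.
  exact: h.
have w0 : - (2 * lap k) != 0 :> R by rewrite oppr_eq0 mulf_neq0.
rewrite cintegral_s_expi ?(ltW t0) //.
have -> : cintegral `[0, t] (fun s => expi (- (2 * lap k) * s)) = t%:C * psi1_dx2 t k.
  by rewrite -psi1_int //; apply: cintegral_eq => s _; congr expi; ring.
rewrite exp_dx2E dx2_invE (_ : - (2 * lap k) * t = - (2 * t * lap k)); last ring.
have lC := cC_neq0 l0; have IC := @I_neq0 R.
have II : I * I = -1 :> C by apply: ReImP => /=; ring.
have E1 : (- (2 * lap k))%:C = - (2 * (lap k)%:C) :> C.
  by rewrite rmorphN rmorphM /= rmorph_nat.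
have E2 : (- (lap k)^-1)%:C = - (lap k)%:C^-1 :> C by rewrite rmorphN fmorphV.
have EI : (I : C)^-1 = - I by apply: (mulfI IC); rewrite mulfV // mulrN II opprK.
rewrite E1 E2 addr0 invfM EI invrN mulrNN invfM.
by move: (expi _) (psi1_dx2 _ _) (w k) => e p v; field.
Qed.

End SchemeRepresentation.

(** * Coefficients of the integrator *)

Section SchemeOnCoefficients.
Context {R : realType}.
Local Notation C := R[i].
Local Notation mu := (@lebesgue_measure R).
Local Notation Omega := (@Omega R).
Local Notation I := (Complex (0 : R) (1 : R)).
Implicit Types (f g : R -> C) (a b : int -> C) (c r s t x K : R) (k : int).

Definition L_seq c t a k : C :=
  - (I * c%:C * t%:C / 2) * ((bracket c k)^-1 * exp_bracket c t k *
    (a k - I * t%:C / 2 * ((Asym c k)%:C * a k - P_seq c a k)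
     + psi1_dx2 t k * crefl a k
     - I * t%:C * (psi2_dx2 t k *
         ((Asym c k)%:C * crefl a k + crefl (P_seq c a) k)))).

Lemma normc_Binv c k : 0 < c -> normc ((bracket c k)^-1 : C) <= (Num.sqrt c)^-1.
Proof.
move=> c0; rewrite bracketE -fmorphV normc_real ger0_norm.
  by rewrite lef_pV2 ?Bsym_ge_sqrt // posrE ?Bsym_gt0 // sqrtr_gt0.
by rewrite invr_ge0 (ltW (Bsym_gt0 _ c0)).
Qed.

Lemma rep_L r c t f a : 1 / 2 < r -> 0 < c -> fourier_rep r f a ->
  fourier_rep r (opL c t f) (L_seq c t a).
Proof.
move=> r2 c0 fa; have cfa := rep_conj r2 fa.
have Af := rep_opA r2 c0 fa; have Pf := rep_opP r2 c0 fa.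
have Acf := rep_opA r2 c0 cfa; have cPf := rep_conj r2 Pf.
apply: repZ => //; apply: (rep_mult r2 (P := (Num.sqrt c)^-1)) => [k|].
  by rewrite normcM exp_bracketE normc_expi mulr1 normc_Binv.
apply: repB => //.
  apply: repD => //; last exact: (rep_mult r2 (@normc_psi1 R t)) cfa.
  by apply: repB => //; apply: repZ => //; exact: repB.
apply: repZ => //; apply: (rep_mult r2 (@normc_psi2 R t)); exact: repD.
Qed.

Definition inner_seq c t a k : C :=
  let Pa := P_seq c a in
  let i1 k := cintegral `[0, t] (fun s => form1 s a a k) in
  let i2 k := cintegral `[0, t] (fun s => form2 s a a k) in
  let j1 k := cintegral `[0, t] (fun s => s%:C * form1 s a a k) in
  let j2 k := cintegral `[0, t] (fun s => s%:C * form2 s a a k) in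
  let p1 k := cintegral `[0, t] (fun s => s%:C * form1 s a Pa k) in
  let p2 k := cintegral `[0, t] (fun s => s%:C * form2 s Pa a k) in
  let p4 k := cintegral `[0, t] (fun s => s%:C * form2 s a Pa k) in
  let w := conv (crefl a) (crefl a) in
  - I * (i1 k + crefl i1 k + 2 * i2 k + t%:C * (psi1_dx2 t k * w k) - t%:C * w k)
  - (Asym c k)%:C * (j1 k + 2 * j2 k + J3_seq t a a k)
  + 2 * (p1 k + p2 k) - 2 * (J3_seq t a Pa k + p4 k).

Lemma rep_integrator_coef r c t f a : 1 / 2 < r -> 0 < c -> 0 <= t ->
  fourier_rep r f a ->
  fourier_rep r (integrator c t f) (fun k => exp_bracket c t k * a k + L_seq c t a k +
    dx2 k / 4 * (bracket c k)^-1 * exp_bracket c t k * inner_seq c t a k).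
Proof.
move=> r2 c0 t0 fa; have cfa := rep_conj r2 fa.
have Pf := rep_opP r2 c0 fa; have [_ _ [K ha]] := fa; have [_ _ [KP hP]] := Pf.
rewrite /integrator; apply: repD => //.
  apply: repD => //; last exact: rep_L.
  apply: (rep_mult r2 (P := 1)) fa => k.
  by rewrite exp_bracketE normc_expi.
apply: (rep_mult r2 (P := 1)) => [k|].
  have -> : dx2 k / 4 * (bracket c k)^-1 = - (4^-1 * ((Bsym c k)^-1%:C * (lap k)%:C)) :> C.
    by rewrite bracketE dx2E rmorphN fmorphV; ring.
  rewrite normcM exp_bracketE normc_expi mulr1 normcN normcM.
  by rewrite mulr_ile1 ?normc_ge0 ?normc_4V ?normc_lapB.
have h1 := rep_I1 r2 t0 fa ha; have h2 := rep_I2 r2 t0 fa ha.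
have h3 : fourier_rep r (I3 t f)
    (fun k => t%:C * (psi1_dx2 t k * conv (crefl a) (crefl a) k)).
  by apply: repZ => //; apply: (rep_mult r2 (@normc_psi1 R t)); exact: repX2.
have h4 : fourier_rep r (fun y => t%:C * conjf f y ^+ 2)
    (fun k => t%:C * conv (crefl a) (crefl a) k).
  by apply: repZ => //; exact: repX2.
have j1 := rep_J1 r2 t0 fa ha fa ha; have j2 := rep_J2 r2 t0 fa ha fa ha.
have j3 := rep_J3 t r2 fa fa.
have p1 := rep_J1 r2 t0 fa ha Pf hP; have p2 := rep_J2 r2 t0 Pf hP fa ha.
have p3 := rep_J3 t r2 fa Pf; have p4 := rep_J2 r2 t0 fa ha Pf hP.
exact: (repB r2 (repD r2 (repB r2
  (repZ (- I) r2 (repB r2 (repD r2 (repD r2 (repD r2 h1 (rep_conj r2 h1))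
     (repZ 2 r2 h2)) h3) h4))
  (rep_opA r2 c0 (repD r2 (repD r2 j1 (repZ 2 r2 j2)) j3)))
  (repZ 2 r2 (repD r2 p1 p2))) (repZ 2 r2 (repD r2 p3 p4))).
Qed.

Lemma has_int_Q1 c t a k : 0 < t ->
  has_int `[0, t] (fun s => Q1 c s a k)
   (t%:C * a k - I * ((t ^+ 2 / 2)%:C * ((Asym c k)%:C * a k - P_seq c a k)) +
    (t%:C * psi1_dx2 t k * crefl a k -
     I * (t%:C ^+ 2 * psi2_dx2 t k *
        ((Asym c k)%:C * crefl a k + crefl (P_seq c a) k)))).
Proof.
move=> t0; have t0' := ltW t0; have mt := measurable_0t t.
set u := (X in I * ((_)%:C * X)); set v := (X in _ * psi2_dx2 t k * X).
have h1 := has_int_cst (a k) t0'; have h2 := has_int_s u t0'.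
have h3 := has_int_psi1 k (crefl a k) t0; have h4 := has_int_psi2 k v t0.
apply: has_int_eq (has_intD mt (has_intB mt h1 (has_intZ I mt h2))
  (has_intB mt h3 (has_intZ I mt h4))) _.
by move=> s; rewrite /Q1 -/u -/v; ring.
Qed.

(** The quadratic part of the integrator is -i times the integral of [Q2]; the
    value z is assembled from the integrals of its terms. *)
Lemma has_int_Q2 r c t a K k : 1 / 2 < r -> 0 < c -> 0 < t -> sob_le r a K ->
  exists2 z, has_int `[0, t] (fun s => Q2 c s a k) z & inner_seq c t a k = - I * z.
Proof.
move=> r2 c0 t0 ha; have t0' := ltW t0; have mt := measurable_0t t.
have rr : r <= r + 2 by rewrite lerDl.
have hP := sob_P r2 (lexx r) rr c0 ha.
have sob_int (F : R -> int -> C) K' : (forall s, cmeas `[0, t] (fun s => F s k)) ->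
    (forall s, 0 <= s <= t -> sob_le r (F s) K') ->
    has_int `[0, t] (fun s => F s k) (cintegral `[0, t] (fun s => F s k)).
  by move=> mF hF; apply: (has_int_sob r2 t0' (mF 0) hF).
have sI (F : R -> int -> C) K' : cmeas `[0, t] (fun s => F s k) ->
    (forall s, sob_le r (F s) K') ->
    has_int `[0, t] (fun s => s%:C * F s k) (cintegral `[0, t] (fun s => s%:C * F s k)).
  move=> mF hF; apply: (sob_int (fun s k => s%:C * F s k) (t * K')).
    by move=> _; apply: cmeasM => //; exact: cmeas_id.
  by move=> s st; apply: sob_le_s.
have h1 := sob_int (fun s => form1 s a a) _ (fun _ => cmeas_form1 _ k r2 ha ha)
  (fun s _ => sob_form1 s r2 (lexx r) rr ha ha).
have h2 := sob_int (fun s => form2 s a a) _ (fun _ => cmeas_form2 _ k r2 ha ha)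
  (fun s _ => sob_form2 s r2 (lexx r) rr ha ha).
have h1c : has_int `[0, t] (fun s => form1c s a k)
    (crefl (fun k => cintegral `[0, t] (fun s => form1 s a a k)) k).
  have [ci _] := sob_int (fun s => form1c s a) _
    (fun _ => cmeas_eq (fun s _ => esym (form1c_crefl s k r2 ha))
       (cmeas_conj (cmeas_form1 _ (- k) r2 ha ha)))
    (fun s _ => sob_form1c s r2 (lexx r) rr ha).
  split=> //; rewrite /crefl -cintegral_conj //.
    by apply: cintegral_eq => s _; rewrite (form1c_crefl s k r2 ha).
  have [] := @has_int_sob R r t (fun s => form1 s a a) _ (- k) r2 t0'
    (cmeas_form1 _ (- k) r2 ha ha) (fun s _ => sob_form1 s r2 (lexx r) rr ha ha).
  by [].
set w := conv (crefl a) (crefl a).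
have h3 : has_int `[0, t] (fun s => form3 s a a k) (t%:C * psi1_dx2 t k * w k).
  exact: has_int_psi1.
have h4 := has_int_cst (w k) t0'.
have j1 := sI (fun s => form1 s a a) _ (cmeas_form1 _ k r2 ha ha)
  (fun s => sob_form1 s r2 (lexx r) rr ha ha).
have j2 := sI (fun s => form2 s a a) _ (cmeas_form2 _ k r2 ha ha)
  (fun s => sob_form2 s r2 (lexx r) rr ha ha).
have j3 := has_int_form3 k r2 t0 ha ha.
have p1 := sI (fun s => form1 s a (P_seq c a)) _ (cmeas_form1 _ k r2 ha hP)
  (fun s => sob_form1 s r2 (lexx r) rr ha hP).
have p2 := sI (fun s => form2 s (P_seq c a) a) _ (cmeas_form2 _ k r2 hP ha)
  (fun s => sob_form2 s r2 (lexx r) rr hP ha).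
have p3 := has_int_form3 k r2 t0 ha hP.
have p4 := sI (fun s => form2 s a (P_seq c a)) _ (cmeas_form2 _ k r2 ha hP)
  (fun s => sob_form2 s r2 (lexx r) rr ha hP).
have X0 := has_intB mt (has_intD mt (has_intD mt (has_intD mt h1 h1c)
  (has_intZ 2 mt h2)) h3) h4.
have X1 := has_intZ (I * (Asym c k)%:C) mt
  (has_intD mt (has_intD mt j1 (has_intZ 2 mt j2)) j3).
have X2 := has_intZ (2 * I) mt (has_intD mt p1 p2).
have X3 := has_intZ (2 * I) mt (has_intD mt p3 p4).
eexists; first apply: (has_int_eq (has_intB mt (has_intD mt (has_intB mt X0 X1) X2) X3)).
  by move=> s; rewrite /Q2 -/w; ring.
rewrite /inner_seq /= -/w.
have II : I * I = -1 :> C by apply: ReImP => /=; ring.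
set z1 := cintegral _ (fun s => form1 s a a k).
set z1c := crefl (fun k0 => _) k.
set z2 := cintegral _ (fun s => form2 s a a k).
set y1 := cintegral _ (fun s => s%:C * form1 s a a k).
set y2 := cintegral _ (fun s => s%:C * form2 s a a k).
set q1 := cintegral _ (fun s => s%:C * form1 s a (P_seq c a) k).
set q2 := cintegral _ (fun s => s%:C * form2 s (P_seq c a) a k).
set q4 := cintegral _ (fun s => s%:C * form2 s a (P_seq c a) k).
move: z1 z1c z2 y1 y2 q1 q2 q4 (J3_seq t a a k) (J3_seq t a (P_seq c a) k)
  (w k) (psi1_dx2 t k) => z1 z1c z2 y1 y2 q1 q2 q4 y3 q3 wk ps.
move: II; set i := Complex 0 1 => II; move: (Asym c k)%:C t%:C => A tt.
have E (x y z : C) : i * (x + i * y + i * z) = i * x - y - z.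
  by rewrite !mulrDr !mulrA II; ring.
transitivity (- (i * ((z1 + z1c + 2 * z2 + tt * ps * wk - tt * wk) +
  i * (- (A * (y1 + 2 * y2 + y3)) + 2 * (q1 + q2)) + i * (- 2 * (q3 + q4))))).
  by rewrite E; ring.
by ring.
Qed.

Theorem rep_scheme r c t f a : 1 / 2 < r -> 0 < c -> 0 < t ->
  fourier_rep r f a -> fourier_rep r (integrator c t f) (scheme c t a).
Proof.
move=> r2 c0 t0 fa; have [_ _ [K ha]] := fa; have t0' := ltW t0.
apply: rep_eqa (rep_integrator_coef r2 c0 t0' fa) => k.
have mt := measurable_0t t.
have [z2 h2 E2] := has_int_Q2 k r2 c0 t0 ha.
have h1 := has_int_Q1 c a k t0.
have [_ hZ] := has_intZ (Bsym c k)^-1%:C mt (has_intB mt (has_intZ (2 * c)%:C mt h1)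
  (has_intZ (lap k)%:C mt h2)).
rewrite /scheme /scheme_rhs hZ {hZ} E2 /L_seq exp_bracketE bracketE dx2E.
have Et : (t ^+ 2 / 2)%:C = t%:C ^+ 2 / 2 :> C.
  by rewrite rmorphM /= rmorphXn fmorphV rmorph_nat.
have Ec : (2 * c)%:C = 2 * c%:C :> C by rewrite rmorphM /= rmorph_nat.
have EV : (Bsym c k)^-1%:C = (Bsym c k)%:C^-1 :> C by rewrite fmorphV.
have EN : (- lap k)%:C = - (lap k)%:C :> C by rewrite rmorphN.
rewrite EN EV Et Ec.
move: (expi _) (P_seq c a k) (crefl (P_seq c a) k) (crefl a k) (a k) => e p cp ca ak.
have bC := cC_neq0 (lt0r_neq0 (Bsym_gt0 k c0)).
move: (psi1_dx2 t k) (psi2_dx2 t k) bC => p1 p2.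
move: (Bsym c k)%:C (Asym c k)%:C (lap k)%:C t%:C c%:C => B A l tt cc bC.
by field.
Qed.

End SchemeOnCoefficients.

(** * Stability *)

Section Stability.
Context {R : realType}.
Local Notation C := R[i].
Local Notation I := (Complex (0 : R) (1 : R)).
Implicit Types (a b : int -> C) (c r s t K : R) (k : int).
Local Notation sq := (int -> C).

Lemma l1_conv r a b Ka Kb k : 1 / 2 < r -> sob_le r a Ka -> sob_le r b Kb ->
  l1_le (fun j => a j * b (k - j)) (Ka * Kb).
Proof.
move=> r2 ha hb; apply: (@l1_le_mul _ r a b _ _ _ k) => //; first lra.
by move=> j; rewrite normcM.
Qed.

Lemma convBl r a a' b Ka Ka' Kb k : 1 / 2 < r -> sob_le r a Ka -> sob_le r a' Ka' ->
  sob_le r b Kb ->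
  conv (fun j => a j - a' j) b k = conv a b k - conv a' b k.
Proof.
move=> r2 ha ha' hb; have h1 := l1_conv k r2 ha hb; have h2 := l1_conv k r2 ha' hb.
rewrite /conv -mulN1r -(bilateral_sumZ _ h2) -(bilateral_sumD h1 (l1_leZ _ h2)).
by congr bilateral_sum; apply/funext => j; rewrite mulrBl mulN1r.
Qed.

Lemma convBr r a b b' Ka Kb Kb' k : 1 / 2 < r -> sob_le r a Ka -> sob_le r b Kb ->
  sob_le r b' Kb' ->
  conv a (fun j => b j - b' j) k = conv a b k - conv a b' k.
Proof.
move=> r2 ha hb hb'; have h1 := l1_conv k r2 ha hb; have h2 := l1_conv k r2 ha hb'.
rewrite /conv -mulN1r -(bilateral_sumZ _ h2) -(bilateral_sumD h1 (l1_leZ _ h2)).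
by congr bilateral_sum; apply/funext => j; rewrite mulrBr mulN1r.
Qed.

Lemma convZr r a b z Ka Kb k : 1 / 2 < r -> sob_le r a Ka -> sob_le r b Kb ->
  conv a (fun j => z * b j) k = z * conv a b k.
Proof.
move=> r2 ha hb; rewrite /conv -(bilateral_sumZ z (l1_conv k r2 ha hb)).
by congr bilateral_sum; apply/funext => j; ring.
Qed.

Lemma convDr r a b b' Ka Kb Kb' k : 1 / 2 < r -> sob_le r a Ka -> sob_le r b Kb ->
  sob_le r b' Kb' ->
  conv a (fun j => b j + b' j) k = conv a b k + conv a b' k.
Proof.
move=> r2 ha hb hb'; have h1 := l1_conv k r2 ha hb; have h2 := l1_conv k r2 ha hb'.
rewrite /conv -(bilateral_sumD h1 h2).
by congr bilateral_sum; apply/funext => j; rewrite mulrDr.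
Qed.

(** Bounded by B and Lipschitz with constant L on the ball of radius K in H^r.
    The bound is part of the notion because the Lipschitz constant of a convolution
    involves it; the constants of composed operators are then assembled
    mechanically. *)
Definition lipschitz r K (F : sq -> sq) B L := forall a b d,
  sob_le r a K -> sob_le r b K -> sob_le r (fun k => a k - b k) d ->
  [/\ sob_le r (F a) B, sob_le r (F b) B & sob_le r (fun k => F a k - F b k) (L * d)].

Lemma lip_id r K : lipschitz r K id K 1.
Proof. by move=> a b d ha hb hd; rewrite mul1r. Qed.

Lemma lip_eq r K F G B L : (forall a k, G a k = F a k) -> lipschitz r K F B L ->
  lipschitz r K G B L.
Proof.
move=> FG; rewrite (_ : G = F) //; apply/funext => a; apply/funext => k; exact: FG.
Qed.

Lemma lip_mult r K F B L P (p : int -> C) : 0 <= P -> (forall k, normc (p k) <= P) ->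
  lipschitz r K F B L -> lipschitz r K (fun a k => p k * F a k) (P * B) (P * L).
Proof.
move=> P0 pP hF a b d ha hb hd; have [h1 h2 h3] := hF a b d ha hb hd.
have pn k (z : C) : normc (p k * z) <= P * normc z.
  by rewrite normcM ler_wpM2r ?normc_ge0.
split; [exact: sob_le_dom h1|exact: sob_le_dom h2|].
by rewrite -mulrA; apply: sob_le_dom h3 => // k; rewrite -mulrBr.
Qed.

Lemma lip_crefl r K F B L : lipschitz r K F B L ->
  lipschitz r K (fun a => crefl (F a)) B L.
Proof.
move=> hF a b d ha hb hd; have [h1 h2 h3] := hF a b d ha hb hd.
split; [exact: sob_le_crefl h1|exact: sob_le_crefl h2|].
rewrite (_ : (fun k => _) = crefl (fun k => F a k - F b k)); first exact: sob_le_crefl.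
by apply/funext => k; rewrite /crefl rmorphB.
Qed.

Lemma lipD r K F G B L B' L' : lipschitz r K F B L -> lipschitz r K G B' L' ->
  lipschitz r K (fun a k => F a k + G a k) (B + B') (L + L').
Proof.
move=> hF hG a b d ha hb hd; have [h1 h2 h3] := hF a b d ha hb hd.
have [h1' h2' h3'] := hG a b d ha hb hd.
split; [exact: sob_leD|exact: sob_leD|].
rewrite mulrDl (_ : (fun k => _) = (fun k => F a k - F b k + (G a k - G b k))).
  exact: sob_leD.
by apply/funext => k; ring.
Qed.

Lemma lipB r K F G B L B' L' : lipschitz r K F B L -> lipschitz r K G B' L' ->
  lipschitz r K (fun a k => F a k - G a k) (B + B') (L + L').
Proof.
move=> hF hG; have := @lip_mult r K G B' L' 1 (fun=> -1) ler01 _ hG.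
rewrite !mul1r => hG'; apply: (@lip_eq r K (fun a k => F a k + -1 * G a k)).
  by move=> a k; rewrite mulN1r.
by apply: lipD => //; apply: hG' => k; rewrite normcN normc1.
Qed.

Lemma lip_conv r K F G B L B' L' : 1 / 2 < r ->
  lipschitz r K F B L -> lipschitz r K G B' L' ->
  lipschitz r K (fun a => conv (F a) (G a))
    (conv_const r * (B * B')) (conv_const r * (L * B' + B * L')).
Proof.
move=> r2 hF hG a b d ha hb hd; have [h1 h2 h3] := hF a b d ha hb hd.
have [h1' h2' h3'] := hG a b d ha hb hd.
have rr : r <= r + 2 by rewrite lerDl.
have cv := sob_conv r2 (lexx r) rr.
split; [exact: cv|exact: cv|].
rewrite (_ : (fun k => _) = (fun k => conv (fun j => F a j - F b j) (G a) k +
    conv (F b) (fun j => G a j - G b j) k)).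
  have -> : conv_const r * (L * B' + B * L') * d =
     conv_const r * (L * d * B') + conv_const r * (B * (L' * d)) by ring.
  by apply: sob_leD; exact: cv.
apply/funext => k; rewrite (convBl k r2 h1 h2 h1') (convBr k r2 h2 h1' h2').
by ring.
Qed.

Lemma lip_twist r K s F B L : lipschitz r K F B L ->
  lipschitz r K (fun a => twist s (F a)) B L.
Proof.
move=> /(@lip_mult r K F B L 1 (fun k => expi (s * lap k)) ler01).
by rewrite !mul1r; apply => k; rewrite normc_expi.
Qed.

Lemma lip_expi r K (w : int -> R) F B L : lipschitz r K F B L ->
  lipschitz r K (fun a k => expi (w k) * F a k) B L.
Proof.
move=> /(@lip_mult r K F B L 1 (fun k => expi (w k)) ler01).
by rewrite !mul1r; apply => k; rewrite normc_expi.
Qed.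

Lemma lip_nonlin r c K : 1 / 2 < r -> 0 < c ->
  exists B L, lipschitz r K (nonlin_seq c) B L.
Proof.
move=> r2 c0; have hh := lipD (@lip_id r K) (lip_crefl (@lip_id r K)).
have hc := lip_conv r2 hh hh.
do 2 eexists; apply: (@lip_eq _ _ (fun a k =>
  (Bsym c k)^-1%:C * (2 * c)%:C * hsum a k -
  (Bsym c k)^-1%:C * (lap k)%:C * conv (hsum a) (hsum a) k)).
  by move=> a k; rewrite /nonlin_seq; ring.
apply: lipB; last first.
  by apply: lip_mult hc; [exact: ler01|move=> k; exact: normc_lapB].
by apply: lip_mult hh; [exact: cmul_ge0 c0|move=> k; exact: normc_cmul].
Qed.

Lemma lip_A r c K F B L : 0 < c -> lipschitz r K F B L ->
  lipschitz r K (fun a k => (Asym c k)%:C * F a k) ((1 + c) * B) ((1 + c) * L).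
Proof. by move=> c0; apply: lip_mult => [|k]; [lra|exact: normc_Asym]. Qed.

Lemma lip_P r c K : 1 / 2 < r -> 0 < c -> exists B L, lipschitz r K (P_seq c) B L.
Proof.
move=> r2 c0; have [B [L hn]] := lip_nonlin K r2 c0.
do 2 eexists; apply: lipB; first exact: lip_A (@lip_id r K).
by apply: (lip_mult (P := 1)) hn => // k; exact: normc_4V.
Qed.

(** All phases have modulus one, which makes the constants uniform in s. *)
Lemma lip_rhs r c K : 1 / 2 < r -> 0 < c ->
  exists B L, forall s, 0 <= s <= 1 -> lipschitz r K (fun a => scheme_rhs c a s) B L.
Proof.
move=> r2 c0; have [BP [LP hP]] := lip_P K r2 c0.
have hi := @lip_id r K.
have f1 s F B L G B' L' (hF : lipschitz r K F B L) (hG : lipschitz r K G B' L') :=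
  lip_expi (fun k => - (s * lap k))
    (lip_conv r2 (lip_twist s hF) (lip_twist s hG)).
have f2 s F B L G B' L' (hF : lipschitz r K F B L) (hG : lipschitz r K G B' L') :=
  lip_expi (fun k => - (s * lap k))
    (lip_conv r2 (lip_twist s hF) (lip_crefl (lip_twist s hG))).
have f1c s := lip_expi (fun k => s * lap k)
    (lip_conv r2 (lip_crefl (lip_twist s hi)) (lip_crefl (lip_twist s hi))).
have f3 s F B L G B' L' (hF : lipschitz r K F B L) (hG : lipschitz r K G B' L') :=
  lip_expi (fun k => - (2 * s * lap k)) (lip_conv r2 (lip_crefl hF) (lip_crefl hG)).
have m2 F B L : lipschitz r K F B L ->
    lipschitz r K (fun a k => 2 * F a k) (2 * B) (2 * L).
  by apply: lip_mult => // k; rewrite normc_nat.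
have nIs s k : 0 <= s <= 1 -> normc (I * s%:C : C) <= 1.
  move=> /andP[s0 s1]; rewrite normcM normc_I mul1r normc_real ger0_norm //.
have mI s F B L : 0 <= s <= 1 -> lipschitz r K F B L ->
    lipschitz r K (fun a k => I * s%:C * F a k) (1 * B) (1 * L).
  by move=> hs; apply: lip_mult => // k; exact: nIs.
have m2I s F B L : 0 <= s <= 1 -> lipschitz r K F B L ->
    lipschitz r K (fun a k => 2 * I * s%:C * F a k) (2 * B) (2 * L).
  move=> hs; apply: lip_mult => // k; rewrite -mulrA normcM normc_nat.
  by rewrite ler_piMr // nIs.
have Bn c' F B L F' B' L' : 0 < c' -> lipschitz r K F B L -> lipschitz r K F' B' L' ->
    lipschitz r K (fun a k => (Bsym c' k)^-1%:C *
      ((2 * c')%:C * F a k - (lap k)%:C * F' a k)) (cmul c' * B + 1 * B') (cmul c' * L + 1 * L').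
  move=> c0' hF hF'; apply: (@lip_eq _ _ (fun a k =>
     (Bsym c' k)^-1%:C * (2 * c')%:C * F a k - (Bsym c' k)^-1%:C * (lap k)%:C * F' a k)).
    by move=> a k; ring.
  apply: lipB; last by apply: lip_mult hF' => // k; exact: normc_lapB.
  by apply: lip_mult hF => [|k]; [exact: cmul_ge0|exact: normc_cmul].
have q1 s (hs : 0 <= s <= 1) := lipD (lipB hi (mI s _ _ _ hs (lipB (lip_A c0 hi) hP)))
  (lip_expi (fun k => - (2 * s * lap k)) (lipB (lip_crefl hi)
     (mI s _ _ _ hs (lipD (lip_A c0 (lip_crefl hi)) (lip_crefl hP))))).
have i1 s := f1 s _ _ _ _ _ _ hi hi; have i2 s := f2 s _ _ _ _ _ _ hi hi.
have i3 s := f3 s _ _ _ _ _ _ hi hi.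
have q2 s (hs : 0 <= s <= 1) := lipB (lipD (lipB
   (lipB (lipD (lipD (lipD (i1 s) (f1c s)) (m2 _ _ _ (i2 s))) (i3 s))
      (lip_conv r2 (lip_crefl hi) (lip_crefl hi)))
   (mI s _ _ _ hs (lip_A c0 (lipD (lipD (i1 s) (m2 _ _ _ (i2 s))) (i3 s)))))
   (m2I s _ _ _ hs (lipD (f1 s _ _ _ _ _ _ hi hP) (f2 s _ _ _ _ _ _ hP hi))))
   (m2I s _ _ _ hs (lipD (f3 s _ _ _ _ _ _ hi hP) (f2 s _ _ _ _ _ _ hi hP))).
do 2 eexists; move=> s hs.
apply: lip_eq (Bn c _ _ _ _ _ _ c0 (q1 s hs) (q2 s hs)) => a k.
by rewrite /scheme_rhs /Q1 /Q2 /form1 /form2 /form3 /form1c; ring.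
Qed.

Lemma cmeas_rhs r c t a K k : 1 / 2 < r -> 0 < c -> 0 < t -> sob_le r a K ->
  cmeas `[0, t] (fun s => scheme_rhs c a s k).
Proof.
move=> r2 c0 t0 ha.
have [z h2 _] := has_int_Q2 k r2 c0 t0 ha; have h1 := has_int_Q1 c a k t0.
have mt := measurable_0t t.
have [h _] := has_intZ (Bsym c k)^-1%:C mt (has_intB mt (has_intZ (2 * c)%:C mt h1)
  (has_intZ (lap k)%:C mt h2)).
exact: cintegrable_meas h.
Qed.

Lemma normc_I4 : normc (I / 4 : C) <= 1.
Proof. by rewrite normcM normc_I mul1r normc_4V. Qed.

(** Stated for arbitrary complex numbers, because normalization would unfold the
    integrals that are substituted for u and v; the same holds for the other ring
    identities below. *)
Lemma sub_update (e x y u v : C) :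
  e * (x - I / 4 * u) - e * (y - I / 4 * v) = e * (x - y - I / 4 * (u - v)).
Proof. by ring. Qed.

Lemma sob_update r c t (w : int -> C) (F G : R -> int -> C) D K K' : 1 / 2 < r -> 0 <= t ->
  sob_le r w D ->
  (forall k, cmeas `[0, t] (fun s => F s k)) ->
  (forall k, cmeas `[0, t] (fun s => G s k)) ->
  (forall s, 0 <= s <= t -> sob_le r (F s) K') ->
  (forall s, 0 <= s <= t -> sob_le r (G s) K') ->
  (forall s, 0 <= s <= t -> sob_le r (fun k => F s k - G s k) K) ->
  sob_le r (fun k => expi (t * Bsym c k) * (w k - I / 4 *
     (cintegral `[0, t] (fun s => F s k) - cintegral `[0, t] (fun s => G s k))))
    (D + t * K).
Proof.
move=> r2 t0 hw mF mG bF bG hFG; apply: sob_expi; apply: sob_leB => //.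
have mt := measurable_0t t; have t_oo := mu_itv_fin t0.
have K0 : 0 <= K by apply: (sob_le_ge0 (hFG 0 _)); rewrite lexx t0.
have cI (H : R -> int -> C) k : (forall k, cmeas `[0, t] (fun s => H s k)) ->
    (forall s, 0 <= s <= t -> sob_le r (H s) K') ->
    cintegrable `[0, t] (fun s => H s k).
  by move=> mH bH; have [] := @has_int_sob R r t H K' k r2 t0 (mH k) bH.
apply: (@sob_le_dom1 _ _ (fun k => cintegral `[0, t] (fun s => F s k - G s k))).
  move=> k; rewrite normcM cintegralB //; [|exact: cI|exact: cI].
  by rewrite ler_piMl ?normc_ge0 ?normc_I4.
have := @sob_le_cintegral R _ r (fun k s => F s k - G s k) K mt t_oo.
rewrite mu_itv //=; apply=> //; first lra.
by move=> k; exact: cmeasB.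
Qed.

(** The linear part is an isometry and the integral is t times a Lipschitz
    function. *)
Theorem scheme_stable r c K : 1 / 2 < r -> 0 < c ->
  exists2 L, 0 <= L & forall t a b d, 0 < t <= 1 ->
    sob_le r a K -> sob_le r b K -> sob_le r (fun k => a k - b k) d ->
    sob_le r (fun k => scheme c t a k - scheme c t b k) ((1 + t * L) * d).
Proof.
move=> r2 c0; have [B [L hL]] := lip_rhs K r2 c0.
exists `|L| => // t a b d /andP[t0 t1] ha hb hd; have t0' := ltW t0.
have d0 := sob_le_ge0 hd.
have hs s : 0 <= s <= t -> 0 <= s <= 1.
  by move=> /andP[-> st] /=; exact: le_trans t1.
have := @sob_update r c t (fun k => a k - b k) (scheme_rhs c a) (scheme_rhs c b)
  d (`|L| * d) B r2 t0' hd (fun k => cmeas_rhs k r2 c0 t0 ha)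
  (fun k => cmeas_rhs k r2 c0 t0 hb).
rewrite (_ : (1 + t * `|L|) * d = d + t * (`|L| * d)); last ring.
rewrite (_ : (fun k => scheme c t a k - _) = (fun k => expi (t * Bsym c k) *
   (a k - b k - I / 4 * (cintegral `[0, t] (fun s => scheme_rhs c a s k) -
      cintegral `[0, t] (fun s => scheme_rhs c b s k))))); last first.
  by apply/funext => k; exact: sub_update.
apply=> s st; have [h1 h2 h3] := hL s (hs s st) a b d ha hb hd => //.
by apply: sob_le_weaken h3 => //; rewrite ler_wpM2r // ler_norm.
Qed.

End Stability.

(** * Phase errors *)

Section LocalError.
Context {R : realType}.
Local Notation C := R[i].
Local Notation I := (Complex (0 : R) (1 : R)).
Implicit Types (a b f : int -> C) (c r s t g K M : R) (k : int).
Local Notation sq := (int -> C).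

(** The properties of the solution on a time step that determine the local
    error, with the origin of time at the beginning of the step. *)
Definition duhamel_flow r c g M t (v : R -> sq) :=
  [/\ forall k, cmeas `[0, t] (fun s => v s k),
      forall s, 0 <= s <= t -> sob_le (1 + r + 2 * g) (v s) M &
      forall s k, 0 <= s <= t -> v s k = expi (s * Bsym c k) *
        (v 0 k - I / 4 * cintegral `[0, s]
          (fun x => expi (- (x * Bsym c k)) * nonlin_seq c (v x) k))].

Lemma sob_le_eq r a b K : (forall k, b k = a k) -> sob_le r a K -> sob_le r b K.
Proof. by move=> ab; apply: sob_le_dom1 => k; rewrite ab. Qed.

Lemma sob_I4 r a K : sob_le r a K -> sob_le r (fun k => I / 4 * a k) K.
Proof. by apply: sob_le_dom1 => k; rewrite normcM ler_piMl ?normc_ge0 ?normc_I4. Qed.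

(** The power t^g is paid with a factor (1 + k^2)^g. *)
Lemma phase_bound g t q (x : R) k : 0 < g <= 1 -> 0 <= t -> 1 <= q ->
  `|x| <= t * q * (1 + lap k) -> normc (expi x - 1) <= 2 * q * t `^ g * weight g k.
Proof.
move=> /andP[g0 g1] t0 q1 hx; apply: le_trans (expi_sub1_powR _ g0 g1) _.
have l0 : 0 <= 1 + lap k :> R by rewrite addr_ge0 // lap_ge0.
rewrite -!mulrA ler_wpM2l //.
apply: (@le_trans _ _ ((t * q * (1 + lap k)) `^ g)).
  by rewrite ge0_ler_powR ?nnegrE ?(ltW g0) // ?mulr_ge0 //; lra.
rewrite !powRM ?mulr_ge0 //; try lra.
rewrite [t `^ g * _]mulrC -!mulrA ler_wpM2r ?mulr_ge0 ?powR_ge0 //.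
by rewrite -[leRHS]powRr1; [rewrite ler_powR|lra].
Qed.

Lemma sob_phase r g t q (w : int -> R) a K : 0 < g <= 1 -> 0 <= t -> 1 <= q ->
  (forall k, `|w k| <= t * q * (1 + lap k)) -> sob_le (r + 2 * g) a K ->
  sob_le r (fun k => (expi (w k) - 1) * a k) (2 * q * t `^ g * K).
Proof.
move=> hg t0 q1 hw; apply: sob_le_gain.
  by rewrite !mulr_ge0 ?powR_ge0 //; lra.
move=> k; rewrite normcM ler_wpM2r ?normc_ge0 //; exact: phase_bound.
Qed.

Lemma le_powR_unit g t s : 0 < g <= 1 -> 0 <= s <= t -> t <= 1 -> s <= t `^ g.
Proof.
move=> /andP[g0 g1] /andP[s0 st] t1; apply: (le_trans st).
have t0 := le_trans s0 st.
have [->|tn0] := eqVneq t 0; first by rewrite powR_ge0.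
by rewrite ger1_powR // lt_neqAle eq_sym tn0 t0.
Qed.

(** The phases of the three factors add up to k^2 - j^2 - (k - j)^2 = 2j(k - j),
    and |exp(2isj(k - j)) - 1| <= 4 s^d |j|^d |k - j|^d: each factor gives up d
    derivatives and the product loses none. *)
Lemma sob_Delta r0 rho d s a b Ka Kb : 1 / 2 < r0 -> r0 <= rho -> rho <= r0 + 2 ->
  0 < d <= 1 -> 0 <= s ->
  sob_le (rho + d) a Ka -> sob_le (rho + d) b Kb ->
  sob_le rho (fun k => expi (s * lap k) *
      conv (crefl (twist s a)) (crefl (twist s b)) k - conv (crefl a) (crefl b) k)
    (4 * s `^ d * (conv_const r0 * (Ka * Kb))).
Proof.
move=> h1 h2 h3 /andP[d0 d1] s0 /sob_le_crefl ha /sob_le_crefl hb.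
pose w (x : sq) k : C := (weight (d / 2) k)%:C * x k.
have wn x k : normc (w x k) = weight (d / 2) k * normc (x k).
  by rewrite normcM normc_real ger0_norm ?weight_ge0.
have hw x K : sob_le (rho + d) x K -> sob_le rho (w x) (1 * K).
  rewrite {1}(_ : d = 2 * (d / 2)); last by field.
  by apply: sob_le_gain => // k; rewrite wn mul1r.
have hwa := sob_leZ (4 * s `^ d)%:C (hw _ _ ha); have hwb := hw _ _ hb.
have s4 : 0 <= 4 * s `^ d by rewrite mulr_ge0 ?powR_ge0.
rewrite (_ : 4 * s `^ d * (conv_const r0 * (Ka * Kb)) =
   conv_const r0 * (normc (4 * s `^ d)%:C * (1 * Ka) * (1 * Kb))); last first.
  by rewrite normc_real ger0_norm //; ring.
have r2 : 1 / 2 < rho + d by lra.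
have lc k j : expi (s * lap k) * (crefl (twist s a) j * crefl (twist s b) (k - j)) =
    expi (2 * s * (j%:~R * (k - j)%:~R)) * (crefl a j * crefl b (k - j)).
  rewrite !crefl_twist.
  have -> : 2 * s * (j%:~R * (k - j)%:~R) =
      s * lap k + - (s * lap j) + - (s * lap (k - j)) :> R.
    by rewrite /lap rmorphB /=; ring.
  by rewrite !expiD; ring.
rewrite (_ : (fun k => _) = (fun k => bilateral_sum (fun j =>
    (expi (2 * s * (j%:~R * (k - j)%:~R)) - 1) * (crefl a j * crefl b (k - j))))).
  apply: (sob_le_conv h1 h2 h3 hwa hwb) => k j.
  rewrite [normc (_%:C * w _ _)]normcM normc_real (ger0_norm s4) !wn.
  rewrite normcM [normc (crefl a j * _)]normcM.
  set x := 2 * s * _.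
  have hx : normc (expi x - 1) <= 4 * s `^ d * (weight (d / 2) j * weight (d / 2) (k - j)).
    apply: le_trans (expi_sub1_powR x d0 d1) _.
    have ew i : weight (d / 2) i = (Num.sqrt (1 + lap i)) `^ d :> R.
      by rewrite -powR12_sqrt ?addr_ge0 ?lap_ge0 // -powRrM /weight mulrC.
    have s1 i : `|i%:~R| <= Num.sqrt (1 + lap i) :> R.
      by rewrite -sqrtr_sqr ler_wsqrtr // lerDr.
    have -> : `|x| = 2 * s * (`|j%:~R| * `|(k - j)%:~R|).
      by rewrite /x !normrM (ger0_norm s0) ger0_norm.
    rewrite !ew -powRM ?sqrtr_ge0 // -!mulrA.
    rewrite (powRM _ (ler0n _ 2)); last by rewrite !mulr_ge0.
    rewrite (powRM _ s0); last by rewrite mulr_ge0.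
    rewrite (_ : 4 = 2 * 2 :> R); last ring.
    rewrite -!mulrA ler_wpM2l // ler_pM ?mulr_ge0 ?powR_ge0 //.
      by rewrite -[leRHS]powRr1 // ler_powR // ler1n.
    rewrite ler_wpM2l ?powR_ge0 // ge0_ler_powR ?nnegrE ?(ltW d0) ?mulr_ge0 //.
    by rewrite ler_pM.
  apply: le_trans (ler_wpM2r _ hx) _; first by rewrite mulr_ge0 ?normc_ge0.
  by apply: le_of_eq; ring.
apply/funext => k.
have hl (x y : sq) Kx Ky (hx : sob_le (rho + d) x Kx) (hy : sob_le (rho + d) y Ky) :=
  l1_conv k r2 hx hy.
have ht x K : sob_le (rho + d) (crefl x) K -> sob_le (rho + d) (crefl (twist s x)) K.
  by apply: sob_le_dom1 => j; rewrite crefl_twist normcM normc_expi mul1r.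
have L1 := hl _ _ _ _ (ht _ _ ha) (ht _ _ hb); have L2 := hl _ _ _ _ ha hb.
rewrite /conv -(bilateral_sumZ (expi (s * lap k)) L1).
rewrite -[- bilateral_sum _]mulN1r -(bilateral_sumZ (-1) L2).
rewrite -(bilateral_sumD (l1_leZ _ L1) (l1_leZ _ L2)).
by congr bilateral_sum; apply/funext => j; rewrite lc mulrBl mul1r mulN1r.
Qed.

Lemma sob_cint r s (F : R -> sq) K : 0 <= r -> 0 <= s ->
  (forall k, cmeas `[0, s] (fun x => F x k)) ->
  (forall x, 0 <= x <= s -> sob_le r (F x) K) ->
  sob_le r (fun k => cintegral `[0, s] (fun x => F x k)) (s * K).
Proof.
move=> r0 s0 mF bF; have K0 : 0 <= K by apply: (sob_le_ge0 (bF 0 _)); rewrite lexx s0.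
have := @sob_le_cintegral R _ r (fun k x => F x k) K (measurable_0t s) (mu_itv_fin s0).
by rewrite mu_itv //=; apply.
Qed.

End LocalError.

(** * Local error *)

Section FlowExpansion.
Context {R : realType} (r c M : R) (r2 : 1 / 2 < r) (c0 : 0 < c).
Local Notation C := R[i].
Local Notation I := (Complex (0 : R) (1 : R)).
Implicit Types (a b f : int -> C) (s t g rho K : R) (k : int).
Local Notation sq := (int -> C).

Let r0 : 0 <= r. Proof. by have := r2; lra. Qed.
Let q1 : 1 <= 1 + c. Proof. by have := c0; lra. Qed.

Lemma flow_sob rho g t v s : duhamel_flow r c g M t v -> rho <= 1 + r + 2 * g ->
  0 <= s <= t -> sob_le rho (v s) M.
Proof. by case=> _ hv _ hrho st; apply: sob_le_weaken (hv s st). Qed.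

Lemma flow_cmeas_nonlin g t v k : duhamel_flow r c g M t v -> 0 < g ->
  cmeas `[0, t] (fun s => nonlin_seq c (v s) k).
Proof.
move=> hv g0; have [mv bv _] := hv.
have mh j : cmeas `[0, t] (fun s => hsum (v s) j).
  by apply: cmeasD; [exact: mv|apply: cmeas_conj; exact: mv].
apply: cmeasZ; apply: cmeasB; apply: cmeasZ => //.
by apply: (cmeas_conv k r2) => // s; rewrite /= in_itv /= => st; exists (M + M);
   apply: sob_hsum; apply: (flow_sob hv _ st); lra.
Qed.

Definition nl_bound := cmul c * (M + M) + conv_const (1 + r) * ((M + M) * (M + M)).

Lemma flow_nonlin rho g t v s : duhamel_flow r c g M t v -> 0 < g <= 1 ->
  rho <= 1 + r + 2 * g -> 0 <= s <= t -> sob_le rho (nonlin_seq c (v s)) nl_bound.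
Proof.
move=> hv /andP[g0 g1] hrho st; apply: (@sob_le_weaken _ (1 + r + 2 * g) _ _ nl_bound) => //.
have r12 : 1 / 2 < 1 + r by have := r2; lra.
by apply: (sob_nonlin r12) => //; [lra|lra|exact: (flow_sob hv _ st)].
Qed.

Lemma flow_P rho g t v : duhamel_flow r c g M t v -> 0 < g <= 1 -> 0 <= t ->
  rho <= 1 + r + 2 * g -> sob_le rho (P_seq c (v 0)) (P_bound (1 + r) c M).
Proof.
move=> hv /andP[g0 g1] t0 hrho.
apply: (@sob_le_weaken _ (1 + r + 2 * g) _ _ (P_bound (1 + r) c M)) => //.
have r12 : 1 / 2 < 1 + r by have := r2; lra.
by apply: (sob_P r12) => //; [lra|lra|apply: (flow_sob hv) => //; rewrite lexx].
Qed.

Lemma cmeas_phase (D : set R) (w : R) : cmeas D (fun x => expi (- (x * w)) : C).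
Proof.
apply: (@cmeas_eq _ _ (fun x => expi (- w * x))); last exact: cmeas_expi.
by move=> x _; congr expi; ring.
Qed.

Lemma sub_set_0t s t : s <= t -> ([set` `[0%R, s]] : set R) `<=` [set` `[0%R, t]].
Proof.
by move=> st x /=; rewrite !in_itv /= => /andP[-> xs] /=; exact: le_trans st.
Qed.

Lemma flow_cmeas_rhs g t v s k : duhamel_flow r c g M t v -> 0 < g -> s <= t ->
  cmeas `[0, s] (fun x => expi (- (x * Bsym c k)) * nonlin_seq c (v x) k).
Proof.
move=> hv g0 st; apply: cmeasM; first exact: cmeas_phase.
by apply: cmeas_sub (sub_set_0t st) (flow_cmeas_nonlin k hv g0); exact: measurable_0t.
Qed.

Lemma phase_B t s k : 0 <= s <= t -> `|s * Bsym c k| <= t * (1 + c) * (1 + lap k).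
Proof.
move=> /andP[s0 st]; have b0 := Bsym_gt0 k c0.
rewrite ger0_norm ?mulr_ge0 ?(ltW b0) // -mulrA.
by apply: ler_pM; rewrite ?(ltW b0) // Bsym_le.
Qed.

Lemma flow_alg (e x y : C) : e * (x - I / 4 * y) - x =
  (e - 1) * x - e * (I / 4 * y).
Proof. by ring. Qed.

(** In Duhamel's formula the free evolution moves the initial value by t^g, at
    the price of 2g derivatives, and the integral is of size t <= t^g. *)
Lemma flow_increment : exists2 K, 0 <= K & forall g t v s, 0 < g <= 1 -> 0 < t <= 1 ->
  duhamel_flow r c g M t v -> 0 <= s <= t ->
  sob_le r (fun k => v s k - v 0 k) (t `^ g * K).
Proof.
exists `|2 * (1 + c) * M + nl_bound| => // g t v s hg ht hv st.
have /andP[g0 g1] := hg; have /andP[t0 t1] := ht; have /andP[s0 st'] := st.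
have v0 : sob_le (r + 2 * g) (v 0) M.
  by apply: (flow_sob hv); rewrite ?lexx ?(ltW t0) //; lra.
have hN := flow_nonlin hv hg (lexx _) st.
have h1 := sob_phase hg (ltW t0) q1 (fun k => phase_B k st) v0.
have h2 : sob_le r (fun k => cintegral `[0, s]
     (fun x => expi (- (x * Bsym c k)) * nonlin_seq c (v x) k)) (s * nl_bound).
  apply: (@sob_cint R r s (fun x k => expi (- (x * Bsym c k)) * nonlin_seq c (v x) k)) => //.
    by move=> k; exact: (flow_cmeas_rhs k hv).
  move=> x /andP[x0 xs]; apply: sob_expi.
  apply: (flow_nonlin hv) => //; first by rewrite addrAC lerDr; lra.
  by rewrite x0 (le_trans xs).
have h3 := sob_leB h1 (sob_expi (fun k => s * Bsym c k) (sob_I4 h2)).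
apply: (@sob_le_weaken _ r _ _ (2 * (1 + c) * t `^ g * M + s * nl_bound)) => //.
  have := sob_le_ge0 hN; have := le_powR_unit hg st t1.
  have := ler_norm (2 * (1 + c) * M + nl_bound); have := powR_ge0 t g.
  move: (t `^ g) => e e0 h se N0; nra.
have [_ _ hE] := hv; apply: sob_le_eq h3 => k.
by rewrite hE //; exact: flow_alg.
Qed.

(** To first order in s, f + is P(f) transported by the Schroedinger flow. *)
Definition flow_expansion (a : sq) s k : C :=
  twist s a k + s%:C * (I * twist s (P_seq c a) k).

Lemma first_order_alg (eB ei el eA x y u A : C) sR : eB * ei = 1 -> eB = el * eA ->
  eB * (x - I / 4 * y) - (el * x + sR * (I * (el * (A * x - 4^-1 * u)))) =
  eB * (ei * (el * ((eA - 1 - I * (sR * A)) * x)) - I / 4 * (y - sR * (ei * (el * u)))).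
Proof.
move=> h1 h2; have -> : eB * (ei * (el * ((eA - 1 - I * (sR * A)) * x)) -
     I / 4 * (y - sR * (ei * (el * u)))) =
   (eB * ei) * (el * ((eA - 1 - I * (sR * A)) * x)) - eB * (I / 4 * y) +
     (eB * ei) * (I / 4 * (sR * (el * u))) by ring.
by rewrite h1 h2; ring.
Qed.

Lemma phase_alg (e E x y : C) : e * x - e * (E * y) = e * (x - y) - e * ((E - 1) * y).
Proof. by ring. Qed.

Lemma Bsym_split s k : expi (s * Bsym c k) = expi (s * lap k) * expi (s * Asym c k).
Proof. by rewrite -expiD; congr expi; rewrite /Asym; ring. Qed.

Lemma sob_taylor rho s a K : sob_le rho a K -> sob_le rho
  (fun k => (expi (s * Asym c k) - 1 - I * (s%:C * (Asym c k)%:C)) * a k)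
  (2 * (s * (1 + c)) ^+ 2 * K).
Proof.
apply: sob_le_dom; first by rewrite mulr_ge0 // sqr_ge0.
move=> k; rewrite normcM ler_wpM2r ?normc_ge0 // -rmorphM.
apply: le_trans (expi_sub1_taylor _) _; rewrite ler_wpM2l // !exprMn.
rewrite ler_wpM2l ?sqr_ge0 // ler_sqr ?nnegrE ?Asym_le ?Asym_ge0 //.
by have := q1; lra.
Qed.

(** Once exp(isk^2) is factored out, the bounded symbol A is expanded with an
    error of size s^2.  In the integral, the nonlinearity is frozen at time 0 and the
    phase (s - x)B is replaced by sk^2; both errors are of size t^g, and the
    integral provides one more power of t. *)
Lemma flow_first_order : exists2 K, 0 <= K & forall g t v s, 0 < g <= 1 -> 0 < t <= 1 ->
  duhamel_flow r c g M t v -> 0 <= s <= t ->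
  sob_le r (fun k => v s k - flow_expansion (v 0) s k) (t * t `^ g * K).
Proof.
have [K0 K0p hinc] := flow_increment; have [B [L hL]] := lip_nonlin M r2 c0.
exists (2 * (1 + c) ^+ 2 * `|M| + (`|L| * K0 + 2 * (1 + c) * `|nl_bound|))
  => [|g t v s hg ht hv st].
  have := q1; have := normr_ge0 M; have := normr_ge0 nl_bound; have := normr_ge0 L.
  by move=> h1 h2 h3 h4; rewrite ?addr_ge0 ?mulr_ge0 ?sqr_ge0 //; lra.
have /andP[g0 g1] := hg; have /andP[t0 t1] := ht; have /andP[s0 st'] := st.
have hr : r <= 1 + r + 2 * g by rewrite addrAC lerDr; lra.
have v0 rho : rho <= 1 + r + 2 * g -> sob_le rho (v 0) M.
  by move=> ?; apply: (flow_sob hv) => //; rewrite lexx (ltW t0).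
have hN (x : R) rho : 0 <= x <= s -> rho <= 1 + r + 2 * g ->
    sob_le rho (nonlin_seq c (v x)) nl_bound.
  by move=> /andP[x0 xs] ?; apply: (flow_nonlin hv) => //; rewrite x0 (le_trans xs).
have s00 : 0 <= (0 : R) <= s by rewrite lexx s0.
pose e := t `^ g; have e0 : 0 <= e by exact: powR_ge0.
have se : s <= e := le_powR_unit hg st t1.
pose w k := expi (- (s * Bsym c k)) * (expi (s * lap k) *
  ((expi (s * Asym c k) - 1 - I * (s%:C * (Asym c k)%:C)) * v 0 k)).
have hw : sob_le r w (2 * (s * (1 + c)) ^+ 2 * M).
  by do 2 apply: sob_expi; apply: sob_taylor; exact: v0.
pose F x k := expi (- (x * Bsym c k)) * nonlin_seq c (v x) k.
pose G (x : R) k := expi (- (s * Bsym c k)) * (expi (s * lap k) * nonlin_seq c (v 0) k).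
have hFG (x : R) : 0 <= x <= s -> sob_le r (fun k => F x k - G x k)
    (e * (`|L| * K0) + 2 * (1 + c) * e * nl_bound).
  move=> /[dup] xs /andP[x0 xs'].
  have xt : 0 <= x <= t by rewrite x0 (le_trans xs').
  have [_ _ h1] := hL _ _ _ (flow_sob hv hr xt) (v0 _ hr) (hinc _ _ _ _ hg ht hv xt).
  apply: (sob_le_eq (a := fun k =>
     expi (- (x * Bsym c k)) * (nonlin_seq c (v x) k - nonlin_seq c (v 0) k) -
     expi (- (x * Bsym c k)) *
       ((expi ((x - s) * Bsym c k + s * lap k) - 1) * nonlin_seq c (v 0) k))).
    move=> k; rewrite /F /G.
    have -> : expi (- (s * Bsym c k)) * (expi (s * lap k) * nonlin_seq c (v 0) k) =
       expi (- (x * Bsym c k)) * (expi ((x - s) * Bsym c k + s * lap k) * nonlin_seq c (v 0) k).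
      move: (nonlin_seq _ _ _) => N; rewrite !mulrA -!expiD; congr (_ * _).
      by congr expi; ring.
    exact: phase_alg.
  apply: sob_leB; apply: sob_expi.
    apply: sob_le_weaken h1 => //; rewrite mulrCA ler_wpM2l // ler_wpM2r ?ler_norm //.
  apply: (sob_phase hg (ltW t0) q1).
    move=> k; have b0 := Bsym_gt0 k c0; have bl := lap_le_Bsym k c0.
    have l0 := lap_ge0 (R := R) k; apply: le_trans (phase_B k st).
    by rewrite [leRHS]ger0_norm ?mulr_ge0 ?(ltW b0) // ler_norml; nra.
  by apply: hN => //; lra.
have mF k : cmeas `[0, s] (fun x => F x k) by exact: (flow_cmeas_rhs k hv).
have mG k : cmeas `[0, s] (fun x => G x k) by exact: cmeas_cst.
have bF x : 0 <= x <= s -> sob_le r (F x) nl_bound.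
  by move=> xs; apply: sob_expi; exact: hN.
have bG x : 0 <= x <= s -> sob_le r (G x) nl_bound.
  by move=> xs; do 2 apply: sob_expi; exact: hN.
have hU := sob_update c r2 s0 hw mF mG bF bG hFG.
have [_ _ hE] := hv.
apply: (@sob_le_weaken _ r _ _ _ _ (lexx r)) (sob_le_eq
  (b := fun k => v s k - flow_expansion (v 0) s k) _ hU); last first.
  move=> k; rewrite hE //.
  rewrite (_ : cintegral `[0, s] (fun x => G x k) = s%:C * G 0 k); last first.
    by rewrite cintegral_cst ?mu_itv // mulrC.
  rewrite /w /G /flow_expansion /twist /P_seq.
  exact: (first_order_alg (v 0 k) (cintegral `[0, s] (fun x => F x k))
    (nonlin_seq c (v 0) k) (Asym c k)%:C s%:C (expiN _) (Bsym_split s k)).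
have N0 := sob_le_ge0 (hN 0 r s00 hr); have M0 := sob_le_ge0 (v0 r hr).
rewrite (ger0_norm N0) (ger0_norm M0) -/e.
have L0 : 0 <= `|L| * K0 by rewrite mulr_ge0.
have c1 : 0 <= 1 + c by have := q1; lra.
rewrite [leRHS]mulrDr; apply: lerD.
  have -> : 2 * (s * (1 + c)) ^+ 2 * M = (s * s) * (2 * (1 + c) ^+ 2 * M) by ring.
  by rewrite ler_wpM2r ?mulr_ge0 ?sqr_ge0 // ler_pM.
have -> : t * e * (`|L| * K0 + 2 * (1 + c) * nl_bound) =
   t * (e * (`|L| * K0) + 2 * (1 + c) * e * nl_bound) by ring.
by rewrite ler_wpM2r // addr_ge0 ?mulr_ge0.
Qed.

(** First-order expansion of exp(-isB) (X + sY).  As in Filon quadrature, the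
    oscillating factor is kept and only the slowly varying one is expanded. *)
Definition filon s (X Y : sq) k : C := expi (- (s * lap k)) *
  ((1 - I * (s%:C * (Asym c k)%:C)) * X k + s%:C * Y k).

Lemma filon_alg (el eA X X0 X1 A : C) sR :
  el * eA * X - el * ((1 - I * (sR * A)) * X0 + sR * X1) =
  el * eA * (X - X0 - sR * X1) + (el * ((eA - 1 - I * (- sR * A)) * X0) +
    el * (sR * ((eA - 1) * X1))).
Proof. by ring. Qed.

Lemma sob_filon s t e X X0 X1 M0 M1 K : 0 <= s <= t -> s <= e ->
  sob_le r X0 M0 -> sob_le r X1 M1 ->
  sob_le r (fun k => X k - X0 k - s%:C * X1 k) (t * e * K) ->
  sob_le r (fun k => expi (- (s * Bsym c k)) * X k - filon s X0 X1 k)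
    (t * e * (K + 2 * (1 + c) ^+ 2 * M0 + (1 + c) * M1)).
Proof.
move=> /andP[s0 st] se h0 h1 hX; have c1 : 0 <= 1 + c by have := q1; lra.
have M00 := sob_le_ge0 h0; have M10 := sob_le_ge0 h1.
have h3 : sob_le r (fun k => (expi (- s * Asym c k) - 1) * X1 k) (s * (1 + c) * M1).
  apply: sob_le_dom h1; first by rewrite mulr_ge0.
  move=> k; rewrite normcM ler_wpM2r ?normc_ge0 //.
  apply: le_trans (expi_sub1_le _) _.
  by rewrite normrM normrN (ger0_norm s0) ger0_norm ?Asym_ge0 // ler_wpM2l // Asym_le.
have h4 := sob_leD (sob_expi (fun k => - (s * lap k)) (sob_taylor (- s) h0))
  (sob_expi (fun k => - (s * lap k)) (sob_leZ s%:C h3)).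
have h5 := sob_leD (sob_expi (fun k => - (s * Bsym c k)) hX) h4.
apply: (@sob_le_weaken _ r _ _ _ _ (lexx r)) (sob_le_eq (b := fun k =>
  expi (- (s * Bsym c k)) * X k - filon s X0 X1 k) _ h5); last first.
  move=> k; rewrite /filon.
  have -> : expi (- (s * Bsym c k)) = expi (- (s * lap k)) * expi (- s * Asym c k) :> C.
    by rewrite -expiD; congr expi; rewrite /Asym; ring.
  by rewrite rmorphN; exact: filon_alg.
rewrite normc_real (ger0_norm s0).
have ss : s * s <= t * e by rewrite ler_pM.
have -> : t * e * K + (2 * (- s * (1 + c)) ^+ 2 * M0 + s * (s * (1 + c) * M1)) =
  t * e * K + (s * s) * (2 * (1 + c) ^+ 2 * M0 + (1 + c) * M1) by ring.
rewrite -[K + _ + _]addrA [leRHS]mulrDr lerD2l ler_wpM2r // addr_ge0 ?mulr_ge0 ?sqr_ge0 //.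
Qed.

(** [free_sum] and [free_slope] are the value and the slope in s of v + conj v in
    the expansion [flow_expansion] ([hsum_expansion]). *)
Definition free_sum s a : sq := hsum (twist s a).
Definition free_slope s a k : C :=
  I * (twist s (P_seq c a) k - crefl (twist s (P_seq c a)) k).

Lemma Q1_filon s a k : Q1 c s a k = filon s (free_sum s a) (free_slope s a) k.
Proof.
rewrite /Q1 /filon /free_sum /free_slope /hsum !crefl_twist /twist.
have -> : expi (- (2 * s * lap k)) = expi (- (s * lap k)) * expi (- (s * lap k)) :> C.
  by rewrite -expiD; congr expi; ring.
have E1 : expi (- (s * lap k)) * expi (s * lap k) = 1 :> C by rewrite mulrC expiN.
move: (P_seq c a k) (crefl (P_seq c a) k) (a k) (crefl a k) => p pt x xt.
move: (expi (- (s * lap k))) (expi (s * lap k)) E1 => E' E E1.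
have -> : x - I * s%:C * ((Asym c k)%:C * x - p) =
   (E' * E) * (x - I * s%:C * ((Asym c k)%:C * x - p)) by rewrite E1 mul1r.
by ring.
Qed.

Lemma conj_expansion (x y z : C) s : (x - (y + s%:C * (I * z)))^* =
  x^* - (y^* - s%:C * (I * z^*)).
Proof.
apply: ReImP; rewrite ?(Re_conjc, Im_conjc, Re_D, Im_D, Re_N, Im_N, Re_M, Im_M) /=.
  by ring.
by ring.
Qed.

Lemma expansion_alg (x y g0 g1 h0 h1 w : C) :
  x + y - (g0 + h0) - w * (I * (g1 - h1)) =
  x - (g0 + w * (I * g1)) + (y - (h0 - w * (I * h1))).
Proof. by ring. Qed.

Lemma hsum_expansion s (x : sq) a k :
  hsum x k - free_sum s a k - s%:C * free_slope s a k =
  hsum (fun j => x j - flow_expansion a s j) k.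
Proof.
rewrite /hsum /free_sum /hsum /free_slope /flow_expansion /crefl.
rewrite conj_expansion; exact: expansion_alg.
Qed.

Lemma convDl (x y z : sq) Kx Ky Kz k : sob_le r x Kx -> sob_le r y Ky ->
  sob_le r z Kz -> conv (fun j => x j + y j) z k = conv x z k + conv y z k.
Proof.
move=> hx hy hz; rewrite (convC r2 (sob_leD hx hy) hz) (convDr k r2 hz hx hy).
by rewrite (convC r2 hx hz) (convC r2 hy hz).
Qed.

Lemma conv_square (x y : sq) Kx Ky k : sob_le r x Kx -> sob_le r y Ky ->
  conv (fun j => x j + y j) (fun j => x j + y j) k =
  conv x x k + 2 * conv x y k + conv y y k.
Proof.
move=> hx hy; rewrite (convDl k hx hy (sob_leD hx hy)) (convDr k r2 hx hx hy).
by rewrite (convDr k r2 hy hx hy) (convC r2 hy hx); ring.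
Qed.

Lemma conv_sum_diff (x y z w : sq) Kx Ky k : sob_le r x Kx -> sob_le r y Kx ->
  sob_le r z Ky -> sob_le r w Ky ->
  conv (fun j => x j + y j) (fun j => I * (z j - w j)) k =
  I * (conv x z k - conv x w k + conv z y k - conv y w k).
Proof.
move=> hx hy hz hw; have hd := sob_leB hz hw.
rewrite (convDl k hx hy (sob_leZ I hd)) (convZr I k r2 hx hd) (convZr I k r2 hy hd).
rewrite (convBr k r2 hx hz hw) (convBr k r2 hy hz hw) (convC r2 hz hy).
by ring.
Qed.

Definition Delta s a b k : C := expi (s * lap k) *
  conv (crefl (twist s a)) (crefl (twist s b)) k - conv (crefl a) (crefl b) k.

Lemma Q2_alg (E2 E F A G D W G1 D1 D2 W1 Z Zp sR : C) : F = E2 * E ->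
  F * ((1 - I * (sR * A)) * (G + 2 * D + W) + sR * (2 * (I * (G1 - D1 + D2 - W1)))) -
  (F * G + E * W + 2 * (F * D) + E2 * Z - Z
   - I * sR * A * (F * G + 2 * (F * D) + E2 * Z)
   + 2 * I * sR * (F * G1 + F * D2) - 2 * I * sR * (E2 * Zp + F * D1)) =
  (E2 - 1) * (E * W - Z) - (I * sR * (A * (E2 * (E * W - Z))) +
     2 * I * sR * (E2 * (E * W1 - Zp))).
Proof. by move=> ->; ring. Qed.

(** With the phases of [form3], a product of two conjugates differs from the
    exact one by a multiple of [Delta]; all other terms agree. *)
Lemma Q2_filon s a Ka Kp k : sob_le r a Ka -> sob_le r (P_seq c a) Kp ->
  filon s (conv (free_sum s a) (free_sum s a))
    (fun j => 2 * conv (free_sum s a) (free_slope s a) j) k - Q2 c s a k =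
  (expi (- (2 * s * lap k)) - 1) * Delta s a a k -
  (I * s%:C * ((Asym c k)%:C * (expi (- (2 * s * lap k)) * Delta s a a k)) +
   2 * I * s%:C * (expi (- (2 * s * lap k)) * Delta s a (P_seq c a) k)).
Proof.
move=> ha hp; have tw x K : sob_le r x K ->
    sob_le r (twist s x) K /\ sob_le r (crefl (twist s x)) K.
  by move=> h; split; [|apply: sob_le_crefl]; exact: sob_twist.
have [h1 h2] := tw _ _ ha; have [h3 h4] := tw _ _ hp.
rewrite /filon [conv (free_sum s a) (free_sum s a) k](conv_square k h1 h2).
rewrite [conv (free_sum s a) (free_slope s a) k](conv_sum_diff k h1 h2 h3 h4).
by apply: Q2_alg; rewrite -expiD; congr expi; ring.
Qed.

(** The first term in [Q2_filon] has no factor s of its own: [sob_Delta] with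
    d = 1 gives one power of s in H^(r + 2g), and the phase 2sk^2 then gives t^g in
    H^r.  The other terms carry a factor s, and d = g suffices for them. *)
Lemma sob_Q2_filon t g s a Ma Mp : 0 < g <= 1 -> 0 < t <= 1 -> 0 <= s <= t ->
  sob_le (1 + r + 2 * g) a Ma -> sob_le (1 + r + 2 * g) (P_seq c a) Mp ->
  sob_le r (fun k => filon s (conv (free_sum s a) (free_sum s a))
      (fun j => 2 * conv (free_sum s a) (free_slope s a) j) k - Q2 c s a k)
    (t * t `^ g * (conv_const r *
       (16 * (Ma * Ma) + (4 * (1 + c) * (Ma * Ma) + 8 * (Ma * Mp))))).
Proof.
move=> hg ht st ha hp; have /andP[g0 g1] := hg; have /andP[t0 t1] := ht.
have /andP[s0 st'] := st.
have low rho x K : rho <= 1 + r + 2 * g -> sob_le (1 + r + 2 * g) x K -> sob_le rho x K.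
  by move=> ?; exact: sob_le_weaken.
have hr : r <= 1 + r + 2 * g by rewrite addrAC lerDr; lra.
have rg : r <= r + 2 * g by rewrite lerDl; lra.
have rg2 : r + 2 * g <= r + 2 by rewrite lerD2l; lra.
have e1 : r + 2 * g + 1 <= 1 + r + 2 * g by rewrite addrC addrA.
have e2 : r + g <= 1 + r + 2 * g by rewrite -addrA addrCA lerD2l; lra.
have i1 : 0 < (1 : R) <= 1 by rewrite ltr01 lexx.
have d1 := sob_Delta r2 rg rg2 i1 s0 (low _ _ _ e1 ha) (low _ _ _ e1 ha).
have rr : r <= r + 2 by rewrite lerDl.
have d2 := sob_Delta r2 (lexx r) rr hg s0 (low _ _ _ e2 ha) (low _ _ _ e2 ha).
have d3 := sob_Delta r2 (lexx r) rr hg s0 (low _ _ _ e2 ha) (low _ _ _ e2 hp).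
have q2 : 1 <= 2 :> R by lra.
have hw k : `|- (2 * s * lap k)| <= t * 2 * (1 + lap k).
  have l0 := lap_ge0 (R := R) k; have s20 : 0 <= 2 * s by lra.
  rewrite normrN ger0_norm; last exact: mulr_ge0.
  by apply: ler_pM => //; lra.
have p1 := sob_phase hg (ltW t0) q2 hw d1.
have p2 := sob_leZ (I * s%:C) (sob_A c0 (sob_expi (fun k => - (2 * s * lap k)) d2)).
have p3 := sob_leZ (2 * I * s%:C) (sob_expi (fun k => - (2 * s * lap k)) d3).
apply: (@sob_le_weaken _ r _ _ _ _ (lexx r)) (sob_le_eq (b := fun k => filon s _ _ k - _) _
   (sob_leB p1 (sob_leD p2 p3))); last first.
  by move=> k; exact: (Q2_filon s k (low _ _ _ hr ha) (low _ _ _ hr hp)).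
have Ma0 := sob_le_ge0 ha; have Mp0 := sob_le_ge0 hp.
have cr0 : 0 <= conv_const r by have := conv_const_ge1 r2; lra.
have -> : normc (I * s%:C) = s by rewrite normcM normc_I mul1r normc_real ger0_norm.
have -> : normc (2 * I * s%:C) = 2 * s.
  by rewrite !normcM normc_I normc_nat mulr1 normc_real ger0_norm.
rewrite (powRr1 s0).
have se : s `^ g <= t `^ g by rewrite ge0_ler_powR ?nnegrE // ltW.
have sse : s * s `^ g <= t * t `^ g by rewrite ler_pM ?powR_ge0.
have ste : s * t `^ g <= t * t `^ g by rewrite ler_wpM2r ?powR_ge0.
have c1 : 0 <= 1 + c by have := q1; lra.
move: (conv_const r) (s `^ g) (t `^ g) cr0 sse ste {se d1 d2 d3 p1 p2 p3} => V u e V0 sse ste.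
have x1 : 0 <= V * (Ma * Ma) by rewrite !mulr_ge0.
have x2 : 0 <= V * (Ma * Mp) by rewrite !mulr_ge0.
have x3 : 0 <= (1 + c) * (V * (Ma * Ma)) by rewrite !mulr_ge0.
have y1 := ler_wpM2r x1 ste; have y2 := ler_wpM2r x2 sse; have y3 := ler_wpM2r x3 sse.
lra.
Qed.

Lemma square_alg (x y z w sR : C) :
  y + 2 * z + w - y - sR * (2 * x) = 2 * (z - sR * x) + w.
Proof. by ring. Qed.

(** Expand the square of H0 + (h - H0): h - H0 is of size t and agrees with
    s H1 up to t e. *)
Lemma sob_square_expansion s t e (h H0 H1 : sq) M0 M1 K : 0 <= s <= t ->
  0 <= t <= e -> e <= 1 -> sob_le r H0 M0 -> sob_le r H1 M1 ->
  sob_le r (fun k => h k - H0 k - s%:C * H1 k) (t * e * K) -> 0 <= K ->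
  sob_le r (fun k => conv h h k - conv H0 H0 k - s%:C * (2 * conv H0 H1 k))
    (t * e * (conv_const r * (2 * (M0 * K) + (K + M1) ^+ 2))).
Proof.
move=> /andP[s0 st] /andP[t0 te] e1 h0 h1 hE K0.
have M00 := sob_le_ge0 h0; have M10 := sob_le_ge0 h1.
have rr : r <= r + 2 by rewrite lerDl.
have hd : sob_le r (fun k => h k - H0 k) (t * (K + M1)).
  apply: (@sob_le_weaken _ r _ _ _ _ (lexx r)) (sob_le_eq (b := fun k => h k - H0 k) _
    (sob_leD hE (sob_leZ s%:C h1))); last by move=> k; rewrite subrK.
  rewrite normc_real (ger0_norm s0) mulrDr; apply: lerD; last exact: ler_wpM2r.
  by rewrite -mulrA ler_wpM2l // ler_piMl.
have E k : h k = H0 k + (h k - H0 k) by rewrite addrC subrK.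
have c1 := sob_conv r2 (lexx r) rr h0 hE; have c2 := sob_conv r2 (lexx r) rr hd hd.
apply: (@sob_le_weaken _ r _ _ _ _ (lexx r)) (sob_le_eq (b := fun k => conv h h k -
   conv H0 H0 k - s%:C * (2 * conv H0 H1 k)) _ (sob_leD (sob_leZ 2 c1) c2)); last first.
  move=> k.
  have -> : conv h h k = conv (fun j => H0 j + (h j - H0 j)) (fun j => H0 j + (h j - H0 j)) k.
    by congr (conv _ _ k); apply/funext.
  rewrite (conv_square k h0 hd).
  rewrite (convBr k r2 h0 hd (sob_leZ s%:C h1)) (convZr s%:C k r2 h0 h1).
  exact: square_alg.
rewrite normc_nat; have cr0 : 0 <= conv_const r by have := conv_const_ge1 r2; lra.
move: (conv_const r) cr0 {c1 c2} => V V0.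
have te2 : t * t <= t * e by rewrite ler_wpM2l.
have x1 : 0 <= V * (K + M1) ^+ 2 by rewrite mulr_ge0 // sqr_ge0.
have y1 := ler_wpM2r x1 te2; lra.
Qed.

Lemma rhs_alg (E B h x l n f2 q2 cc : C) :
  E * (B * (cc * h - l * x)) - B * (cc * n - l * q2) =
  B * (cc * (E * h - n) - l * (E * x - f2 + (f2 - q2))).
Proof. by ring. Qed.

Theorem local_error : exists2 K, 0 <= K & forall g t v, 0 < g <= 1 -> 0 < t <= 1 ->
  duhamel_flow r c g M t v ->
  sob_le r (fun k => v t k - scheme c t (v 0) k) (t * (t * t `^ g * K)).
Proof.
have [K1 K10 hfirst] := flow_first_order; have [B [L hL]] := lip_rhs M r2 c0.
pose Pb := P_bound (1 + r) c M; pose KE := K1 + K1.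
pose KQ1 := KE + 2 * (1 + c) ^+ 2 * (M + M) + (1 + c) * (Pb + Pb).
pose W := conv_const r * (2 * ((M + M) * KE) + (KE + (Pb + Pb)) ^+ 2).
pose KQ2 := W + 2 * (1 + c) ^+ 2 * (conv_const r * ((M + M) * (M + M))) +
   (1 + c) * (normc (2 : C) * (conv_const r * ((M + M) * (Pb + Pb)))) +
   conv_const r * (16 * (M * M) + (4 * (1 + c) * (M * M) + 8 * (M * Pb))).
exists `|cmul c * KQ1 + KQ2| => // g t v hg ht hv.
have /andP[g0 g1] := hg; have /andP[t0 t1] := ht; have t0' := ltW t0.
have tt : 0 <= t <= t by rewrite t0' lexx.
have zt : 0 <= (0 : R) <= t by rewrite lexx t0'.
have hr : r <= 1 + r + 2 * g by rewrite addrAC lerDr; lra.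
pose e := t `^ g; have te : 0 <= t <= e by rewrite t0' (le_powR_unit hg tt t1).
have e1 : e <= 1.
  have := @ge0_ler_powR R g (ltW g0) t 1; rewrite powR1; apply; rewrite ?nnegrE //.
have v0 : sob_le r (v 0) M := flow_sob hv hr zt.
have vP : sob_le r (P_seq c (v 0)) Pb := flow_P hv hg t0' hr.
have hF s : 0 <= s <= t -> sob_le r (fun k => expi (- (s * Bsym c k)) * nonlin_seq c (v s) k -
     scheme_rhs c (v 0) s k) (t * e * (cmul c * KQ1 + KQ2)).
  move=> st; have /andP[s0 st'] := st.
  have se : s <= e by have /andP[_] := te; exact: le_trans.
  have hH0 : sob_le r (free_sum s (v 0)) (M + M) by apply: sob_hsum; exact: sob_twist.
  have hH1 : sob_le r (free_slope s (v 0)) (Pb + Pb).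
    have := sob_twist s vP => hp; have := sob_leZ I (sob_leB hp (sob_le_crefl hp)).
    by rewrite normc_I mul1r.
  have hE : sob_le r (fun k => hsum (v s) k - free_sum s (v 0) k -
      s%:C * free_slope s (v 0) k) (t * e * KE).
    apply: sob_le_eq (hsum_expansion s (v s) (v 0)) _.
    by rewrite mulrDr; apply: sob_hsum; exact: hfirst.
  have f1 := sob_filon st se hH0 hH1 hE.
  have KE0 : 0 <= KE by rewrite addr_ge0.
  have hE2 := sob_square_expansion st te e1 hH0 hH1 hE KE0.
  have rr : r <= r + 2 by rewrite lerDl.
  have f2 := sob_filon st se (sob_conv r2 (lexx r) rr hH0 hH0)
    (sob_leZ 2 (sob_conv r2 (lexx r) rr hH0 hH1)) hE2.
  have f3 := sob_Q2_filon hg ht st (flow_sob hv (lexx _) zt) (flow_P hv hg t0' (lexx _)).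
  have := sob_Bcomb c0 f1 (sob_leD f2 f3).
  rewrite -/Pb -/e -/KQ1 -/W.
  rewrite (_ : cmul c * (t * e * KQ1) + _ = t * e * (cmul c * KQ1 + KQ2)); last first.
    by rewrite /KQ2; ring.
  apply: sob_le_eq => k; rewrite /nonlin_seq /scheme_rhs Q1_filon.
  exact: rhs_alg.
pose KB := Num.max nl_bound B.
have zero : sob_le r (fun k => v 0 k - v 0 k) 0.
  by apply: sob_le_eq (sob_le0 r) => k; rewrite subrr.
have hU := @sob_update R r c t (fun k => v 0 k - v 0 k)
  (fun s k => expi (- (s * Bsym c k)) * nonlin_seq c (v s) k)
  (scheme_rhs c (v 0)) 0 _ KB r2 t0' zero
  (fun k => flow_cmeas_rhs k hv g0 (lexx t)) (fun k => cmeas_rhs k r2 c0 t0 v0) _ _ hF.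
have [_ _ hEq] := hv.
apply: (@sob_le_weaken _ r _ _ _ _ (lexx r)) (sob_le_eq (b := fun k => v t k - scheme c t (v 0) k) _
   (hU _ _)); last first.
- move=> s st; have s01 : 0 <= s <= 1 by have /andP[-> sle] := st; exact: le_trans t1.
  have [h _ _] := hL s s01 _ _ _ v0 v0 zero.
  by apply: sob_le_weaken h => //; rewrite le_max lexx orbT.
- move=> s st; apply: sob_expi; apply: (@sob_le_weaken _ r _ _ nl_bound) => //.
    by rewrite le_max lexx.
  exact: (flow_nonlin hv).
- by move=> k; rewrite hEq //; exact: sub_update.
rewrite add0r ler_wpM2l // ler_wpM2l ?ler_norm //.
by rewrite mulr_ge0 // powR_ge0.
Qed.

End FlowExpansion.

(** * Sobolev norms and translated integrals *)

Section SobolevNorm.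
Context {R : realType}.
Local Notation C := R[i].
Local Notation mu := (@lebesgue_measure R).
Implicit Types (f g : R -> C) (a : int -> C) (r s t K : R) (k : int).

Lemma sobolev_norm_sqr r f K : 0 <= K ->
  (sobolev_norm r f <= K%:E)%E <->
  (\esum_(k in [set: int])
    (weight r k * normc (fourier_coef f k) ^+ 2)%:E <= (K ^+ 2)%:E)%E.
Proof.
move=> K0; rewrite /sobolev_norm.
set S := (\esum_(_ in _) _)%E; have S0 : (0 <= S)%E.
  by apply: esum_ge0 => k _; rewrite lee_fin mulr_ge0 ?weight_ge0 ?sqr_ge0.
case: S S0 => [x| |] //=; rewrite ?leNye //.
  by rewrite !lee_fin => x0; rewrite -{2}[x]sqr_sqrtr // ler_sqr ?nnegrE ?sqrtr_ge0.
Qed.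

Lemma sobolev_normP r f K : 0 <= K ->
  (sobolev_norm r f <= K%:E)%E <-> sob_le r (fourier_coef f) K.
Proof.
move=> K0; rewrite sobolev_norm_sqr //; split=> [h|[_ h]].
  split=> // s us; rewrite -lee_fin; apply: le_trans h.
  apply: esum_ge; exists [set` s]; first by split => //; exact: finite_seq.
  by rewrite -fsbig_seq // sumEFin.
apply: ub_ereal_sup => _ [A [fA _]] <-.
rewrite fsbig_finite // sumEFin lee_fin; apply: h.
exact: finmap.fset_uniq.
Qed.

Lemma sobolev_norm_fin r f : (sobolev_norm r f < +oo)%E ->
  exists K, sob_le r (fourier_coef f) K.
Proof.
move=> foo; have n0 : (0 <= sobolev_norm r f)%E by rewrite sqrte_ge0.
exists (fine (sobolev_norm r f)); apply/sobolev_normP; first exact: fine_ge0.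
by rewrite fineK // ge0_fin_numE.
Qed.

(** Lebesgue measure and its translate agree on intervals, hence are equal. *)
Lemma Rintegral_shift t0 s (h : R -> R) K : 0 <= s ->
  measurable_fun ([set` `[t0, (t0 + s)%R]] : set R) h ->
  (forall x, t0 <= x <= t0 + s -> `|h x| <= K) ->
  \int[mu]_(x in `[t0, (t0 + s)%R]) h x = \int[mu]_(x in `[0%R, s]) h (t0 + x).
Proof.
move=> s0 mh bh; rewrite /Rintegral; congr fine.
pose phi (x : measurableTypeR R) : measurableTypeR R := t0 + x.
have mphi : measurable_fun [set: measurableTypeR R] phi.
  by apply: measurable_funD => //; exact: measurable_cst.
have pE : phi @^-1` [set` `[t0, (t0 + s)%R]] = [set` `[0%R, s]].
  by apply/seteqP; split => x; rewrite /phi /= !in_itv /= lerDl lerD2l.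
have mD : measurable ([set` `[t0, (t0 + s)%R]] : set R) by exact: measurable_itv.
pose f : R -> \bar R := (EFin \o h) \_ [set` `[t0, (t0 + s)%R]].
have mf : measurable_fun [set: R] f.
  by apply/(measurable_restrictT _ mD); exact/measurable_EFinP.
have fphi : f \o phi = (EFin \o (h \o phi)) \_ [set` `[0%R, s]].
  by apply/funext => x; rewrite /f /= !patchE -pE.
have m0 := measurable_0t s.
have mh' : measurable_fun ([set` `[0%R, s]] : set R) (h \o phi).
  apply: (measurable_comp mD) => //; last exact: measurable_funTS.
  by move=> _ [x /= xs <-]; have : (phi @^-1` [set` `[t0, (t0 + s)%R]]) x by rewrite pE.
have ifphi : mu.-integrable [set` `[0%R, s]] (EFin \o (h \o phi)).
  apply: (@integrable_ebounded R _ (h \o phi) K m0 (mu_itv_fin s0) mh').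
  apply: aeW => x /=; rewrite in_itv /= => /andP[x0 xs]; apply: bh.
  by rewrite lerDl lerD2l x0.
have shiftE (A : set R) : measurable A -> mu A = pushforward mu phi A.
  apply: lebesgue_measure_unique => _ [[a b]] _ <-.
  rewrite /= /pushforward.
  rewrite (_ : phi @^-1` _ = [set` `]a - t0, b - t0]]); last first.
    by apply/seteqP; split => x; rewrite /phi /= !in_itv /= ltrBlDl lerBrDl.
  rewrite !lebesgue_measure_itv /= !lte_fin ltrD2r; case: ifP => // _.
  by rewrite -!EFinB; congr EFin; ring.
transitivity (\int[mu]_x f x)%E; first by rewrite -integral_mkcond.
transitivity (\int[pushforward mu phi]_x f x)%E.
  by apply: eq_measure_integral => A mA _; exact: shiftE.
rewrite (integral_pushforward mphi mf) //.
  by rewrite preimage_setT fphi -integral_mkcond.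
rewrite preimage_setT fphi.
exact: ((integrable_mkcond (mu := mu) (EFin \o (h \o phi)) m0).1 ifphi).
Qed.

Lemma cintegral_shift t0 s f K : 0 <= s -> cmeas [set` `[t0, (t0 + s)%R]] f ->
  (forall x, t0 <= x <= t0 + s -> normc (f x) <= K) ->
  cintegral [set` `[t0, (t0 + s)%R]] f = cintegral `[0, s] (fun x => f (t0 + x)).
Proof.
move=> s0 [mr mi] bf; rewrite /cintegral.
congr (_ +i* _); apply: (@Rintegral_shift t0 s _ K) => // x hx.
  by apply: le_trans (bf x hx); exact: Re_le_normc.
by apply: le_trans (bf x hx); exact: Im_le_normc.
Qed.

Lemma cintegral_itvB t t' f : 0 <= t <= t' -> cintegrable `[0, t'] f ->
  cintegral `[0, t'] f - cintegral `[0, t] f = cintegral [set` `]t, t']] f.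
Proof.
move=> /andP[t0 tt] [hr hi]; apply: ReImP; rewrite ?(Re_D, Re_N, Im_D, Im_N) /=.
  exact: Rintegral_itvB.
exact: Rintegral_itvB.
Qed.

Lemma cintegral_itv_lip t t' f K : 0 <= t <= t' -> 0 <= K -> cmeas `[0, t'] f ->
  ebounded `[0, t'] f K ->
  normc (cintegral `[0, t'] f - cintegral `[0, t] f) <= K * (t' - t).
Proof.
move=> /[dup] tt' /andP[t0 tt] K0 mf bf.
have t0' := le_trans t0 tt.
have cf := cintegrable_ebounded (measurable_0t t') (mu_itv_fin t0') mf bf.
rewrite cintegral_itvB //.
have sub : ([set` `]t, t']] : set R) `<=` [set` `[0%R, t']].
  by move=> x /=; rewrite !in_itv /= => /andP[tx ->]; rewrite (le_trans t0) // ltW.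
have mD : measurable ([set` `]t, t']] : set R) by exact: measurable_itv.
have muD : mu [set` `]t, t']] = (t' - t)%:E.
  rewrite lebesgue_measure_itv /= lte_fin; have [lt|ge] := ltP t t'; first by rewrite -EFinB.
  by congr EFin; apply/esym/eqP; rewrite subr_eq0 eq_le tt ge.
have := @cintegral_le R [set` `]t, t']] f K mD.
rewrite muD /=; apply => //; first by rewrite ltry.
  exact: cmeas_sub (measurable_0t t') sub mf.
move: bf; apply: filterS; first exact: (ae_filter_ringOfSetsType mu).
by move=> x h /sub; exact: h.
Qed.

Lemma cmeas_shift t0 s t f : 0 <= t0 -> t0 + s <= t -> cmeas `[0, t] f ->
  cmeas `[0, s] (fun x => f (t0 + x)).
Proof.
move=> t00 st [mr mi].
have sub : (fun x : R => t0 + x) @` [set` `[0%R, s]] `<=` ([set` `[0%R, t]] : set R).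
  move=> _ [x /= xs <-]; move: xs; rewrite !in_itv /= => /andP[x0 xs].
  by rewrite addr_ge0 //= (le_trans _ st) // lerD2l.
have mD : measurable_fun ([set` `[0%R, s]] : set R) (fun x : R => t0 + x).
  by apply: measurable_funD => //; exact: measurable_cst.
split; first exact: (measurable_comp (measurable_0t t) sub mr mD).
exact: (measurable_comp (measurable_0t t) sub mi mD).
Qed.

Lemma cintegral_split t0 s f K : 0 <= t0 -> 0 <= s -> cmeas `[0, (t0 + s)%R] f ->
  (forall x, 0 <= x <= t0 + s -> normc (f x) <= K) ->
  cintegral `[0, (t0 + s)%R] f = cintegral `[0, t0] f +
    cintegral `[0, s] (fun x => f (t0 + x)).
Proof.
move=> t00 s0 mf bf; have ts : 0 <= t0 <= t0 + s by rewrite t00 lerDl.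
have b0 : ebounded `[0, (t0 + s)%R] f K.
  by apply: ebounded_pt => x /=; rewrite in_itv /=; exact: bf.
have cf := cintegrable_ebounded (measurable_0t (t0 + s))
  (mu_itv_fin (addr_ge0 t00 s0)) mf b0.
have sub : ([set` `[t0, (t0 + s)%R]] : set R) `<=` [set` `[0%R, (t0 + s)%R]].
  by move=> x /=; rewrite !in_itv /= => /andP[tx ->]; rewrite (le_trans t00).
rewrite -(@cintegral_shift t0 s f K) //; last first.
- by move=> x /andP[x0 xs]; apply: bf; rewrite xs (le_trans t00).
- exact: cmeas_sub (measurable_0t (t0 + s)) sub mf.
have sub_add (x y z : C) : x - y = z -> x = y + z by move=> <-; rewrite addrC subrK.
apply: sub_add; rewrite cintegral_itvB //.
have sub' : ([set` `]t0, (t0 + s)%R]] : set R) `<=` [set` `[0%R, (t0 + s)%R]].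
  by move=> x /=; rewrite !in_itv /= => /andP[/ltW tx ->]; rewrite (le_trans t00).
have muD : (mu [set` `]t0, (t0 + s)%R]] < +oo)%E.
  by rewrite lebesgue_measure_itv /= lte_fin; case: ifP => _; rewrite -?EFinB ltry.
have [cr ci] : cintegrable [set` `]t0, (t0 + s)%R]] f.
  apply: (cintegrable_ebounded (K := K)) => //.
  - exact: cmeas_sub (measurable_0t (t0 + s)) sub' mf.
  - by apply: ebounded_pt => x /sub' /=; rewrite in_itv /=; exact: bf.
by apply: ReImP; exact: Rintegral_itv_obnd_cbnd.
Qed.

End SobolevNorm.

(** * Coefficients of the solution *)

Section AlmostEverywhere.
Context {R : realType}.
Local Notation C := R[i].
Local Notation I := (Complex (0 : R) (1 : R)).
Local Notation mu := (@lebesgue_measure R).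
Implicit Types (f g : R -> C) (a : int -> C) (r s t K : R) (k : int).

(** Unimodular factors make the sum of the moduli the real part of one single
    integral, whose integrand is bounded almost everywhere. *)
Lemma l1_cintegral (D : set R) (F : int -> R -> C) K : measurable D ->
  (mu D < +oo)%E -> 0 <= K -> (forall k, cmeas D (F k)) ->
  {ae mu, forall x, D x -> l1_le (fun k => F k x) K} ->
  l1_le (fun k => cintegral D (F k)) (K * fine (mu D)).
Proof.
move=> mD Doo K0 mF bF s us; pose E k := cintegral D (F k).
(* For E k = 0 the quotient is 0. *)
pose z k : C := (E k)^* / (normc (E k))%:C.
have zE k : z k * E k = (normc (E k))%:C.
  have [E0|En] := eqVneq (E k) 0; first by rewrite E0 mulr0 normc0.
  have n0 : normc (E k) != 0 by apply: contra_neq En; exact: eq0_normc.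
  apply: (mulIf (cC_neq0 n0)); rewrite /z mulrAC divfK ?cC_neq0 //.
  rewrite -rmorphM -expr2 normc_sqr; move: (E k) => -[x y].
  by apply: ReImP; rewrite /=; ring.
have z1 k : normc (z k) <= 1.
  rewrite normcM normc_conj normcV normc_real ger0_norm ?normc_ge0 //.
  have [->|n0] := eqVneq (normc (E k)) 0; first by rewrite mul0r.
  by rewrite divff.
have cF k : cintegrable D (F k).
  apply: (@cintegrable_ebounded _ _ _ K) => //.
  move: bF; apply: filterS; first exact: (ae_filter_ringOfSetsType mu).
  by move=> x h /h /(_ [:: k] isT); rewrite big_seq1.
have cZ k : cintegrable D (fun x => z k * F k x) by exact: cintegrableZ.
have -> : \sum_(k <- s) normc (cintegral D (F k)) =
    Re (cintegral D (fun x => \sum_(k <- s) z k * F k x)).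
  rewrite cintegral_sum // Re_sum; apply: eq_bigr => k _.
  by rewrite cintegralZ // -/(E k) zE.
apply: le_trans (ler_norm _) _; apply: le_trans (Re_le_normc _) _.
apply: cintegral_le => //; first by apply: cmeas_sum => k; exact: cmeasZ.
move: bF; apply: filterS; first exact: (ae_filter_ringOfSetsType mu).
move=> x h /h /(_ s us); apply: le_trans; apply: le_trans (normc_sum _ _) _.
by apply: ler_sum => k _; rewrite normcM ler_piMl ?normc_ge0.
Qed.

(** A set of full measure meets every interval of positive length. *)
Lemma ae_dense (P : R -> Prop) (T t e : R) : {ae mu, forall x, P x} ->
  0 < T -> 0 <= t <= T -> 0 < e ->
  exists2 x : R, 0 < x < T & `|x - t| <= e /\ P x.
Proof.
move=> [N [mN N0 PN]] T0 /andP[t0 tT] e0; apply: contrapT => none.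
pose lo := Num.max 0 (t - e); pose hi := Num.min T (t + e).
have lohi : lo < hi.
  clear - T0 t0 tT e0.
  by rewrite lt_min !gt_max T0; apply/andP; split; apply/andP; split; lra.
have sub : ([set` `]lo, hi[] : set R) `<=` N.
  move=> x /=; rewrite in_itv /= gt_max lt_min => /andP[/andP[x0 xt] /andP[xT xe]].
  apply: PN => Px; apply: none; exists x; first by rewrite x0 xT.
  by split=> //; rewrite ler_norml; clear - xt xe; apply/andP; split; lra.
have : (mu [set` `]lo, hi[] <= mu N)%E by apply: le_measure; rewrite ?inE.
rewrite N0 lebesgue_measure_itv /= lte_fin lohi -EFinB lee_fin.
by clear - lohi; lra.
Qed.

Lemma cvg_of_le_harmonic (x_ : nat -> R) x L :
  (forall N, `|x_ N - x| <= L * N.+1%:R^-1) -> x_ @ \oo --> x.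
Proof.
move=> h; have hL : (fun N => L * N.+1%:R^-1) @ \oo --> (0 : R).
  by rewrite -[0](mulr0 L); apply: cvgM; [exact: cvg_cst|exact: cvg_harmonic].
apply/cvgrPdist_le => e e0; move/cvgrPdist_le: hL => /(_ e e0).
apply: filterS => N; rewrite sub0r normrN => hN.
by rewrite distrC; apply: le_trans (h N) _; apply: le_trans (ler_norm _) hN.
Qed.

Lemma le_max_fine (x : \bar R) : (x < +oo)%E -> (x <= (Num.max (fine x) 0)%:E)%E.
Proof. by case: x => [x| |] // _; rewrite ?leNye // lee_fin le_max lexx. Qed.

End AlmostEverywhere.

Section SolutionCoefficients.
Context {R : realType} (c T m : R) (u : R -> R -> R[i]).
Context (c0 : 0 < c) (T0 : 0 < T) (m2 : 1 / 2 < m)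
  (hu : forall t : R, 0 <= t <= T -> in_sobolev m (u t))
  (huL : in_sobolev_Linfty T m u) (hd : duhamel_solution c T u).
Local Notation C := R[i].
Local Notation I := (Complex (0 : R) (1 : R)).
Local Notation mu := (@lebesgue_measure R).
Local Notation "'\hat' t" := (fourier_coef (u t)) (at level 8, t at level 2).
Implicit Types (s t K : R) (k : int).

Lemma sol_rep t : 0 <= t <= T -> fourier_rep m (u t) (\hat t).
Proof.
move=> ht; have [_ ir ii noo] := hu ht.
by have [K hK] := sobolev_norm_fin noo; exact: rep_of_coef hK.
Qed.

Lemma sol_sob t : 0 <= t <= T -> exists K, sob_le m (\hat t) K.
Proof. by case/sol_rep. Qed.

Definition sol_bound : R := Num.max (fine (sobolev_Linfty_norm T m u)) 0.

Lemma sol_ae_bound : {ae mu, forall t, 0 < t < T -> sob_le m (\hat t) sol_bound}.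
Proof.
have M0 : 0 <= sol_bound by rewrite le_max lexx orbT.
have hN : (sobolev_Linfty_norm T m u <= sol_bound%:E)%E.
  exact: le_max_fine huL.2.
have h : {ae mu, forall t, (((fun t => sobolev_norm m (u t)) \_ [set` `]0%R, T[]) t
    <= sobolev_Linfty_norm T m u)%E} by exact: ess_sup_ge.
move: h; apply: filterS; first exact: (ae_filter_ringOfSetsType mu).
move=> t h ht; apply/sobolev_normP => //; apply: le_trans hN; apply: le_trans h.
by rewrite patchE ifT // inE /= in_itv.
Qed.

(** The end points are included by enlarging the radius; the sharp bound at all
    times is [sol_ball]. *)
Lemma sol_ae_ball : exists K,
  {ae mu, forall t, [set` `[0%R, T]] t -> sob_le m (\hat t) K}.
Proof.
have T0' := ltW T0.
have [K0 h0] : exists K, sob_le m (\hat 0) K by apply: sol_sob; rewrite lexx T0'.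
have [K1 h1] : exists K, sob_le m (\hat T) K by apply: sol_sob; rewrite lexx T0'.
exists (Num.max sol_bound (Num.max K0 K1)).
move: sol_ae_bound; apply: filterS; first exact: (ae_filter_ringOfSetsType mu).
move=> t h /=; rewrite in_itv /= => /andP[t0 tT].
have [E|tn0] := eqVneq t 0.
  by rewrite E; apply: sob_le_weaken h0 => //; rewrite !le_max lexx orbT.
have [E|tnT] := eqVneq t T.
  by rewrite E; apply: sob_le_weaken h1 => //; rewrite !le_max lexx !orbT.
apply: (sob_le_weaken (lexx m) _ (h _)); first by rewrite le_max lexx.
by rewrite !lt_neqAle eq_sym tn0 tnT t0.
Qed.

Lemma sol_cmeas k : cmeas [set` `[0%R, T]] (fun t => \hat t k).
Proof. exact: (huL.1 k). Qed.

Lemma sol_cmeas_nonlin k : cmeas [set` `[0%R, T]] (fun t => nonlin_seq c (\hat t) k).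
Proof.
have mh j : cmeas [set` `[0%R, T]] (fun s => hsum (\hat s) j).
  by apply: cmeasD; [exact: sol_cmeas|apply: cmeas_conj; exact: sol_cmeas].
apply: cmeasZ; apply: cmeasB; apply: cmeasZ => //.
by apply: (cmeas_conv k m2) => // s; rewrite /= in_itv /= => /sol_sob[K hK];
  exists (K + K); exact: sob_hsum.
Qed.

Lemma sol_ae_nonlin : exists K,
  {ae mu, forall t, [set` `[0%R, T]] t -> sob_le m (nonlin_seq c (\hat t)) K}.
Proof.
have [K hK] := sol_ae_ball; eexists.
move: hK; apply: filterS; first exact: (ae_filter_ringOfSetsType mu).
by move=> t h /h; apply: (sob_nonlin m2) => //; rewrite lerDl.
Qed.

Lemma duhamel_alg (e i x y : C) : e * x - i * (e * y) = e * (x - i * y).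
Proof. by ring. Qed.

(** The formula holds for almost every x, where the integral in time and the
    Fourier series in x are exchanged; coefficients are then compared. *)
Lemma sol_duhamel t k : 0 <= t <= T -> \hat t k = expi (t * Bsym c k) *
  (\hat 0 k - I / 4 * cintegral `[0, t]
    (fun s => expi (- (s * Bsym c k)) * nonlin_seq c (\hat s) k)).
Proof.
move=> /[dup] ht /andP[t0 tT].
have h00 : 0 <= (0 : R) <= T by rewrite lexx ltW.
have mt := measurable_0t t; have moo := mu_itv_fin t0; have st := sub_set_0t tT.
pose d s k := expi ((t - s) * Bsym c k) * nonlin_seq c (\hat s) k.
have md j : cmeas [set` `[0%R, t]] (fun s => d s j).
  apply: cmeasM; last exact: cmeas_sub (measurable_0t T) st (sol_cmeas_nonlin j).
  apply: (@cmeas_eq _ _ (fun s => expi (t * Bsym c j) * expi (- (s * Bsym c j)))).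
    by move=> s _; rewrite -expiD; congr expi; ring.
  by apply: cmeasZ; exact: cmeas_phase.
have sd s K : sob_le m (nonlin_seq c (\hat s)) K -> l1_le (d s) (zeta_bound m * K).
  by move=> h; apply: sob_le_l1 => //; exact: sob_expi.
have [K hK] := sol_ae_nonlin.
pose K' := `|zeta_bound m * K|.
have bd : {ae mu, forall s, [set` `[0%R, t]] s -> l1_le (d s) K'}.
  move: hK; apply: filterS; first exact: (ae_filter_ringOfSetsType mu).
  by move=> s h /st /h /sd l s' us; apply: le_trans (l s' us) (ler_norm _).
have ld s : [set` `[0%R, t]] s -> exists K', l1_le (d s) K'.
  move=> /st /=; rewrite in_itv /= => /sol_sob[Ks hs].
  have mm : m <= m + 2 by rewrite lerDl.
  by eexists; exact: sd (sob_nonlin m2 (lexx m) mm c0 hs).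
have [K0 h0] := sol_sob h00.
have l0 := sob_le_l1 m2 (sob_expi (fun k => t * Bsym c k) h0).
have lI := @l1_cintegral R _ (fun k s => d s k) K' mt moo (normr_ge0 _) md bd.
pose e k := expi (t * Bsym c k) * \hat 0 k - I / 4 * cintegral [set` `[0%R, t]] (fun s => d s k).
have le := l1_leD l0 (l1_leZ (-1) (l1_leZ (I / 4) lI)).
have uE : {ae mu, forall x, @Omega R x -> u t x = fser e x}.
  move: (hd ht); apply: filterS; first exact: (ae_filter_ringOfSetsType mu).
  move=> x -> _.
  rewrite (fourier_multE_rep _ _ m2 (sol_rep h00)).
  have -> : fser (fun k => exp_bracket c t k * \hat 0 k) x =
      fser (fun k => expi (t * Bsym c k) * \hat 0 k) x.
    by apply: (congr1 (fun e => fser e x)); apply/funext => j; rewrite exp_bracketE.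
  have -> : cintegral `[0, t] (fun s => fourier_mult (exp_bracket c (t - s))
      (nonlin c (u s)) x) = cintegral [set` `[0%R, t]] (fun s => fser (d s) x).
    apply: cintegral_eq => s /st /=; rewrite in_itv /= => hs.
    rewrite (fourier_multE_rep _ _ m2 (rep_nonlin m2 c0 (sol_rep hs))).
    by apply: (congr1 (fun e => fser e x)); apply/funext => j; rewrite exp_bracketE.
  rewrite (fser_cintegral x mt moo md ld bd) -(fserZ _ x lI) -mulN1r.
  rewrite -(fserZ _ x (l1_leZ (I / 4) lI)) -(fserD x l0 (l1_leZ (-1) (l1_leZ (I / 4) lI))).
  by apply: (congr1 (fun e => fser e x)); apply/funext => j; rewrite mulN1r.
have eE : e = (fun k => expi (t * Bsym c k) * \hat 0 k +
   -1 * (I / 4 * cintegral [set` `[0%R, t]] (fun s => d s k))).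
  by apply/funext => j; rewrite mulN1r.
have [mu_t _ _] := sol_rep ht.
rewrite (fourier_coef_ae k mu_t _ uE); last first.
  by rewrite eE; exact: cmeas_fser le.
rewrite eE (fourier_coef_fser k le) mulN1r.
have -> : cintegral [set` `[0%R, t]] (fun s => d s k) = expi (t * Bsym c k) *
   cintegral `[0, t] (fun s => expi (- (s * Bsym c k)) * nonlin_seq c (\hat s) k).
  rewrite -cintegralZ //.
    apply: cintegral_eq => s _; rewrite /d mulrA -expiD; congr (expi _ * _); ring.
  apply: (@cintegrable_ebounded _ _ _ K') => //.
    apply: cmeasM; first exact: cmeas_phase.
    exact: cmeas_sub (measurable_0t T) st (sol_cmeas_nonlin k).
  move: bd; apply: filterS; first exact: (ae_filter_ringOfSetsType mu).
  move=> s h /h /(_ [:: k] isT); rewrite big_seq1; apply: le_trans.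
  by rewrite !normcM !normc_expi.
exact: duhamel_alg.
Qed.

Lemma sub_alg (a i x y : C) : a - i * x - (a - i * y) = - (i * (x - y)).
Proof. by ring. Qed.

Lemma sol_lipschitz k : exists L, forall t t', 0 <= t <= t' -> t' <= T ->
  normc (\hat t' k - \hat t k) <= L * (t' - t).
Proof.
have [K hK] := sol_ae_nonlin.
have m0 : 0 <= m by have := m2; lra.
pose G s := expi (- (s * Bsym c k)) * nonlin_seq c (\hat s) k.
have mG : cmeas [set` `[0%R, T]] G.
  by apply: cmeasM; [exact: cmeas_phase|exact: sol_cmeas_nonlin].
have bG : ebounded [set` `[0%R, T]] G `|K|.
  move: hK; apply: filterS; first exact: (ae_filter_ringOfSetsType mu).
  move=> s h /h hs; rewrite /G normcM normc_expi mul1r.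
  exact: le_trans (sob_le_pt k m0 hs) (ler_norm _).
pose X t := \hat 0 k - I / 4 * cintegral `[0, t] G.
have sub t : t <= T -> cmeas [set` `[0%R, t]] G /\ ebounded [set` `[0%R, t]] G `|K|.
  move=> tT; have st := sub_set_0t tT; split.
    exact: cmeas_sub (measurable_0t T) st mG.
  move: bG; apply: filterS; first exact: (ae_filter_ringOfSetsType mu).
  by move=> s h /st /h.
have hX t t' : 0 <= t <= t' -> t' <= T -> normc (X t' - X t) <= `|K| * (t' - t).
  move=> tt tT; have [mg bg] := sub _ tT; have := cintegral_itv_lip tt (normr_ge0 K) mg bg.
  apply: le_trans; rewrite /X sub_alg normcN normcM ler_piMl ?normc_ge0 ?normc_I4 //.
have X0 : X 0 = \hat 0 k.
  have m00 := measurable_0t (0 : R); have [mg bg] := sub 0 (ltW T0).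
  have := cintegral_le m00 (mu_itv_fin (lexx 0)) mg (normr_ge0 K) bg.
  rewrite mu_itv // mulr0 => h0; rewrite /X.
  have /eq0_normc -> : normc (cintegral [set` `[0%R, 0%R]] G) = 0.
    by apply: le_anti; rewrite h0 normc_ge0.
  by rewrite mulr0 subr0.
exists (`|K| + Bsym c k * (normc (\hat 0 k) + `|K| * T)) => t t' /[dup] tt /andP[t0 tt'] tT.
have ht : 0 <= t <= T by rewrite t0 (le_trans tt').
have ht' : 0 <= t' <= T by rewrite tT (le_trans t0).
rewrite (sol_duhamel k ht) (sol_duhamel k ht') -/(X t) -/(X t').
have -> : expi (t' * Bsym c k) * X t' - expi (t * Bsym c k) * X t =
   expi (t' * Bsym c k) * (X t' - X t) +
   expi (t * Bsym c k) * ((expi ((t' - t) * Bsym c k) - 1) * X t).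
  have -> : expi (t' * Bsym c k) = expi (t * Bsym c k) * expi ((t' - t) * Bsym c k) :> C.
    by rewrite -expiD; congr expi; ring.
  by ring.
apply: le_trans (le_normcD _ _) _; rewrite [leRHS]mulrDl.
apply: lerD; rewrite normcM normc_expi mul1r; first exact: hX.
have b0 := Bsym_gt0 k c0; rewrite normcM.
have t'0 : 0 <= t' - t by rewrite subr_ge0.
rewrite [leRHS]mulrAC [Bsym c k * _]mulrC; apply: ler_pM; rewrite ?normc_ge0 //.
  have tb : 0 <= (t' - t) * Bsym c k by rewrite mulr_ge0 // ltW.
  by apply: le_trans (expi_sub1_le _) _; rewrite ger0_norm.
have h00t : 0 <= (0 : R) <= t by rewrite lexx.
have := hX 0 t h00t (proj2 (andP ht)); rewrite X0 subr0 => h.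
have -> : X t = \hat 0 k + (X t - \hat 0 k) by rewrite addrC subrK.
apply: le_trans (le_normcD _ _) _; rewrite lerD2l; apply: le_trans h _.
by rewrite ler_wpM2l //; case/andP: ht.
Qed.

(** The coefficients are continuous in time, and the norm is lower
    semicontinuous: a bound at almost all times holds at all times. *)
Lemma sol_ball t : 0 <= t <= T -> sob_le m (\hat t) sol_bound.
Proof.
move=> ht; have /andP[t0 tT] := ht.
have ex N : exists s, 0 < s < T /\
    (`|s - t| <= N.+1%:R^-1 /\ sob_le m (\hat s) sol_bound).
  have e0 : 0 < N.+1%:R^-1 :> R by rewrite invr_gt0.
  have [s hs [h1 h2]] := ae_dense sol_ae_bound T0 ht e0.
  by exists s; split => //; split => //; exact: h2.
pose s_ N := projT1 (cid (ex N)).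
have hs N : 0 < s_ N < T /\ (`|s_ N - t| <= N.+1%:R^-1 /\ sob_le m (\hat (s_ N)) sol_bound).
  exact: projT2 (cid (ex N)).
apply: (@sob_le_lim _ m (fun N => \hat (s_ N))) => [N|k]; first by have [_ []] := hs N.
have [L hL] := sol_lipschitz k.
have hN N : normc (\hat (s_ N) k - \hat t k) <= `|L| * N.+1%:R^-1.
  have [/andP[sN0 sNT] [h _]] := hs N.
  have le0 x : 0 <= x <= N.+1%:R^-1 -> L * x <= `|L| * N.+1%:R^-1.
    move=> /andP[x0 xN]; apply: (@le_trans _ _ (`|L| * x)); last exact: ler_wpM2l.
    by rewrite ler_wpM2r ?ler_norm.
  have [st|/ltW ts] := leP (s_ N) t.
  - have -> : normc (\hat (s_ N) k - \hat t k) = normc (\hat t k - \hat (s_ N) k).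
      by rewrite -normcN opprB.
    apply: le_trans (hL _ _ _ tT) _; first by rewrite (ltW sN0).
    by apply: le0; rewrite subr_ge0 st -[_ - _]opprB -(ler0_norm _) // subr_le0.
  - apply: le_trans (hL _ _ _ (ltW sNT)) _; first by rewrite t0.
    by apply: le0; rewrite subr_ge0 ts -(ger0_norm (_ : 0 <= s_ N - t)) // subr_ge0.
split; apply: cvg_of_le_harmonic => N; apply: le_trans (hN N).
  by rewrite -Re_N -Re_D; exact: Re_le_normc.
by rewrite -Im_N -Im_D; exact: Im_le_normc.
Qed.

Lemma flow_shift_alg (E0 Es Et i a w x y J X0 X1 : C) :
  X1 = Et * (a - i * w) -> X0 = E0 * (a - i * x) -> w = x + y ->
  Et = Es * E0 -> J = E0 * y -> X1 = Es * (X0 - i * J).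
Proof. by move=> -> -> -> -> ->; ring. Qed.

(** Duhamel's formula restarted at the time t0. *)
Lemma sol_flow r g t0 t : m = 1 + r + 2 * g -> 0 <= t0 -> 0 <= t -> t0 + t <= T ->
  duhamel_flow r c g sol_bound t (fun s => \hat (t0 + s)%R).
Proof.
move=> mE t00 t_ge0 tT.
have inT s : 0 <= s <= t -> 0 <= t0 + s <= T.
  by move=> /andP[s0 st]; rewrite addr_ge0 //= (le_trans _ tT) // lerD2l.
have m0 : 0 <= m by have := m2; lra.
have mm : m <= m + 2 by rewrite lerDl.
split=> [k|s hs|s k hs].
- by apply: (@cmeas_shift _ _ _ T (fun x => \hat x k)) => //; exact: sol_cmeas.
- by rewrite -mE; apply: sol_ball; exact: inT.
have /andP[s0 st] := hs; have hs' := inT s hs.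
have t0T : 0 <= t0 + 0 <= T by apply: inT; rewrite lexx.
rewrite addr0 in t0T *.
pose G x := expi (- (x * Bsym c k)) * nonlin_seq c (\hat x) k.
have subs := sub_set_0t (proj2 (andP hs')).
have mG : cmeas `[0, (t0 + s)%R] G.
  apply: cmeasM; first exact: cmeas_phase.
  exact: cmeas_sub (measurable_0t T) subs (sol_cmeas_nonlin k).
pose D := sol_bound + sol_bound; pose K := cmul c * D + conv_const m * (D * D).
have bG x : 0 <= x <= t0 + s -> normc (G x) <= K.
  move=> /andP[x0 xs]; rewrite normcM normc_expi mul1r.
  apply: (sob_le_pt k m0 (sob_nonlin m2 (lexx m) mm c0 (sol_ball _))).
  by rewrite x0 (le_trans xs) //; case/andP: hs'.
apply: (flow_shift_alg (sol_duhamel k hs') (sol_duhamel k t0T)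
  (cintegral_split t00 s0 mG bG)); first by rewrite -expiD; congr expi; ring.
rewrite -cintegralZ.
- apply: cintegral_eq => x _; rewrite /G mulrA -expiD; congr (expi _ * _); ring.
- exact: measurable_0t.
apply: (@cintegrable_ebounded _ _ _ K).
- exact: measurable_0t.
- exact: mu_itv_fin.
- exact: (cmeas_shift t00 (lexx _) mG).
apply: ebounded_pt => x /=; rewrite in_itv /= => /andP[x0 xs].
by apply: bG; rewrite lerD2l xs addr_ge0.
Qed.

End SolutionCoefficients.

(** * Convergence *)

Section Convergence.
Context {R : realType}.
Local Notation C := R[i].
Implicit Types (f : R -> C) (a : int -> C) (c r s t T M N K L g tau : R) (k : int).

(** Here X stands for exp(xL): the bound exp(xL) x d on the error at time x
    passes to time x + tau when a step adds tau d. *)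
Lemma gronwall_step L tau d x X : 0 <= L -> 0 <= tau -> 0 <= d -> 0 <= x ->
  1 <= X -> tau * d + (1 + tau * L) * (X * x * d) <= expR (tau * L) * X * (x + tau) * d.
Proof.
move=> L0 tau0 d0 x0 X1; have := expR_ge1Dx (tau * L).
have tl : 0 <= tau * L by rewrite mulr_ge0.
move: (expR _) => Y Y1.
have -> : Y * X * (x + tau) * d = Y * (X * x * d) + Y * X * (tau * d) by ring.
rewrite addrC; apply: lerD; first by rewrite ler_wpM2r // !mulr_ge0 // (le_trans _ X1).
rewrite ler_peMl ?mulr_ge0 //; nra.
Qed.

Lemma telescope_alg (x y z : C) : x - z = x - y + (y - z).
Proof. by rewrite addrA subrK. Qed.

(** As long as the bound on the error holds, it is at most 1 for small steps; the
    iterate is then in the ball of radius M + 1, on which the Lipschitz constant of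
    the next step is known. *)
Lemma global_error r c T M : 1 / 2 < r -> 0 < c -> 0 < T ->
  exists2 K, 0 <= K & exists2 tau0, 0 < tau0 & forall g tau (v : R -> int -> C),
  0 < g <= 1 -> 0 < tau <= tau0 ->
  (forall t, 0 <= t <= T -> sob_le r (v t) M) ->
  (forall t0, 0 <= t0 -> t0 + tau <= T ->
     duhamel_flow r c g M tau (fun s => v (t0 + s))) ->
  forall n, n%:R * tau <= T ->
  sob_le r (fun k => v (n%:R * tau) k - iter n (scheme c tau) (v 0) k)
    (K * tau `^ (1 + g)).
Proof.
move=> r2 c0 T0; have [L L0 hL] := scheme_stable (M + 1) r2 c0.
have [KL K0 hloc] := local_error M r2 c0.
pose E := expR (T * L) * (T * KL).
have T0' := ltW T0.
have E0 : 0 <= E by rewrite !mulr_ge0 // expR_ge0.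
(* At this step size the error bound E tau^(1 + g) is at most E tau <= 1. *)
exists E => //; exists (Num.min 1 (1 + E)^-1).
  by rewrite lt_min ltr01 invr_gt0; lra.
move=> g tau v hg /andP[tau_gt0]; rewrite le_min => /andP[tau1 tauE] hv hflow.
have tau_ge0 := ltW tau_gt0; have /andP[g0 g1] := hg.
have powE : tau `^ (1 + g) = tau * tau `^ g.
  by rewrite powRD ?powRr1 //; apply/implyP => _; rewrite gt_eqF.
have e1 : tau `^ g <= 1.
  by have := @ge0_ler_powR R g (ltW g0) tau 1; rewrite powR1; apply; rewrite ?nnegrE.
have e0 := powR_ge0 tau g.
pose d := tau * tau `^ g * KL.
have d0 : 0 <= d by rewrite !mulr_ge0.
pose bnd n := expR (n%:R * tau * L) * (n%:R * tau) * d.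
have bndE n : n%:R * tau <= T -> bnd n <= E * tau `^ (1 + g).
  move=> nT; rewrite powE /bnd /E.
  have nt0 : 0 <= n%:R * tau by rewrite mulr_ge0.
  have -> : expR (T * L) * (T * KL) * (tau * tau `^ g) = expR (T * L) * T * d.
    by rewrite /d; ring.
  by rewrite ler_wpM2r // ler_pM ?expR_ge0 // ler_expR ler_wpM2r.
have small : E * tau `^ (1 + g) <= 1.
  have E1 : 0 < 1 + E by lra.
  rewrite powE mulrA; apply: (@le_trans _ _ (E * tau)); first by rewrite ler_piMr ?mulr_ge0.
  apply: (@le_trans _ _ (E * (1 + E)^-1)); first by rewrite ler_wpM2l.
  by rewrite ler_pdivrMr // mul1r; lra.
have claim n : n%:R * tau <= T ->
    sob_le r (fun k => v (n%:R * tau) k - iter n (scheme c tau) (v 0) k) (bnd n).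
  elim: n => [_|n IH nT].
    apply: sob_le_eq (sob_le_weaken (lexx r) _ (sob_le0 r)).
      by move=> k; rewrite /= mul0r subrr.
    by rewrite /bnd !mul0r mulr0 mul0r.
  have n1 : n.+1%:R * tau = n%:R * tau + tau by rewrite -natr1 mulrDl mul1r.
  have nT' : n%:R * tau <= T by apply: le_trans nT; rewrite n1 lerDl.
  have nt0 : 0 <= n%:R * tau by rewrite mulr_ge0.
  have {}IH := IH nT'; set b := iter n (scheme c tau) (v 0) in IH.
  have ha : sob_le r (v (n%:R * tau)) M by apply: hv; rewrite nt0.
  have hb : sob_le r b (M + 1).
    apply: sob_le_eq (sob_le_weaken (lexx r) _ (sob_leB ha IH)).
      by move=> k; rewrite opprB addrC subrK.
    by rewrite lerD2l; apply: le_trans (bndE n nT') small.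
  have ha' : sob_le r (v (n%:R * tau)) (M + 1) by apply: sob_le_weaken ha => //; rewrite lerDl.
  have t01 : 0 < tau <= 1 by rewrite tau_gt0.
  have h1 := hL tau _ _ _ t01 ha' hb IH.
  have nT1 : n%:R * tau + tau <= T by rewrite -n1.
  have h2 := hloc g tau _ hg t01 (hflow _ nt0 nT1).
  rewrite /= addr0 in h2.
  apply: sob_le_eq (sob_le_weaken (lexx r) _ (sob_leD h2 h1)).
    by move=> k; rewrite /= -/b n1; exact: telescope_alg.
  rewrite -/d (_ : bnd n.+1 = expR (tau * L) * expR (n%:R * tau * L) *
    (n%:R * tau + tau) * d).
    2: by rewrite /bnd n1 (mulrDl (n%:R * tau)) expRD [expR (tau * L) * _]mulrC.
  by apply: gronwall_step => //; rewrite -[leLHS](@expR0 R) ler_expR mulr_ge0.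
by move=> n nT; apply: sob_le_weaken (claim n nT) => //; exact: bndE.
Qed.

Lemma iter_rep r c t f a n : 1 / 2 < r -> 0 < c -> 0 < t -> fourier_rep r f a ->
  fourier_rep r (iter n (integrator c t) f) (iter n (scheme c t) a).
Proof.
by move=> r2 c0 t0 fa; elim: n => //= n; exact: rep_scheme.
Qed.

Lemma rep_weaken r r' f a : r <= r' -> fourier_rep r' f a -> fourier_rep r f a.
Proof.
by move=> rr [mf fa [K aK]]; split => //; exists K; exact: sob_le_weaken aK.
Qed.

(** K serves for all exponents gamma and all solutions whose norm has the value
    N; only the step size bound may depend on them. *)
Definition convergence_bound c T r N K :=
  forall g (u : R -> R -> C), 0 < g <= 1 ->
  (forall t, 0 <= t <= T -> in_sobolev (1 + r + 2 * g) (u t)) ->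
  in_sobolev_Linfty T (1 + r + 2 * g) u -> duhamel_solution c T u ->
  fine (sobolev_Linfty_norm T (1 + r + 2 * g) u) = N ->
  exists tau0, 0 < tau0 /\ forall tau (n : nat), 0 < tau <= tau0 -> n%:R * tau <= T ->
  (sobolev_norm r (fun x => u (n%:R * tau)%R x - iter n (integrator c tau) (u 0%R) x)%R
   <= (K * tau `^ (1 + g))%:E)%E.

Lemma convergence_boundP c T r N : 0 < c -> 0 < T -> 1 / 2 < r ->
  exists K, convergence_bound c T r N K.
Proof.
move=> c0 T0 r2; have [K K0 [tau0 tau00 hK]] := global_error (Num.max N 0) r2 c0 T0.
exists K => g u hg hu huL hd hN; exists tau0; split=> // tau n htau nT.
have /andP[g0 g1] := hg; have /andP[tau_gt0 _] := htau.
have m2 : 1 / 2 < 1 + r + 2 * g by lra.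
have hr : r <= 1 + r + 2 * g by rewrite addrAC lerDr; lra.
have bE : sol_bound T (1 + r + 2 * g) u = Num.max N 0 by rewrite /sol_bound hN.
have nt0 : 0 <= n%:R * tau by rewrite mulr_ge0 // ltW.
have rep t : 0 <= t <= T -> fourier_rep r (u t) (fourier_coef (u t)).
  by move=> ht; apply: rep_weaken hr _; exact: (sol_rep m2 hu).
have r0 : fourier_rep r (u 0) (fourier_coef (u 0)) by apply: rep; rewrite lexx ltW.
have rn : fourier_rep r (u (n%:R * tau)) (fourier_coef (u (n%:R * tau))).
  by apply: rep; rewrite nt0.
have hrep := repB r2 rn (iter_rep n r2 c0 tau_gt0 r0).
apply/sobolev_normP; first by rewrite mulr_ge0 ?powR_ge0.
rewrite (rep_coef r2 hrep).
apply: (hK g tau (fun t => fourier_coef (u t)) hg htau _ _ n nT).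
  move=> t ht; apply: (sob_le_weaken hr (lexx _)).
  by rewrite -bE; apply: (sol_ball c0).
move=> t0 t00 ht0; rewrite -bE.
by apply: sol_flow => //; exact: ltW.
Qed.

End Convergence.

Theorem theorem4p3 (R : realType) :
  exists C : R -> R -> R -> R -> R,
  forall (c T r gamma : R) (u : R -> R -> R[i]),
  0 < c -> 0 < T -> 1 / 2 < r -> 0 < gamma <= 1 ->
  (forall t : R, 0 <= t <= T -> in_sobolev (1 + r + 2 * gamma) (u t)) ->
  in_sobolev_Linfty T (1 + r + 2 * gamma) u ->
  duhamel_solution c T u ->
  exists tau0 : R, 0 < tau0 /\
  forall (tau : R) (n : nat), 0 < tau <= tau0 -> n%:R * tau <= T ->
  (sobolev_norm r
     (fun x => u (n%:R * tau)%R x - iter n (integrator c tau) (u 0%R) x)%R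
   <= (C T c r (fine (sobolev_Linfty_norm T (1 + r + 2 * gamma)%R u))
       * tau `^ (1 + gamma))%:E)%E.

Proof.
(* The constant precedes the hypotheses on c, T and r: it is 0 when they fail. *)
have ex (c T r N : R) : exists K, 0 < c -> 0 < T -> 1 / 2 < r ->
    convergence_bound c T r N K.
  have [[c0 T0 r2]|no] := pselect [/\ 0 < c, 0 < T & 1 / 2 < r].
    by have [K hK] := convergence_boundP N c0 T0 r2; exists K.
  by exists 0 => c0 T0 r2; exfalso; apply: no.
exists (fun T c r N => projT1 (cid (ex c T r N))).
move=> c T r g u c0 T0 r2 hg hu huL hd.
have := projT2 (cid (ex c T r (fine (sobolev_Linfty_norm T (1 + r + 2 * g) u)))).
by move/(_ c0 T0 r2 g u hg hu huL hd erefl).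
Qed.
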